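(* For all positive integers $k,h,n$ and sufficiently small $\varepsilon>0$, every $K_h$-minor-free weighted graph $G$ on $n$ vertices admits a $(1+\varepsilon)(2k-1)$-spanner $H$ with lightness $$O\left(h^{\frac{2}{k+1}}\cdot \mathrm{polylog}(h)\cdot \frac{1}{\varepsilon^3}\log\frac{1}{\varepsilon}\right).$$
   Context: A weighted graph has positive real edge weights; $\mathrm{dist}_G(u,v)$ is the weighted shortest-path distance. For a real $t\ge1$, a $t$-spanner of $G$ is a subgraph $H\subseteq G$ on the same vertex set with $\mathrm{dist}_H(u,v)\le t\cdot\mathrm{dist}_G(u,v)$ for all vertices $u,v$. The lightness of $H$ is $w(H)/w(\mathrm{MST}(G))$, where $w(\cdot)$ is total edge weight and $\mathrm{MST}(G)$ is a minimum spanning tree of $G$. $\mathrm{polylog}(h)$ denotes a factor bounded by a polynomial in $\log h$; the $O$ hides absolute constants. *)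

(* Defs.v *)
From HB Require Import structures.
From mathcomp Require Import all_boot all_order all_algebra.
From mathcomp Require Import all_classical all_reals all_analysis.

Set Implicit Arguments.
Unset Strict Implicit.
Unset Printing Implicit Defensive.

Import Order.TTheory GRing.Theory Num.Theory.

Local Open Scope ring_scope.

(* Finite simple graphs: an edge set [E : {set {set V}}] consists of 2-element
   vertex sets, so a subgraph on the same vertex set is just a subset of [E]. *)
Record wgraph (R : realType) (V : finType) := WGraph {
  edges : {set {set V}};
  wt : {set V} -> R;
  edges_card2 : forall e, e \in edges -> #|e| = 2%N;
  wt_gt0 : forall e, e \in edges -> 0 < wt e
}.

Definition adj (V : finType) (E : {set {set V}}) : rel V :=
  fun x y => [set x; y]%SET \in E.

Definition connected_in (V : finType) (E : {set {set V}}) (S : {set V}) :=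
  forall x y, x \in S -> y \in S ->
    connect [rel a b | [&& a \in S, b \in S & adj E a b]] x y.

Definition is_minor (U V : finType) (A : {set {set U}}) (E : {set {set V}}) :=
  exists B : U -> {set V},
    [/\ forall u, B u != finset.set0,
        forall u, connected_in E (B u),
        forall u v, u != v -> [disjoint B u & B v] &
        forall u v, adj A u v ->
          exists x y, [/\ x \in B u, y \in B v & adj E x y]].

Definition complete_edges (h : nat) : {set {set 'I_h}} :=
  [set e : {set 'I_h} | #|e| == 2%N]%SET.

Definition clique_minor_free (h : nat) (V : finType) (E : {set {set V}}) :=
  ~ is_minor (complete_edges h) E.

Section WeightedGraph.
Variables (R : realType) (V : finType) (G : wgraph R V).

Definition weight (F : {set {set V}}) : R := \sum_(e in F) wt G e.

Definition walk_weight (u : V) (p : seq V) : R :=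
  \sum_(c <- pairmap (fun x y => wt G [set x; y]%SET) u p) c.

(* The distance is [+oo] between distinct components of [F]. *)
Definition dist (F : {set {set V}}) (u v : V) : \bar R :=
  ereal_inf [set d | exists p : seq V,
    [/\ path (adj F) u p, last u p = v & d = (walk_weight u p)%:E]]%classic.

Definition is_spanner (t : R) (H : {set {set V}}) :=
  H \subset edges G /\
  forall u v, (dist H u v <= t%:E * dist (edges G) u v)%E.

Definition acyclic (F : {set {set V}}) :=
  forall c : seq V, (3 <= size c)%N -> ~ ucycle (adj F) c.

(* For connected [G] this is a spanning tree; for disconnected [G] it is a
   spanning forest with one tree per component. *)
Definition spanning_tree (T : {set {set V}}) :=
  [/\ T \subset edges G, acyclic T &
      forall x y, connect (adj T) x y = connect (adj (edges G)) x y].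

Definition is_mst (T : {set {set V}}) :=
  spanning_tree T /\ forall T', spanning_tree T' -> weight T <= weight T'.

(* [T] is meant to be a minimum spanning tree; all of them have the same
   weight.  If that weight is 0 then [G] has no edges and the ratio is 0. *)
Definition lightness (T H : {set {set V}}) : R := weight H / weight T.

End WeightedGraph.

Definition is_polylog (R : realType) (f : nat -> R) :=
  exists p : {poly R}, forall h, (0 < h)%N -> `|f h| <= p.[ln h%:R].

(* Main.v *)
Require Import Defs.
From mathcomp Require Import all_boot all_order all_algebra.
From mathcomp Require Import zify ring lra.
From mathcomp Require Import reals.

Set Implicit Arguments.
Unset Strict Implicit.
Unset Printing Implicit Defensive.

(* Sparsity.  A maximal subgraph of girth more than [2 * k] is a
   [(2 * k - 1)]-spanner in the hop metric.  If it had average degree [D], carve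
   disjoint balls of radius about [k / 2] out of it; since short paths are unique,
   two balls are joined by at most one edge, up to few collisions when [k] is
   even, so contracting them yields a minor on about [n / D ^ (k / 2)] of the [n]
   vertices with almost all the edges.  A graph of average degree
   [O(h * log h)] has a [K_h] minor, hence [D ^ (k + 1) = O(h * log h) ^ 2].

   Lightness.  Split the edges into weight classes of ratio [1 + eps] and treat
   every [J]-th class separately, [J = O(log (1 / eps) / eps)], so that consecutive
   scales [L] differ by a factor [1 / eps].  Maintain a weighted forest on
   contracted clusters, initially the minimum spanning tree, whose weight serves
   as a potential.  At scale [L], prune its short leaves and take an
   [eps * L]-separated net of the endpoints of the edges that are not yet spanned.
   The Voronoi cells of the net are branch sets of a minor, whose sparse spanner
   provides [O(D)] edges per net point.  Each net point is paid for by a potential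
   drop of order [eps ^ 2 * L]: either it is close to a leaf or a branching vertex,
   and these are few because pruning paid for the leaves, or it lies on a long bare
   path, a piece of which is traded for one of the new edges. *)

(** * Clique minors in dense graphs *)

(** Carving loses the edges at vertices left outside the clusters, and these could be all the edges
    that matter. Random cuts therefore produce four parts: clusters grow in [P1], [Q1] and in [P2],
    [Q2], only the edges between [Q1] and [Q2] are counted, and a vertex of [Q1] has at least as
    many neighbours in [P1] as in [Q2], and symmetrically. Counted edges that get lost are then
    charged to edges inside a part, whose loss carving bounds. For odd [k] the radius is
    [(k - 1) / 2]. For even [k] the radius [k / 2] is half a step too large for unique crossings;
    keeping one branch in about [sqrt D] makes collisions rare, and the factor [sqrt D] lost in this
    way is what the exponent [k + 1] allows.

    For lightness, one forest serves all scales of a residue class, so the drops of its weight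
    telescope to the weight of the spanning tree. A drop of [eps ^ 2 * L] against [O(D)] new edges
    of weight at most [L] gives [D / eps ^ 2] per class; the number [J] of classes supplies the
    third factor [1 / eps] and the logarithm. *)

Definition nbr (T : finType) (e : rel T) (S : {set T}) (x : T) : {set T} :=
  [set y in S | e x y].

Definition within (T : finType) (e : rel T) (S : {set T}) : rel T :=
  fun a b => [&& a \in S, b \in S & e a b].
Arguments within T e S a b /.

Definition conn (T : finType) (e : rel T) (S : {set T}) : Prop :=
  forall x y, x \in S -> y \in S -> connect (within e S) x y.

Definition narcs (T : finType) (e : rel T) (S : {set T}) : nat :=
  \sum_(x in S) #|nbr e S x|.

Definition minor_on (U T : finType) (e' : rel U) (S : {set U}) (e : rel T) :=
  exists B : U -> {set T},
    [/\ forall u, u \in S -> B u != set0,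
        forall u, u \in S -> conn e (B u),
        forall u v, u \in S -> v \in S -> u != v -> [disjoint B u & B v] &
        forall u v, u \in S -> v \in S -> u != v -> e' u v ->
          exists x y, [/\ x \in B u, y \in B v & e x y]].

Definition Kminor_on (T : finType) (h : nat) (e : rel T) (S : {set T}) :=
  exists B : 'I_h -> {set T},
    [/\ forall i, B i \subset S, forall i, B i != set0,
        forall i, conn e (B i),
        forall i j, i != j -> [disjoint B i & B j] &
        forall i j, i != j -> exists x y, [/\ x \in B i, y \in B j & e x y]].

Section Basics.
Variable T : finType.
Implicit Types (e : rel T) (S : {set T}).

Lemma within_sub e (S S' : {set T}) : S \subset S' -> subrel (within e S) (within e S').
Proof.
by move=> /subsetP sSS' a b /and3P[aS bS eab]; rewrite /= !sSS'.
Qed.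

Lemma connect_within e (S S' : {set T}) x y : S \subset S' ->
  connect (within e S) x y -> connect (within e S') x y.
Proof.
by move=> sSS'; apply: connect_sub => a b /(within_sub sSS'); apply: connect1.
Qed.

Lemma conn1 e x : conn e [set x].
Proof. by move=> a b /set1P-> /set1P->. Qed.

Lemma connU e S S' : symmetric e -> conn e S -> conn e S' ->
  (exists x y, [/\ x \in S, y \in S' & (x == y) || e x y]) -> conn e (S :|: S').
Proof.
move=> syme cS cS' [x [y [xS yS' exy]]].
have cxy : connect (within e (S :|: S')) x y.
  case/orP: exy => [/eqP->//|exy]; apply: connect1.
  by rewrite /= !inE xS yS' exy orbT.
have symw : symmetric (within e (S :|: S')).
  by move=> a b; rewrite /= syme andbCA.
have csym := sym_connect_sym symw.
have toS a : a \in S :|: S' -> connect (within e (S :|: S')) a x.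
  case/setUP => [aS|aS'].
    by apply: connect_within (cS _ _ aS xS); apply: subsetUl.
  rewrite csym; apply: connect_trans cxy _.
  by apply: connect_within (cS' _ _ yS' aS'); apply: subsetUr.
by move=> a b /toS ax /toS bx; apply: connect_trans ax _; rewrite csym.
Qed.

Lemma connU1 e S x : symmetric e -> conn e S ->
  (exists2 y, y \in S & e x y) -> conn e (x |: S).
Proof.
move=> syme cS [y yS exy]; apply: connU => //; first exact: conn1.
by exists x, y; rewrite set11 yS exy orbT.
Qed.

Lemma conn_rel e e' S : {in S &, subrel e e'} -> conn e S -> conn e' S.
Proof.
move=> see' cS x y xS yS; apply: (@connect_sub _ (within e S)); last exact: cS.
move=> a b /and3P[aS bS eab]; apply: connect1.
by rewrite /= aS bS /=; apply: see'.
Qed.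

Lemma minor_on_refl e S : minor_on e S e.
Proof.
exists (fun x => [set x]); split=> [u _|u _|u v _ _ uv|u v _ _ _ euv].
- by apply/set0Pn; exists u; rewrite set11.
- exact: conn1.
- by rewrite disjoints1 inE.
- by exists u, v; rewrite !set11.
Qed.

Lemma minor_on_sub (U : finType) (e' : rel U) (S S' : {set U}) e :
  S' \subset S -> minor_on e' S e -> minor_on e' S' e.
Proof.
move=> /subsetP sS [B [B0 Bc Bd Ba]]; exists B; split.
- by move=> u /sS/B0.
- by move=> u /sS/Bc.
- by move=> u v /sS ? /sS ?; apply: Bd.
- by move=> u v /sS ? /sS ?; apply: Ba.
Qed.

End Basics.

Lemma conn_bigcup (U T : finType) (e' : rel U) (e : rel T) (A : {set U})
    (B : U -> {set T}) : symmetric e ->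
  (forall u, u \in A -> conn e (B u)) ->
  (forall u v, u \in A -> v \in A -> e' u v ->
     exists x y, [/\ x \in B u, y \in B v & (x == y) || e x y]) ->
  conn e' A -> conn e (\bigcup_(u in A) B u).
Proof.
move=> syme Bc Ba cA x y /bigcupP[u uA xu] /bigcupP[v vA yv].
case/connectP: (cA _ _ uA vA) => p pp lp.
elim: p u uA x xu pp lp => [|w p IH] u uA x xu /=.
  move=> _ uv; subst u; apply: connect_within (Bc _ uA _ _ xu yv).
  exact: (bigcup_sup v).
case/andP => /and3P[_ wA euw] pp lp.
have [a [b [au bw eab]]] := Ba _ _ uA wA euw.
apply: (@connect_trans _ _ a).
  by apply: connect_within (Bc _ uA _ _ xu au); apply: (bigcup_sup u).
have cb := IH w wA b bw pp lp.
case/orP: eab => [/eqP->//|eab]; apply: connect_trans cb; apply: connect1.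
rewrite /= eab andbT; apply/andP; split; apply/bigcupP.
  by exists u.
by exists w.
Qed.

Lemma Kminor_lift (U T : finType) (h : nat) (e' : rel U) (S : {set U})
    (e : rel T) : symmetric e -> irreflexive e' ->
  minor_on e' S e -> Kminor_on h e' S -> Kminor_on h e [set: T].
Proof.
move=> syme irr' [B [B0 Bc Bd Ba]] [C [CS C0 Cc Cd Ca]].
have memS i u : u \in C i -> u \in S by apply/subsetP/CS.
exists (fun i => \bigcup_(u in C i) B u); split.
- by move=> i; apply: subsetT.
- move=> i; case/set0Pn: (C0 i) => u uC; case/set0Pn: (B0 u (memS _ _ uC)) => x xB.
  by apply/set0Pn; exists x; apply/bigcupP; exists u.
- move=> i; apply: (conn_bigcup (e' := e')) => //.
    by move=> u /memS; apply: Bc.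
  move=> u v uC vC euv.
  have uv : u != v by apply: contraTneq euv => ->; rewrite irr'.
  have [x [y [? ? exy]]] := Ba _ _ (memS _ _ uC) (memS _ _ vC) uv euv.
  by exists x, y; rewrite exy orbT.
- move=> i j ij; rewrite disjoint_sym; apply/bigcup_disjoint => u uC.
  rewrite disjoint_sym; apply/bigcup_disjoint => v vC.
  apply: Bd; [exact: memS uC|exact: memS vC|].
  apply/eqP=> uv; have := Cd _ _ ij; rewrite -setI_eq0 => /eqP/setP/(_ u).
  by rewrite !inE uC uv vC.
- move=> i j ij; have [u [v [uC vC euv]]] := Ca _ _ ij.
  have uv : u != v by apply: contraTneq euv => ->; rewrite irr'.
  have [x [y [xB yB exy]]] := Ba _ _ (memS _ _ uC) (memS _ _ vC) uv euv.
  by exists x, y; split=> //; apply/bigcupP; [exists u|exists v].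
Qed.

(** [y] becomes isolated and [x] inherits its neighbours, so the vertex type stays [T] while the
    vertex set shrinks to [S :\ y]. *)
Definition contract (T : finType) (e : rel T) (x y : T) : rel T :=
  fun a b => [&& a != y, b != y, a != b &
    [|| e a b, (a == x) && e y b | (b == x) && e a y]].
Arguments contract T e x y a b /.

Section Contraction.
Variables (T : finType) (e : rel T) (S : {set T}) (x y : T).
Hypotheses (syme : symmetric e) (irre : irreflexive e).
Hypotheses (xS : x \in S) (yS : y \in S) (exy : e x y).

Let common := nbr e S x :&: nbr e S y.

Lemma contract_sym : symmetric (contract e x y).
Proof.
move=> a b; rewrite /= (eq_sym b a) (syme b a) (syme b y) (syme y a).
case: (a == y); case: (b == y); case: (a == b) => //=.
by case: (e a b) => //=; rewrite orbC.
Qed.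

Lemma contract_irr : irreflexive (contract e x y).
Proof. by move=> a; rewrite /= eqxx /= !andbF. Qed.

Lemma neq_xy : x != y.
Proof. by apply: contraTneq exy => ->; rewrite irre. Qed.

Lemma minor_on_contract (T0 : finType) (e0 : rel T0) : symmetric e0 ->
  minor_on e S e0 -> minor_on (contract e x y) (S :\ y) e0.
Proof.
move=> sym0 [B [B0 Bc Bd Ba]].
have xy := neq_xy.
exists (fun u => if u == x then B x :|: B y else B u); split.
- move=> u /setD1P[uy uS]; case: ifP => _; last exact: B0.
  by case/set0Pn: (B0 _ xS) => z zB; apply/set0Pn; exists z; rewrite inE zB.
- move=> u /setD1P[uy uS]; case: ifP => _; last exact: Bc.
  apply: connU => //; try exact: Bc.
  by have [a [b [? ? ab]]] := Ba _ _ xS yS xy exy; exists a, b; rewrite ab orbT.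
- move=> u v /setD1P[uy uS] /setD1P[vy vS].
  case: (eqVneq u x) => [ux|ux]; case: (eqVneq v x) => [vx|vx] uv.
  + by rewrite ux vx eqxx in uv.
  + rewrite disjoint_sym disjoints_subset setCU subsetI -!disjoints_subset.
    by rewrite !Bd // 1?eq_sym.
  + rewrite disjoints_subset setCU subsetI -!disjoints_subset.
    by rewrite !Bd.
  + exact: Bd.
- move=> u v /setD1P[uy uS] /setD1P[vy vS] uv /and4P[_ _ _].
  have key a b : a \in S -> b \in S -> a != b -> e a b -> exists z t,
      [/\ z \in B a, t \in B b & e0 z t] by move=> *; apply: Ba.
  case: (eqVneq u x) => [ux|ux]; case: (eqVneq v x) => [vx|vx] /=.
  + by rewrite ux vx eqxx in uv.
  + move: uS uy uv; rewrite ux => uS uy uv.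
    rewrite orbF => /orP[] euv.
      have [z [t [? ? ?]]] := key _ _ xS vS uv euv.
      by exists z, t; rewrite !inE; split=> //; apply/orP; left.
    have yv : y != v by rewrite eq_sym.
    have [z [t [? ? ?]]] := key _ _ yS vS yv euv.
    by exists z, t; rewrite !inE; split=> //; apply/orP; right.
  + move: vS vy uv; rewrite vx => vS vy uv /orP[] euv.
      have [z [t [? ? ?]]] := key _ _ uS xS ux euv.
      by exists z, t; rewrite !inE; split=> //; apply/orP; left.
    have [z [t [? ? ?]]] := key _ _ uS yS uy euv.
    by exists z, t; rewrite !inE; split=> //; apply/orP; right.
  + by rewrite !orbF; apply: key.
Qed.

(** The edge between [x] and [y] accounts for 2 arcs, and at each common neighbour two edges merge
    into one, which again costs 2 arcs. *)
Lemma narcs_contract :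
  narcs e S <= narcs (contract e x y) (S :\ y) + 2 * #|common| + 2.
Proof.
have xy := neq_xy.
have xS' : x \in S :\ y by rewrite !inE xy.
rewrite /narcs (bigD1 y) //= (bigD1 x) ?xS //=.
rewrite [X in _ <= X + _ + _](bigD1 x xS') /=.
have hx : #|nbr e S y| + #|nbr e S x| <=
   #|nbr (contract e x y) (S :\ y) x| + #|common| + 2.
  rewrite addnC -cardsUI -/common -!addnA [_ + 2]addnC addnA leq_add2r.
  have sub : nbr e S x :|: nbr e S y \subset
      nbr (contract e x y) (S :\ y) x :|: [set x; y].
    apply/subsetP => z; rewrite !inE ?eqxx /=.
    move=> H; case: (boolP (z == x)) => zx; first by apply/orP; right.
    case: (boolP (z == y)) => zy; first by apply/orP; right; rewrite orbT.
    apply/orP; left; rewrite xy (eq_sym x) zx.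
    by case/orP: H => /andP[-> ->]; rewrite /= ?eqxx ?orbT /= ?orbT.
  apply: leq_trans (subset_leq_card sub) _.
  by apply: leq_trans (leq_card_setU _ _) _; rewrite leq_add2l cards2; case: eqP.
pose P i := (i \in S) && ((i != y) && (i != x)).
have hc : #|common| = \sum_(i | P i) (e x i && e y i : nat).
  rewrite -sum1_card big_mkcond [RHS]big_mkcond; apply: eq_bigr => i _.
  rewrite /P /common !inE; case: (i \in S) => //=.
  case: (eqVneq i y) => [->|_] /=; first by rewrite irre andbF.
  by case: (eqVneq i x) => [->|_] /=; [rewrite irre | case: (e x i && e y i)].
have hr : \sum_(i | P i) #|nbr e S i| <=
   \sum_(i | P i) #|nbr (contract e x y) (S :\ y) i| + #|common|.
  rewrite hc -big_split /=; apply: leq_sum => a /and3P[aS ay ax].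
  have hsub : nbr e S a \subset nbr (contract e x y) (S :\ y) a :|: [set y].
    apply/subsetP => z; rewrite !inE => /andP[zS eaz].
    case: (eqVneq z y) => [->|zy]; first by rewrite orbT.
    rewrite zS /= ay zy eaz /= andbT orbF.
    by apply: contraTneq eaz => ->; rewrite irre.
  case: (boolP (e y a)) => eya; last first.
    rewrite andbF addn0; apply: subset_leq_card.
    apply/subsetP=> z zN; move/subsetP/(_ z zN): hsub; rewrite inE => /orP[//|/set1P zy].
    by move: zN; rewrite zy inE syme (negbTE eya) andbF.
  rewrite andbT; case: (boolP (e x a)) => exa.
    apply: leq_trans (subset_leq_card hsub) _.
    by apply: leq_trans (leq_card_setU _ _) _; rewrite cards1.
  rewrite addn0.
  have sub2 : x |: (nbr e S a :\ y) \subset nbr (contract e x y) (S :\ y) a.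
    apply/subsetP => z /setU1P[->|].
      by rewrite !inE /= xy xS ay ax eqxx (syme a y) eya !orbT.
    rewrite !inE /= => /and3P[zy zS eaz]; rewrite zy zS ay eaz /= andbT.
    by apply: contraTneq eaz => ->; rewrite irre.
  apply: leq_trans (subset_leq_card sub2).
  rewrite cardsU1 !inE xy xS /= syme (negbTE exa) /= add1n.
  by rewrite (cardsD1 y) !inE yS syme eya.
rewrite (eq_bigl P); last by move=> i; rewrite /P andbA.
rewrite [X in _ <= _ + X + _ + _](eq_bigl P); last first.
  move=> i; change ((i \in S :\ y) && (i != x) = P i).
  by rewrite /P !inE; case: (i \in S); case: (i == y).
lia.
Qed.

End Contraction.

Definition earcs (T : finType) (e : rel T) (A B : {set T}) : nat :=
  \sum_(x in A) #|nbr e B x|.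

Section Count.
Variables (T : finType) (e : rel T).
Hypothesis syme : symmetric e.

Lemma cardsU1_le x (A : {set T}) : #|x |: A| <= #|A|.+1.
Proof. by rewrite cardsU1; case: (x \notin A). Qed.

Lemma nbr_sub S x : nbr e S x \subset S.
Proof. by apply/subsetP => z; rewrite inE => /andP[]. Qed.

Lemma earcsC A B : earcs e A B = earcs e B A.
Proof.
have E C D : earcs e C D = \sum_(x in C) \sum_(y in D) (e x y : nat).
  apply: eq_bigr => x _; rewrite -sum1_card big_mkcond [RHS]big_mkcond.
  by apply: eq_bigr => y _; rewrite inE; case: (y \in D) => //=; case: (e x y).
rewrite !E exchange_big; apply: eq_bigr => x _; apply: eq_bigr => y _.
by rewrite syme.
Qed.

Lemma narcs_rem (S : {set T}) x : x \in S ->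
  narcs e S <= narcs e (S :\ x) + 2 * #|nbr e S x|.
Proof.
move=> xS; rewrite /narcs (big_setD1 x xS) /= mulSn mul1n addnCA leq_add2l.
have -> : #|nbr e S x| = \sum_(i in S) (e x i : nat).
  rewrite -sum1_card big_mkcond [RHS]big_mkcond /=; apply: eq_bigr => i _.
  by rewrite inE; case: (i \in S) => //=; case: (e x i).
rewrite (big_setD1 x xS) /= addnCA -[X in X <= _]add0n leq_add // -big_split /=.
apply: leq_sum => i iS; rewrite (cardsD1 x (nbr e S i)) inE xS /= addnC syme.
rewrite leq_add2r subset_leq_card //; apply/subsetP => z.
by rewrite !inE => /and3P[-> -> ->].
Qed.

(** Delete vertices of degree below [d] while there are any: each deletion costs fewer than [2 * d]
    arcs, so the surplus of arcs survives and the set cannot become empty. *)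
Lemma core (d : nat) (S : {set T}) : 2 * d * #|S| < narcs e S ->
  exists S' : {set T}, [/\ S' \subset S, S' != set0 & forall x, x \in S' -> d <= #|nbr e S' x|].
Proof.
have [n] := ubnP #|S|; elim: n S => // n IH S; rewrite ltnS => Sn H.
case: (boolP [forall x in S, d <= #|nbr e S x|]) => [/forallP P|].
  exists S; split=> //; last by move=> x xS; have /implyP := P x; apply.
  apply: contraTneq H => ->; rewrite /narcs big_set0; lia.
rewrite negb_forall => /existsP[x]; rewrite negb_imply -ltnNge => /andP[xS lx].
have cS := cardsD1 x S; rewrite xS add1n in cS; rewrite cS in Sn H.
have hn := narcs_rem xS.
have [||S' [sS' S'0 P]] := IH (S :\ x); first exact: Sn.
  by move: H hn lx; rewrite mulnS; lia.
by exists S'; split=> //; apply: subset_trans sS' (subsetDl _ _).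
Qed.

Lemma connect_cross (r : rel T) (P : {set T}) a b :
  connect r a b -> a \in P -> b \notin P ->
  exists z z', [/\ r z z', z \in P & z' \notin P].
Proof.
case/connectP => p pp ->; elim: p a pp => [|c p IH] a /=; first by move=> _ ->.
move=> /andP[rac pp] aP lP; case: (boolP (c \in P)) => cP; first exact: IH pp cP lP.
by exists a, c.
Qed.

(** By double counting, some vertex sees a quarter of the vertices not yet dominated, so each choice
    shrinks their number by a factor [3 / 4]. *)
Lemma greedy_dominating (Z : {set T}) t : 0 < #|Z| ->
  (forall v, v \in Z -> #|Z| <= 4 * #|nbr e Z v|) ->
  exists D : {set T}, [/\ D \subset Z, #|D| <= t &
    4 ^ t * #|[set v in Z | [forall d in D, ~~ e v d]]| <= 3 ^ t * #|Z|].
Proof.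
move=> Z0 deg; elim: t => [|t [D [DZ Dt HD]]].
  exists set0; rewrite sub0set cards0 !expn0 !mul1n; split=> //.
  by apply: subset_leq_card; apply/subsetP => z; rewrite inE => /andP[].
set Q := [set v in Z | _] in HD.
have [x xZ hx] : exists2 x, x \in Z & #|Q| <= 4 * #|nbr e Q x|.
  apply/exists_inP; apply: contraT; rewrite negb_exists_in => /forall_inP N.
  have l1 : 4 * earcs e Z Q + #|Z| <= #|Z| * #|Q|.
    rewrite /earcs big_distrr /= -sum1_card -big_split /= big_distrl /=.
    by apply: leq_sum => z /N; rewrite -ltnNge mul1n addn1.
  have l2 : #|Q| * #|Z| <= 4 * earcs e Z Q.
    rewrite earcsC /earcs big_distrr /= -sum1_card big_distrl /=.
    by apply: leq_sum => z; rewrite inE mul1n => /andP[/deg].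
  by nia.
exists (x |: D); split.
- by rewrite subUset sub1set xZ.
- by rewrite cardsU1; case: (x \notin D); rewrite ?add1n ?add0n // ltnW.
set Q' := [set v in Z | _].
have sQ' : Q' \subset Q :\: nbr e Q x.
  apply/subsetP => v; rewrite !inE => /andP[vZ /forall_inP N].
  have nex : ~~ e x v by rewrite syme N ?setU11.
  rewrite vZ (negbTE nex) andbF /=.
  by apply/forall_inP => d dD; apply: N; rewrite inE dD orbT.
have := subset_leq_card sQ'; rewrite cardsD.
have -> : Q :&: nbr e Q x = nbr e Q x.
  exact/setIidPr/nbr_sub.
move=> hQ'; have h4 : 4 * #|Q'| <= 3 * #|Q| by move: hQ' hx; lia.
apply: leq_trans (_ : 4 ^ t * (3 * #|Q|) <= _).
  by rewrite expnSr -mulnA leq_mul2l h4 orbT.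
by rewrite mulnCA expnS -mulnA leq_mul2l HD orbT.
Qed.

(** The condition on [t] makes the greedy set dominate all of [Z]. Its members are then joined one
    by one, each at the price of two connecting vertices, hence [3 * t]. *)
Lemma dominating_conn (Z : {set T}) t : 0 < #|Z| -> conn e Z ->
  (forall v, v \in Z -> #|Z| <= 4 * #|nbr e Z v|) -> 3 ^ t * #|Z| < 4 ^ t ->
  exists D : {set T}, [/\ D \subset Z, conn e D, #|D| <= 3 * t &
    forall v, v \in Z -> exists2 d, d \in D & e v d].
Proof.
move=> Z0 cZ deg ht.
have [D0 [D0Z D0t HD]] := greedy_dominating t Z0 deg.
have dom v : v \in Z -> exists2 d, d \in D0 & e v d.
  move=> vZ; apply/exists_inP; apply: contraLR ht; rewrite negb_exists_in -leqNgt => N.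
  apply: leq_trans HD; rewrite -[X in X <= _]muln1 leq_mul2l; apply/orP; right.
  by apply/card_gt0P; exists v; rewrite inE vZ.
have [z0 z0Z] := card_gt0P Z0.
have [d0 d0D _] := dom _ z0Z.
have hasn v : v \in Z -> exists2 u, u \in Z & e v u.
  move=> vZ; have := deg v vZ; case: (posnP #|nbr e Z v|) => [->|]; first lia.
  by case/card_gt0P => u; rewrite inE => /andP[uZ evu] _; exists u.
have grow j : j <= #|D0| -> exists D : {set T}, [/\ D \subset Z, conn e D,
    #|D| <= 3 * #|D :&: D0| & j <= #|D :&: D0|] /\ D :&: D0 != set0.
  elim: j => [|j IH] jD.
    exists [set d0]; split; last by apply/set0Pn; exists d0; rewrite !inE eqxx.
    split=> //; first by rewrite sub1set (subsetP D0Z).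
      exact: conn1.
    by rewrite (setIidPl _) ?sub1set // cards1.
  have [D [[DZ cD sD jle] ne]] := IH (ltnW jD).
  have [|jlt] := ltnP j #|D :&: D0|; first by exists D.
  have : ~~ (D0 \subset D).
    apply/negP => sub; move: jlt jD; rewrite (setIidPr sub); lia.
  case/subsetPn => d1 d1D0 d1D.
  pose P := [set z in Z | [exists d in D :&: D0, e z d]].
  pose P' := [set z in Z | [exists d in D0 :\: D, e z d]].
  have PP' z : z \in Z -> (z \in P) || (z \in P').
    move=> zZ; have [d dD0 ezd] := dom z zZ; rewrite !inE zZ /=.
    case: (boolP (d \in D)) => dD; apply/orP; [left|right]; apply/exists_inP;
      by exists d; rewrite // !inE dD0 dD.
  have [a aP] : exists a, a \in P.
    case/set0Pn: ne => d dDD; have [u uZ edu] := hasn d (subsetP D0Z _ (subsetP (subsetIr _ _) _ dDD)).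
    by exists u; rewrite inE uZ /=; apply/exists_inP; exists d; rewrite // syme.
  have [b bP] : exists b, b \in P'.
    have [u uZ edu] := hasn d1 (subsetP D0Z _ d1D0).
    exists u; rewrite inE uZ /=; apply/exists_inP; exists d1; last by rewrite syme.
    by rewrite inE d1D d1D0.
  (* The neighbourhoods [P] of the joined and [P'] of the remaining dominating vertices cover the
     connected set [Z], so they meet or an edge joins them. *)
  have [z [z' [zP zP' zz']]] : exists z z', [/\ z \in P, z' \in P' & (z' == z) || e z' z].
    case: (boolP (b \in P)) => bPP; first by exists b, b; rewrite eqxx.
    have aZ : a \in Z by move: aP; rewrite inE => /andP[].
    have bZ : b \in Z by move: bP; rewrite inE => /andP[].
    have [z [z' [/and3P[zZ z'Z ezz'] zP z'P]]] := connect_cross (cZ _ _ aZ bZ) aP bPP.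
    exists z, z'; split=> //; first by have := PP' _ z'Z; rewrite (negbTE z'P).
    by rewrite syme ezz' orbT.
  move: zP; rewrite inE => /andP[zZ /exists_inP[d dDD ezd]].
  move: zP'; rewrite inE => /andP[z'Z /exists_inP[d' d'D ez'd']].
  have d'Z : d' \in Z by apply: (subsetP D0Z); move: d'D; rewrite inE => /andP[].
  exists (d' |: (z' |: (z |: D))); split; last first.
    apply/set0Pn; exists d'; rewrite !inE eqxx /=.
    by move: d'D; rewrite inE => /andP[].
  have cc : #|(d' |: (z' |: (z |: D))) :&: D0| >= (#|D :&: D0|).+1.
    have := subset_leq_card (_ : d' |: (D :&: D0) \subset (d' |: (z' |: (z |: D))) :&: D0).
    rewrite cardsU1 !inE; move: d'D; rewrite inE => /andP[/negbTE-> d'D0] /=.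
    rewrite add1n; apply; apply/subsetP => v; rewrite !inE.
    by case/orP => [/eqP->|/andP[-> ->]]; rewrite ?eqxx ?d'D0 ?orbT.
  split.
  - by rewrite !subUset !sub1set d'Z z'Z zZ.
  - have dD : d \in D by move: dDD; rewrite inE => /andP[].
    apply: connU1 => //; last by exists z'; rewrite ?setU11 // syme.
    apply: connU => //; first exact: conn1.
      by apply: connU1 => //; exists d.
    by exists z', z; rewrite !set11 setU11.
  - apply: leq_trans (_ : #|D| + 3 <= _).
      rewrite addn3; do 3![apply: leq_trans (cardsU1_le _ _) _; rewrite ltnS].
      exact: leqnn.
    apply: leq_trans (_ : 3 * (#|D :&: D0|).+1 <= _); last by rewrite leq_mul2l cc orbT.
    by rewrite mulnS addnC leq_add2l.
  - exact: leq_ltn_trans jle cc.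
have [D [[DZ cD sD jle] _]] := grow _ (leqnn _).
have sub : D0 \subset D.
  apply/setIidPr/eqP; rewrite eqEcard jle andbT; exact: subsetIr.
exists D; split=> //; first by apply: leq_trans sD _; rewrite (setIidPr sub) leq_mul2l.
by move=> v /dom[d dD evd]; exists d => //; apply: (subsetP sub).
Qed.

(** The branch sets are connected dominating sets, each found in what the earlier ones leave.
    Together they have at most [x] vertices, so the rest stays connected and dense. A later set lies
    in the part dominated by every earlier one, which gives the edges between them. *)
Lemma robust_Kminor (Z : {set T}) x d0 t h : x < #|Z| ->
  (forall Q : {set T}, #|Q| <= x -> conn e (Z :\: Q)) ->
  (forall v, v \in Z -> d0 <= #|nbr e Z v|) -> #|Z| <= 4 * (d0 - x) ->
  3 ^ t * #|Z| < 4 ^ t -> h * (3 * t) <= x -> Kminor_on h e Z.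
Proof.
move=> xZ rob deg d0Z ht hx.
have build j : j <= h -> exists B : nat -> {set T}, forall i, i < j ->
  [/\ B i \subset Z, conn e (B i), #|B i| <= 3 * t,
      forall i', i' < i -> [disjoint B i' & B i] &
      (B i != set0) /\ forall v, v \in Z -> (forall i', i' < i -> v \notin B i') ->
        exists2 d, d \in B i & e v d].
  elim: j => [|j IH] jh; first by exists (fun=> set0).
  have [B HB] := IH (ltnW jh).
  pose Q := \bigcup_(i < j) B i.
  have cQ : #|Q| <= x.
    apply: leq_trans hx; apply: leq_trans (_ : j * (3 * t) <= _); last first.
      by rewrite leq_mul2r (ltnW jh) orbT.
    apply: leq_trans (_ : \sum_(i < j) #|B i| <= _).
      rewrite /Q; elim/big_rec2: _ => [|i a b _ ab]; first by rewrite cards0.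
      by apply: leq_trans (leq_card_setU _ _) _; rewrite leq_add2l.
    rewrite -[X in _ <= X * _]card_ord -sum_nat_const; apply: leq_sum => i _.
    by have [] := HB i (ltn_ord i).
  have cZQ : #|Z| - x <= #|Z :\: Q|.
    by rewrite cardsD leq_sub2l //; apply: leq_trans cQ; apply: subset_leq_card; apply: subsetIr.
  have [||v||D [DZ cD sD dom]] := @dominating_conn (Z :\: Q) t.
  - by rewrite (leq_trans _ cZQ) // subn_gt0.
  - exact: rob.
  - rewrite inE => /andP[vQ vZ].
    have l1 : #|Z :\: Q| <= #|Z| by apply: subset_leq_card; apply: subsetDl.
    apply: leq_trans l1 _; apply: leq_trans d0Z _; rewrite leq_mul2l /= leq_subLR.
    apply: leq_trans (deg v vZ) _; apply: leq_trans (_ : #|Q :|: nbr e (Z :\: Q) v| <= _).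
      apply: subset_leq_card; apply/subsetP => u; rewrite !inE => /andP[-> ->].
      by rewrite !andbT orbN.
    by apply: leq_trans (leq_card_setU _ _) _; rewrite leq_add2r.
  - apply: leq_ltn_trans ht; rewrite leq_mul2l; apply/orP; right.
    by apply: subset_leq_card; apply: subsetDl.
  have D0 : D != set0.
    have : 0 < #|Z :\: Q| by rewrite (leq_trans _ cZQ) // subn_gt0.
    by case/card_gt0P => v /dom[d dD _]; apply/set0Pn; exists d.
  exists (fun i => if i == j then D else B i) => i; rewrite ltnS leq_eqVlt.
  case/orP => [/eqP->|ij].
    rewrite eqxx; split=> //; first by apply: subset_trans DZ (subsetDl _ _).
      move=> i' i'j; rewrite ltn_eqF // disjoint_sym disjoints_subset.
      apply: subset_trans DZ _; apply/subsetP => v; rewrite !inE => /andP[vQ _].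
      by apply: contra vQ => vB; apply/bigcupP; exists (Ordinal i'j).
    split=> // v vZ vB; apply: dom; rewrite inE vZ andbT.
    by apply/bigcupP => -[[i' i'j]] _ /=; apply/negP; have := vB i' i'j; rewrite ltn_eqF.
  have [? ? ? H1 [? H2]] := HB i ij; rewrite ltn_eqF //; split=> //.
    by move=> i' i'i; rewrite ltn_eqF ?H1 // (ltn_trans i'i).
  split=> // v vZ vB; apply: H2 => // i' i'i.
  by have := vB i' i'i; rewrite ltn_eqF // (ltn_trans i'i).
have [B HB] := build h (leqnn _).
exists (fun i : 'I_h => B i); split.
- by move=> i; have [] := HB i (ltn_ord i).
- by move=> i; have [_ _ _ _ []] := HB i (ltn_ord i).
- by move=> i; have [] := HB i (ltn_ord i).
- move=> i j; rewrite -val_eqE neq_ltn => /orP[] lt.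
    by have [_ _ _ H _] := HB j (ltn_ord j); apply: H.
  by rewrite disjoint_sym; have [_ _ _ H _] := HB i (ltn_ord i); apply: H.
have key i j : i < j -> j < h -> exists x0 y, [/\ x0 \in B i, y \in B j & e x0 y].
  move=> ij jh; have [Bj _ _ dj [/set0Pn[v vB] _]] := HB j jh.
  have [_ _ _ _ [_ dom]] := HB i (ltn_trans ij jh).
  have [i' i'i|d dB evd] := dom v (subsetP Bj _ vB).
    have := dj i' (ltn_trans i'i ij); rewrite -setI_eq0 => /eqP/setP/(_ v).
    by rewrite !inE vB andbT => ->.
  by exists d, v; rewrite syme.
move=> i j; rewrite -val_eqE neq_ltn => /orP[] lt; first exact: key.
have [x0 [y [? ? ?]]] := key _ _ lt (ltn_ord i).
by exists y, x0; rewrite syme.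
Qed.

Lemma Kminor_on_sub h (S S' : {set T}) : S \subset S' -> Kminor_on h e S -> Kminor_on h e S'.
Proof.
move=> sS [B [BS ? ? ? ?]]; exists B; split=> // i.
exact: subset_trans (BS i) sS.
Qed.

(* Either the graph stays connected after deleting few vertices, or a small
   component is so dense that any two of its vertices share many neighbours. *)
Lemma dense_Kminor (J : {set T}) d x t h : #|J| <= d.*2.+1 -> 0 < #|J| ->
  (forall v, v \in J -> d <= #|nbr e J v|) -> 10 * x + 10 <= d ->
  3 ^ t * d.*2.+1 < 4 ^ t -> h * (3 * t) <= x -> Kminor_on h e J.
Proof.
move=> cJ J0 deg xd ht hx.
have [v0 v0J] := card_gt0P J0.
have dJ : d <= #|J|.
  apply: leq_trans (deg _ v0J) _; apply: subset_leq_card.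
  by apply/subsetP => z; rewrite inE => /andP[].
case: (boolP [forall Q : {set T}, (#|Q| <= x) ==> [forall u in J :\: Q, forall v in J :\: Q,
    connect (within e (J :\: Q)) u v]]) => [/forallP rob|].
  apply: (robust_Kminor (x := x) (d0 := d) (t := t)) => //.
  - by move: dJ xd; lia.
  - move=> Q Qx u v uJ vJ; have /implyP/(_ Qx)/forall_inP/(_ u uJ)/forall_inP := rob Q.
    by apply.
  - by move: cJ xd; lia.
  - by apply: leq_ltn_trans ht; rewrite leq_mul2l cJ orbT.
rewrite negb_forall => /existsP[Q]; rewrite negb_imply negb_forall_in.
case/andP => Qx /exists_inP[a aJ]; rewrite negb_forall_in => /exists_inP[b bJ nab].
set r := within e (J :\: Q) in nab.
have symr : symmetric r by move=> u v; rewrite /r /= syme andbCA.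
have csym := sym_connect_sym symr.
pose comp u := [set v in J :\: Q | connect r u v].
(* Two disjoint components have at most [2 * d + 1] vertices together, so one of them has at most
   [d]. *)
have [c cJQ cle] : exists2 c, c \in J :\: Q & #|comp c| <= d.
  have dis : [disjoint comp a & comp b].
    rewrite -setI_eq0; apply/eqP/setP => v; rewrite !inE; apply/negbTE/negP.
    case/andP => /andP[_ av] /andP[_ bv]; move/negP: nab; apply.
    by apply: connect_trans av _; rewrite csym.
  have : #|comp a| + #|comp b| <= #|J|.
    rewrite -cardsUI (_ : _ :&: _ = set0) ?cards0 ?addn0; last by apply/eqP; rewrite setI_eq0.
    apply: subset_leq_card; apply/subsetP => v; rewrite !inE.
    by case/orP => /andP[/andP[_ ->]].
  case: (leqP #|comp a| d) => [|lt]; first by exists a.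
  by exists b => //; move: cJ lt; lia.
set Z := comp c in cle.
have ZJ : Z \subset J by apply/subsetP => v; rewrite !inE => /andP[/andP[_ ->]].
have degZ v : v \in Z -> d - x <= #|nbr e Z v|.
  rewrite inE => /andP[vJQ cv]; rewrite leq_subLR.
  have vJ : v \in J by move: vJQ; rewrite inE => /andP[].
  apply: leq_trans (deg v vJ) _; apply: leq_trans (_ : #|Q :|: nbr e Z v| <= _).
    apply: subset_leq_card; apply/subsetP => u; rewrite !inE => /andP[uJ evu].
    case: (boolP (u \in Q)) => //= uQ; rewrite uJ evu andbT /=.
    apply: connect_trans cv _; apply: connect1.
    by move: vJQ; rewrite /r /= !inE uJ uQ evu => ->.
  by apply: leq_trans (leq_card_setU _ _) _; rewrite leq_add2r.
have cZ : c \in Z by rewrite inE cJQ connect0.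
have dxZ : d - x <= #|Z|.
  apply: leq_trans (degZ _ cZ) _; apply: subset_leq_card.
  by apply/subsetP => z; rewrite inE => /andP[].
apply: Kminor_on_sub ZJ _; clearbody Z.
apply: (robust_Kminor (x := x) (d0 := d - x) (t := t)) => //.
- by move: dxZ xd; lia.
(* Two vertices of [Z] keep at least [d - 2 * x] neighbours each inside a set of at most [d]
   vertices, so a common neighbour survives the deletion of [Q']. *)
- move=> Q' Q'x u v; rewrite !inE => /andP[uQ uZ] /andP[vQ vZ].
  have big w : w \in Z -> w \notin Q' -> d - x - x <= #|nbr e (Z :\: Q') w|.
    move=> wZ wQ; rewrite leq_subLR; apply: leq_trans (degZ _ wZ) _.
    apply: leq_trans (_ : #|Q' :|: nbr e (Z :\: Q') w| <= _).
      apply: subset_leq_card; apply/subsetP => y; rewrite !inE => /andP[yZ ewy].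
      by rewrite yZ ewy !andbT orbN.
    by apply: leq_trans (leq_card_setU _ _) _; rewrite leq_add2r.
  have hu := big u uZ uQ; have hv := big v vZ vQ.
  have : nbr e (Z :\: Q') u :&: nbr e (Z :\: Q') v != set0.
    rewrite -card_gt0; have := cardsUI (nbr e (Z :\: Q') u) (nbr e (Z :\: Q') v).
    have : #|nbr e (Z :\: Q') u :|: nbr e (Z :\: Q') v| <= #|Z|.
      apply: subset_leq_card; apply/subsetP => y; rewrite !inE.
      by case/orP => /andP[/andP[_ ->]].
    move: hu hv cle xd; lia.
  case/set0Pn => y; rewrite !inE => /andP[/andP[/andP[yQ yZ] euy] /andP[_ evy]].
  apply: (@connect_trans _ _ y); apply: connect1; rewrite /= !inE.
    by rewrite uQ yQ uZ yZ.
  by rewrite vQ yQ vZ yZ syme.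
- by move: cle xd; lia.
- by apply: leq_ltn_trans ht; rewrite leq_mul2l; apply/orP; right; move: cle; lia.
Qed.

End Count.

(* Contract edges lying in few triangles for as long as the average degree does
   not drop. *)
Lemma dense_minor (T U : finType) (e : rel T) d n : symmetric e -> 0 < d ->
  forall (S : {set U}) (e' : rel U), #|S| <= n -> symmetric e' -> irreflexive e' ->
  minor_on e' S e -> S != set0 -> 2 * d * #|S| <= narcs e' S ->
  exists (S2 : {set U}) (e2 : rel U) d2,
    [/\ minor_on e2 S2 e, symmetric e2, irreflexive e2, S2 != set0 & d <= d2] /\
    [/\ narcs e2 S2 < 2 * d2.+1 * #|S2|,
        forall x, x \in S2 -> 0 < #|nbr e2 S2 x| &
        forall x y, x \in S2 -> y \in S2 -> e2 x y ->
          d2 <= #|nbr e2 S2 x :&: nbr e2 S2 y|].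
Proof.
move=> syme d0; elim: n => [|n IH] S e' Sn syme' irre' mS S0 hd.
  by move: S0; rewrite -card_gt0; move: Sn; case: #|S|.
have cS0 : 0 < #|S| by rewrite card_gt0.
pose d2 := narcs e' S %/ (2 * #|S|).
have dd2 : d <= d2 by rewrite leq_divRL ?muln_gt0 //; move: hd; rewrite mulnA (mulnC d).
have d2l : 2 * d2 * #|S| <= narcs e' S.
  by rewrite (mulnC 2) -mulnA leq_trunc_div.
have d2u : narcs e' S < 2 * d2.+1 * #|S|.
  by rewrite (mulnC 2) -mulnA -ltn_divLR ?muln_gt0.
case: (boolP [exists x in S, nbr e' S x == set0]) => [/exists_inP[x xS /eqP nx]|].
  have cS := cardsD1 x S; rewrite xS add1n in cS.
  have hn := narcs_rem syme' xS; rewrite nx cards0 muln0 addn0 in hn.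
  have ne : S :\ x != set0.
    apply/eqP => S1; move: hd; rewrite leqNgt => /negP; apply.
    apply: leq_ltn_trans hn _; rewrite S1 /narcs big_set0 !muln_gt0 d0 cS0; lia.
  apply: (IH (S :\ x) e') => //; first by lia.
    exact: minor_on_sub (subsetDl _ _) mS.
  by apply: leq_trans hn; apply: leq_trans hd; rewrite leq_mul2l cS leqnSn orbT.
rewrite negb_exists_in => /forall_inP noiso.
case: (boolP [exists x in S, exists y in S,
    e' x y && (#|nbr e' S x :&: nbr e' S y| < d2)]) => [|].
  case/exists_inP => x xS /exists_inP[y yS /andP[exy lt]].
  have cS := cardsD1 y S; rewrite yS add1n in cS.
  have hn := narcs_contract syme' irre' xS yS exy.
  apply: (IH (S :\ y) (contract e' x y)) => //; first by lia.
  - exact: contract_sym.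
  - exact: contract_irr.
  - exact: minor_on_contract.
  - apply/set0Pn; exists x; rewrite !inE xS andbT.
    by apply: contraTneq exy => ->; rewrite irre'.
  - apply: leq_trans (_ : 2 * d2 * #|S :\ y| <= _).
      by rewrite leq_mul2r leq_mul2l dd2 !orbT.
    by move: hn d2l lt; rewrite cS mulnS; lia.
rewrite negb_exists_in => /forall_inP bad.
exists S, e', d2; split=> //; split=> //.
  by move=> x xS; rewrite card_gt0 noiso.
move=> x y xS yS exy; have := bad x xS; rewrite negb_exists_in => /forall_inP/(_ y yS).
by rewrite exy /= -leqNgt.
Qed.

(** This many edges per vertex force a [K_h] minor. The order [h * log h] is good enough, as the
    logarithm goes into the polylogarithmic factor. *)
Definition minor_density (h : nat) : nat := 2 ^ 13 * h * (trunc_log 2 h).+1.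

(** [d] may lie far above [minor_density h], so the logarithm [m] of [2 * d + 1] is not bounded in
    terms of [h] beforehand. If the claim failed, [d] would be [O(h * m)]; this forces
    [m = O(log h)], and then the lower bound on [d] is violated. *)
Lemma dense_numeric h d m : 0 < h -> minor_density h <= d ->
  2 ^ m <= d.*2.+1 -> d.*2.+1 < 2 ^ m.+1 -> 10 * (h * (3 * (3 * m.+1).+1)) + 10 <= d.
Proof.
move=> h0; rewrite /minor_density; set l := trunc_log 2 h => Md lem ltm.
have hl : h < 2 ^ l.+1 by apply: trunc_log_ltn.
rewrite leqNgt; apply/negP => dlt.
have hm : m <= 2 * l + 40.
  rewrite leqNgt; apply/negP => mlt.
  have e1 : 2 ^ m < 2 ^ (l + 12) * m.+1.
    apply: leq_ltn_trans lem _.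
    have -> : 2 ^ (l + 12) = 2048 * 2 ^ l.+1 by rewrite addnC -[12]/(11 + 1)%N -addnA add1n expnD.
    have : h * m.+1 <= 2 ^ l.+1 * m.+1 by rewrite leq_mul2r (ltnW hl) orbT.
    have : h <= h * m.+1 by rewrite -[X in X <= _]muln1 leq_mul2l orbT.
    move: dlt h0; rewrite -mulnA; nia.
  have e2 : forall j, 2 * j.+1 + 1 < 2 ^ (j + 3).
    by elim=> [|j IHj] //; rewrite addSn expnS; lia.
  pose j := m./2 - 0.
  have : 2 ^ (l + 12) * m.+1 <= 2 ^ m.
    have -> : m = (l + 12) + (m - (l + 12)) by lia.
    rewrite [X in _ <= X]expnD leq_mul2l; apply/orP; right.
    have -> : (l + 12 + (m - (l + 12))).+1 = m.+1 by lia.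
    have := e2 m./2; have := odd_double_half m; rewrite -mul2n.
    have : m./2 + 3 <= m - (l + 12) by have := odd_double_half m; rewrite -mul2n; case: odd; lia.
    move=> le3; have := leq_pexp2l (isT : 0 < 2) le3; case: odd; lia.
  by move: e1; lia.
move: dlt Md; rewrite -mulnA => dlt.
have : h * m.+1 <= h * (2 * l + 41) by rewrite leq_mul2l; apply/orP; right; lia.
have : h <= h * l.+1 by rewrite -[X in X <= _]muln1 leq_mul2l orbT.
have -> : h * (2 * l + 41) = 2 * (h * l.+1) + 39 * h by lia.
move: dlt; have -> : h * (3 * (3 * m.+1).+1) = 9 * (h * m.+1) + 3 * h by lia.
move: (h * l.+1) (h * m.+1) => a b; have := h0; lia.
Qed.

(** After the contractions every edge lies in at least [d2] triangles, while by averaging some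
    vertex has degree at most [2 * d2 + 1]. The neighbourhood of that vertex is a small graph of
    minimum degree [d2], to which [dense_Kminor] applies. *)
Lemma Kminor_density (T : finType) (e : rel T) h : symmetric e -> irreflexive e ->
  0 < h -> 0 < #|T| -> 2 * minor_density h * #|T| <= narcs e [set: T] ->
  Kminor_on h e [set: T].
Proof.
move=> syme irre h0 T0 hn.
have M0 : 0 < minor_density h by rewrite /minor_density !muln_gt0 h0.
have [|||S2 [e2 [d2 [[mi syme2 irre2 S20 dd2] [nlt iso tri]]]]] :=
    @dense_minor T T e (minor_density h) #|T| syme M0 [set: T] e _ syme irre (minor_on_refl _ _) _ _.
- by rewrite cardsT.
- by rewrite -card_gt0 cardsT.
- by rewrite cardsT.
apply: (Kminor_lift syme irre2 mi).
have [x xS degx] : exists2 x, x \in S2 & #|nbr e2 S2 x| <= d2.*2.+1.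
  apply/exists_inP; apply: contraTT nlt; rewrite negb_exists_in -leqNgt => /forall_inP N.
  rewrite /narcs mulnC -sum_nat_const; apply: leq_sum => z /N.
  by rewrite -ltnNge -mul2n; lia.
set J := nbr e2 S2 x in degx.
have JS : J \subset S2 by apply: nbr_sub.
apply: Kminor_on_sub JS _.
pose m := trunc_log 2 d2.*2.+1.
have lem : 2 ^ m <= d2.*2.+1 by apply: trunc_logP.
have ltm : d2.*2.+1 < 2 ^ m.+1 by apply: trunc_log_ltn.
have num := dense_numeric h0 dd2 lem ltm.
apply: (dense_Kminor syme2 (d := d2) (x := h * (3 * (3 * m.+1).+1)) (t := (3 * m.+1).+1)) => //.
- exact: iso.
- move=> y yJ; have /andP[yS exy] : (y \in S2) && e2 x y by move: yJ; rewrite inE.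
  apply: leq_trans (tri _ _ xS yS exy) _; apply: subset_leq_card.
  by apply/subsetP => z; rewrite !inE => /andP[/andP[-> ->] /andP[_ ->]].
(* The choice [t = 3 * (m + 1) + 1] works because [27 * 2 <= 64]. *)
- apply: leq_ltn_trans (_ : 3 ^ (3 * m.+1).+1 * 2 ^ m.+1 < _).
    by rewrite leq_mul2l (ltnW ltm) orbT.
  have -> : 3 ^ (3 * m.+1).+1 = 3 * 27 ^ m.+1 by rewrite expnS expnM.
  have -> : 4 ^ (3 * m.+1).+1 = 4 * 64 ^ m.+1 by rewrite expnS expnM.
  rewrite -mulnA -expnMn -[27 * 2]/54.
  have h1 : 54 ^ m.+1 <= 64 ^ m.+1 by rewrite leq_exp2r.
  have h2 : 0 < 64 ^ m.+1 by rewrite expn_gt0.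
  by move: h1 h2; move: (54 ^ _) (64 ^ _) => a b; lia.
Qed.

(** * Sparse spanners of minor-free graphs *)

Definition unique_paths (T : eqType) (g : nat) (f : rel T) : Prop :=
  forall x p q, path f x p -> path f x q -> uniq (x :: p) -> uniq (x :: q) ->
    last x p = last x q -> size p + size q <= g -> p = q.

Definition del_edge (T : eqType) (f : rel T) (x y : T) : rel T :=
  fun a b => f a b && ~~ ((a == x) && (b == y) || (a == y) && (b == x)).
Arguments del_edge T f x y a b /.

(** Girth above [g]: a walk that joins the ends of an edge and avoids it closes up with that edge.
    Walks instead of simple paths are easier to concatenate. *)
Definition large_girth (T : eqType) (g : nat) (f : rel T) : Prop :=
  forall x y p, f x y -> path (del_edge f x y) x p -> last x p = y -> g <= size p.

Lemma sym_rev_path (T : eqType) (f : rel T) x p : symmetric f ->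
  path f (last x p) (rev (belast x p)) = path f x p.
Proof. by move=> sf; rewrite rev_path; apply: eq_path => a b; rewrite sf. Qed.

Lemma last_rev_belast (T : eqType) (x : T) p : last (last x p) (rev (belast x p)) = x.
Proof. by case: p => //= y p; rewrite rev_cons last_rcons. Qed.

Lemma size_rev_belast (T : eqType) (x : T) p : size (rev (belast x p)) = size p.
Proof. by rewrite size_rev size_belast. Qed.

Lemma path_del_edge (T : eqType) (f : rel T) x a z s : x \notin z :: s ->
  path f z s -> path (del_edge f x a) z s.
Proof.
elim: s z => //= b s IH z; rewrite !inE !negb_or => /and3P[xz xb xs] /andP[fzb ps].
rewrite fzb /= (eq_sym z) (negbTE xz) /= (eq_sym b) (negbTE xb) andbF /=.
by apply: IH; rewrite // inE negb_or xb.
Qed.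

(** Where the paths first differ they leave a vertex [x] by two edges. One path followed by the
    reverse of the other joins the ends of one of these edges, avoids it because [x] does not recur,
    and is too short. *)
Lemma girth_unique_paths (T : eqType) (g : nat) (f : rel T) :
  symmetric f -> large_girth g f -> unique_paths g f.
Proof.
move=> sf gf x p; elim: p x => [|a p IH] x [|b q] //.
- by move=> _ _ _ /= /andP[xq _] lx; rewrite lx mem_last in xq.
- by move=> _ _ /= /andP[xq _] _ lx; rewrite -lx mem_last in xq.
move=> pp pq up uq lpq sz.
have [ab|ab] := eqVneq a b.
  rewrite -ab in pq uq lpq *; congr cons; apply: (IH a) => //.
  - by case/andP: pp.
  - by case/andP: pq.
  - by case/andP: up.
  - by case/andP: uq.
  - by apply: leq_trans sz => /=; lia.
have xa : x \notin a :: p by case/andP: up.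
have xb : x \notin b :: q by case/andP: uq.
case/andP: pp => fxa pp; case/andP: pq => fxb pq.
have := gf x a ((b :: q) ++ rev (belast a p)) fxa.
rewrite /= cat_path size_cat size_rev_belast last_cat.
rewrite /= in lpq; rewrite -lpq last_rev_belast.
rewrite (path_del_edge _ xb pq) /= fxb (eq_sym b a) (negbTE ab) andbF /=.
have xa' : x == a = false by apply/negbTE; move: xa; rewrite inE negb_or => /andP[].
rewrite xa' /= => /(_ _ erefl); move=> H; move: sz; rewrite /= => sz.
suff /H : path (del_edge f x a) (last a p) (rev (belast a p)) by clear -sz; lia.
apply: path_del_edge; last by rewrite sym_rev_path.
apply: contra xa; rewrite inE mem_rev => /orP[/eqP->|]; first exact: mem_last.
exact: mem_belast.
Qed.

Lemma path_first_fail (T : eqType) (r r' : rel T) x p : path r x p ->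
  path r' x p \/ exists p1 c p2, [/\ p = p1 ++ c :: p2, r (last x p1) c & ~~ r' (last x p1) c].
Proof.
elim: p x => [|b p IH] x /=; first by left.
case/andP => rxb /IH[pp|[p1 [c [p2 [-> h1 h2]]]]]; last first.
  by right; exists (b :: p1), c, p2.
case: (boolP (r' x b)) => r'xb; first by left.
by right; exists [::], b, p.
Qed.

Section GirthSpanner.
Variables (T : finType) (e : rel T) (g : nat).
Hypotheses (syme : symmetric e) (irre : irreflexive e).

Let relF (F : {set T * T}) : rel T := fun a b => (a, b) \in F.

(** Graphs are symmetric sets of darts, so that a largest one can be taken; bounding the length of
    the walks makes the girth condition decidable. *)
Let okF (F : {set T * T}) : bool :=
  [forall p in F, ((p.2, p.1) \in F) && e p.1 p.2] &&
  [forall x, forall y, relF F x y ==>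
     ~~ [exists p : g.-bseq T, path (del_edge (relF F) x y) x p && (last x p == y)]].

(* A maximal subgraph of girth more than [g + 1] is a [g]-spanner: an omitted
   edge would close a short cycle. *)
Lemma girth_spanner : exists f : rel T,
  [/\ symmetric f, subrel f e, large_girth g.+1 f &
      forall x y, e x y -> exists p, [/\ path f x p, last x p = y & size p <= maxn g 1]].
Proof.
have ok0 : okF set0.
  apply/andP; split; first by apply/forall_inP => p; rewrite inE.
  by apply/forallP => x; apply/forallP => y; rewrite /relF inE.
case: (arg_maxnP (fun F : {set T * T} => #|F|) ok0) => F /andP[/forall_inP okS /forallP okG] Fmax.
have symF : symmetric (relF F).
  by move=> a b; apply/idP/idP => /okS /andP[].
have subF : subrel (relF F) e by move=> a b /okS /andP[].
have gF : large_girth g.+1 (relF F).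
  move=> x y p Fxy pp lp; rewrite ltnNge; apply/negP => sp.
  have /forallP/(_ y)/implyP/(_ Fxy)/negP := okG x; apply.
  by apply/existsP; exists (Bseq sp); rewrite /= pp lp eqxx.
exists (relF F); split=> // x y exy.
have [Fxy|nFxy] := boolP (relF F x y).
  by exists [:: y]; rewrite /= Fxy; split=> //; rewrite leq_maxr.
suff [p [pp lp sp]] : exists p, [/\ path (relF F) x p, last x p = y & size p <= g].
  by exists p; split=> //; rewrite (leq_trans sp) ?leq_maxl.
pose F' := (x, y) |: ((y, x) |: F).
have F'E a b : relF F' a b = relF F a b || ((a == x) && (b == y) || (a == y) && (b == x)).
  by rewrite /relF !inE !xpair_eqE orbA orbC.
have symF' : symmetric (relF F').
  by move=> a b; rewrite !F'E symF; congr orb; rewrite orbC [X in X || _]andbC [X in _ || X]andbC.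
have bad : ~~ okF F'.
  apply/negP => /Fmax /=; rewrite leqNgt => /negP; apply.
  rewrite proper_card // properE; apply/andP; split.
    by apply/subsetP => z zF; rewrite !inE zF !orbT.
  by apply/subsetPn; exists (x, y) => //; rewrite !inE eqxx.
move: bad; rewrite negb_and => /orP[/negP bad|].
  case: bad; apply/forall_inP => -[a b] abF' /=.
  have : relF F' a b by []; rewrite F'E => H.
  rewrite -/(relF F' b a) symF' F'E H /=.
  case/orP: H => [/subF//|/orP[] /andP[/eqP-> /eqP->] //].
  by rewrite syme.
rewrite negb_forall => /existsP[a]; rewrite negb_forall => /existsP[b].
rewrite negb_imply negbK => /andP[F'ab /existsP[p0 /andP[pp0 /eqP lp0]]].
have [p [pp up lp sp]] : exists p, [/\ path (del_edge (relF F') a b) a p, uniq (a :: p),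
    last a p = b & size p <= g].
  case/shortenP: pp0 lp0 => p pp up subp lp0; exists p; split=> //.
  apply: leq_trans (size_bseq p0); apply: uniq_leq_size subp.
  by case/andP: up.
have rev_case u v q : path (relF F) u q -> last u q = v -> size q <= g ->
    (u == x) && (v == y) || (u == y) && (v == x) ->
    exists p, [/\ path (relF F) x p, last x p = y & size p <= g].
  move=> pq lq sq /orP[] /andP[/eqP ux /eqP vy]; rewrite -ux -vy -lq.
    by exists q.
  by exists (rev (belast u q)); rewrite size_rev_belast sym_rev_path // last_rev_belast.
(* The short cycle uses the new edge. Either that is the distinguished edge [a b], or it is an edge
   [u c] of the walk, and the rest of the cycle, traversed the other way, joins its ends. *)
have [xyab|nxyab] := boolP ((a == x) && (b == y) || (a == y) && (b == x)).
  apply: (rev_case a b p) => //; apply: sub_path pp => u v /=.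
  rewrite F'E; case: (relF F u v) => //=.
  case/orP: xyab => /andP[/eqP-> /eqP->]; first by rewrite andbN.
  by rewrite orbC andbN.
have Fab : relF F a b by move: F'ab; rewrite F'E (negbTE nxyab) orbF.
have [pF|[p1 [c [p2 [pE]]]]] := path_first_fail (del_edge (relF F) a b) pp.
  by have := gF a b p Fab pF lp; rewrite ltnNge sp.
set u := last a p1 => /andP[F'uc nab]; rewrite /= nab andbT => nFuc.
have xyuc : (u == x) && (c == y) || (u == y) && (c == x).
  by move: F'uc; rewrite F'E (negbTE nFuc).
have avoid w z s : w \notin z :: s -> (w == x) || (w == y) ->
    path (del_edge (relF F') a b) z s -> path (relF F) z s.
  move=> ws wxy; apply: (sub_in_path (P := fun d => d != w)).
    move=> d1 d2; rewrite !unfold_in => d1w d2w /andP[]; rewrite F'E.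
    case: (relF F d1 d2) => //= /orP[] /andP[/eqP E1 /eqP E2];
    by move: wxy d1w d2w; rewrite E1 E2 !(eq_sym w) => /orP[] ->.
  by apply/allP => d ds; apply: contraNneq ws => <-.
move: up pp lp sp; rewrite pE -cat_cons cat_uniq cat_path last_cat size_cat /= -/u.
case/and3P => u1 /norP[cp1 up12] /andP[cp2 u2] /andP[pp1 /andP[_ pp2]] lp sp.
have wu : (u == x) || (u == y) by case/orP: xyuc => /andP[-> _]; rewrite ?orbT.
have wc : (c == x) || (c == y) by case/orP: xyuc => /andP[_ ->]; rewrite ?orbT.
have pF1 : path (relF F) a p1 by apply: avoid wc pp1.
have pF2 : path (relF F) c p2.
  apply: (avoid u) => //; rewrite inE negb_or; apply/andP; split.
    by apply: contraNneq cp1 => <-; exact: mem_last.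
  by apply: contra up12 => up2; apply/hasP; exists u => //; exact: mem_last.
apply: (rev_case u c (rev (belast a p1) ++ b :: rev (belast c p2))) => //.
- rewrite cat_path /= sym_rev_path // pF1 last_rev_belast Fab /=.
  by rewrite -lp sym_rev_path.
- by rewrite last_cat /= -lp last_rev_belast.
- by rewrite size_cat /= !size_rev_belast.
Qed.

End GirthSpanner.

Lemma exists_ge_avg (I : finType) (F : I -> nat) c : 0 < #|I| ->
  c * #|I| <= \sum_i F i -> exists i, c <= F i.
Proof.
move=> I0 h; apply/existsP; apply: contraLR h; rewrite negb_exists => /forallP N.
rewrite -ltnNge mulnC -sum_nat_const; have [i0 _] := card_gt0P I0.
rewrite (bigD1 i0) //= [X in _ < X](bigD1 i0) //= -addSn leq_add //.
  by rewrite ltnNge N.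
by apply: leq_sum => i _; rewrite ltnW // ltnNge N.
Qed.

Lemma card_multicover (I J : finType) (A : {set I}) (B : {set J}) (E : I -> {set J}) c :
  (forall i, i \in A -> E i \subset B) ->
  (forall j, j \in B -> #|[set i in A | j \in E i]| <= c) ->
  \sum_(i in A) #|E i| <= c * #|B|.
Proof.
move=> EB Ec.
have -> : \sum_(i in A) #|E i| = \sum_(j in B) #|[set i in A | j \in E i]|.
  have -> : \sum_(i in A) #|E i| = \sum_(i in A) \sum_(j in B) (j \in E i : nat).
    apply: eq_bigr => i iA; rewrite -sum1_card big_mkcond [RHS]big_mkcond.
    apply: eq_bigr => j _; case: ifP => [/(subsetP (EB i iA))->//|].
    by rewrite if_same.
  rewrite exchange_big; apply: eq_bigr => j _.
  rewrite -sum1_card big_mkcond [RHS]big_mkcond; apply: eq_bigr => i _.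
  by rewrite inE; case: (i \in A) => //=; case: (_ \in _).
by rewrite mulnC -sum_nat_const; apply: leq_sum.
Qed.

Lemma card_disjoint_cover (I J : finType) (A : {set I}) (B : {set J}) (E : I -> {set J}) :
  (forall i, i \in A -> E i \subset B) ->
  (forall i i' j, i \in A -> i' \in A -> j \in E i -> j \in E i' -> i = i') ->
  \sum_(i in A) #|E i| <= #|B|.
Proof.
move=> EB Ei; rewrite -[X in _ <= X]mul1n; apply: card_multicover => // j _.
apply/card_le1_eqP => i i'; rewrite !inE => /andP[iA jE] /andP[iA' jE'].
exact: (Ei i' i j).
Qed.

(** * Random cuts and thinning of set families *)

Section Cuts.
Variable T : finType.

Lemma card_sets : #|{: {set T}}| = 2 ^ #|T|.
Proof. by rewrite -[LHS]cardsT -powersetT card_powerset cardsT. Qed.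

(** Toggling the membership of [x] or of [y] permutes the subsets, so the four membership patterns
    are equally frequent. *)
Lemma card_separating (x y : T) : x != y ->
  4 * #|[set A : {set T} | (x \in A) && (y \notin A)]| = 2 ^ #|T|.
Proof.
move=> xy.
pose tog (z : T) (A : {set T}) := if z \in A then A :\ z else z |: A.
have togE z A w : (w \in tog z A) = (w == z) (+) (w \in A).
  rewrite /tog; case: (boolP (z \in A)) => zA; rewrite !inE.
    by case: eqVneq => [->|] //=; rewrite zA.
  by case: eqVneq => [->|] //=; rewrite (negbTE zA).
have togK z : involutive (tog z).
  by move=> A; apply/setP => w; rewrite !togE addbA addbb.
have sw z (P Q : pred {set T}) : (forall A, P (tog z A) = Q A) ->
    #|[set A | P A]| = #|[set A | Q A]|.
  move=> PQ; rewrite -(card_imset [set A | Q A] (inv_inj (togK z))).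
  apply: eq_card => A; apply/idP/imsetP; rewrite inE.
    by move=> PA; exists (tog z A); rewrite ?togK // inE -PQ togK.
  by case=> A'; rewrite inE -PQ => PA' ->.
pose N b b' := #|[set A : {set T} | ((x \in A) == b) && ((y \in A) == b')]|.
have N1 b b' : N (~~ b) b' = N b b'.
  apply: (sw x) => A; rewrite !togE eqxx (eq_sym y) (negbTE xy) /=.
  by case: (x \in A); case: b.
have N2 b b' : N b (~~ b') = N b b'.
  apply: (sw y) => A; rewrite !togE eqxx (negbTE xy) /=.
  by case: (y \in A); case: b'.
have tot : N true true + N true false + (N false true + N false false) = 2 ^ #|T|.
  have NE b b' : N b b' = \sum_(A : {set T}) (((x \in A) == b) && ((y \in A) == b') : nat).
    by rewrite /N -sum1_card big_mkcond; apply: eq_bigr => A _; rewrite inE; case: (_ && _).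
  rewrite -card_sets -sum1_card !NE -!big_split /=; apply: eq_bigr => A _.
  by case: (x \in A); case: (y \in A).
have -> : #|[set A : {set T} | (x \in A) && (y \notin A)]| = N true false.
  by apply: eq_card => A; rewrite !inE eqb_id eqbF_neg.
have h1 : N false true = N true true by apply: (N1 true).
have h2 : N false false = N true false by apply: (N1 true).
have h3 : N true false = N true true by apply: (N2 true true).
by rewrite -tot h1 h2 h3 !mulSn mul0n addn0 !addnA.
Qed.

Lemma earcsE (e : rel T) (A B : {set T}) :
  earcs e A B = \sum_x \sum_y ([&& x \in A, y \in B & e x y] : nat).
Proof.
rewrite /earcs big_mkcond; apply: eq_bigr => x _; case: (x \in A) => /=; last by rewrite big1.
rewrite -sum1_card big_mkcond; apply: eq_bigr => y _; rewrite inE.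
by case: (_ && _).
Qed.

Lemma sum_separating (x y : T) :
  4 * (\sum_(A : {set T}) ((x \in A) && (y \notin A) : nat)) = (x != y) * 2 ^ #|T|.
Proof.
have -> : \sum_(A : {set T}) ((x \in A) && (y \notin A) : nat) =
    #|[set A : {set T} | (x \in A) && (y \notin A)]|.
  by rewrite -sum1_card [RHS]big_mkcond; apply: eq_bigr => A _; rewrite inE; case: (_ && _).
case: eqVneq => [->|xy] /=; last by rewrite mul1n card_separating.
by rewrite (_ : [set A | _] = set0) ?cards0 //; apply/setP => A; rewrite !inE andbN.
Qed.

(** A uniformly random set contains the tail and misses the head of a given arc with probability
    [1 / 4]. *)
Lemma directed_cut (a : rel T) (U : {set T}) : irreflexive a ->
  exists A : {set T}, A \subset U /\ earcs a U U <= 4 * earcs a A (U :\: A).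
Proof.
move=> irra.
have [||A hA] := @exists_ge_avg {set T} (fun A => 4 * earcs a (U :&: A) (U :\: A)) (earcs a U U).
- by apply/card_gt0P; exists set0.
- rewrite -big_distrr /= (eq_bigr (fun A : {set T} => \sum_x \sum_y
     ([&& x \in U, y \in U & a x y] * ((x \in A) && (y \notin A)) : nat))); last first.
    move=> A _; rewrite earcsE; apply: eq_bigr => x _; apply: eq_bigr => y _.
    rewrite !inE; case: (x \in U); case: (y \in U); case: (x \in A); case: (y \in A);
    by case: (a x y).
  rewrite exchange_big /= (eq_bigr (fun x => \sum_y ([&& x \in U, y \in U & a x y] *
     \sum_(A : {set T}) ((x \in A) && (y \notin A) : nat)))); last first.
    by move=> x _; rewrite exchange_big; apply: eq_bigr => y _; rewrite big_distrr.
  rewrite earcsE big_distrl big_distrr /=; apply: leq_sum => x _.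
  rewrite big_distrl big_distrr /=; apply: leq_sum => y _.
  rewrite mulnCA sum_separating card_sets.
  have [->|xy] := eqVneq x y; first by rewrite irra !andbF.
  by rewrite mul1n.
exists (U :&: A); split; first exact: subsetIl.
by rewrite setDIr setDv set0U.
Qed.

(** When a random set splits [N] into parts of sizes [p] and [q], the mean of [p * q] is
    [#|N| * (#|N| - 1) / 4], and [p * q <= minn p q * #|N|]. *)
Lemma split_min (N : {set T}) :
  #|N| * 2 ^ #|T| <= \sum_(A : {set T}) (4 * minn #|N :&: A| #|N :\: A| + 1).
Proof.
have [->|N0] := eqVneq N set0; first by rewrite cards0.
have pN : 0 < #|N| by rewrite card_gt0.
rewrite -(leq_pmul2r pN) big_distrl /=.
apply: leq_trans (_ : \sum_(A : {set T}) (4 * (#|N :&: A| * #|N :\: A|) + #|N|) <= _); last first.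
  apply: leq_sum => A _; rewrite mulnDl mul1n leq_add2r -mulnA leq_mul2l /=.
  have := cardsID A N; move: #|N :&: A| #|N :\: A| #|N| => p q r <-.
  by case: (leqP p q) => pq; rewrite ?leq_mul2l ?[p * q]mulnC ?leq_mul2l ?leq_addr ?leq_addl ?orbT.
rewrite big_split /= sum_nat_const card_sets -big_distrr /=.
have -> : \sum_(A : {set T}) #|N :&: A| * #|N :\: A| =
   \sum_(x in N) \sum_(y in N) \sum_(A : {set T}) ((x \in A) && (y \notin A) : nat).
  rewrite exchange_big /= (eq_bigr (fun y => \sum_(A : {set T}) \sum_(x in N) ((x \in A) && (y \notin A) : nat))); last first.
    by move=> y _; rewrite exchange_big.
  rewrite exchange_big /=; apply: eq_bigr => A _.
  rewrite -!sum1_card big_distrlr /= exchange_big /= [LHS]big_mkcond [RHS]big_mkcond /=.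
  apply: eq_bigr => y _; rewrite !inE; case: (y \in N); rewrite ?andbF //=.
  case: (y \in A) => /=; last rewrite [LHS]big_mkcond [RHS]big_mkcond.
    by rewrite big1 // => x _; rewrite andbF.
  by apply: eq_bigr => x _; rewrite inE; case: (x \in N); case: (x \in A).
rewrite big_distrr /= (eq_bigr (fun x => \sum_(y in N) (x != y) * 2 ^ #|T|)); last first.
  by move=> x _; rewrite big_distrr /=; apply: eq_bigr => y _; rewrite sum_separating.
rewrite -mulnA (mulnC (2 ^ _)) mulnA.
have -> : \sum_(x in N) \sum_(y in N) (x != y) * 2 ^ #|T| = #|N| * (#|N|.-1 * 2 ^ #|T|).
  rewrite -sum_nat_const; apply: eq_bigr => x xN.
  rewrite -big_distrl /=; congr (_ * _).
  rewrite (big_setD1 x xN) /= eqxx /= add0n (eq_bigr (fun _ => 1)) ?sum1_card; last first.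
    by move=> y; rewrite !inE => /andP[yx _]; rewrite eq_sym yx.
  by have := cardsD1 x N; rewrite xN => ->.
by rewrite mulnA -mulnDl -mulnSr prednK.
Qed.

(** Edges from [Y'] to [X :\: X1] will be counted, those to [X1] will carry the clusters. A random
    split leaves about a quarter of the edges at [y] on its minority side; either the split or its
    complement puts half of these into [X :\: X1], hence the factor 8. *)
Lemma balanced_split (e : rel T) (X Y : {set T}) : symmetric e ->
  exists X1 Y' : {set T}, [/\ X1 \subset X, Y' \subset Y,
    (forall y, y \in Y' -> #|nbr e (X :\: X1) y| <= #|nbr e X1 y|) &
    earcs e X Y <= 8 * earcs e (X :\: X1) Y' + #|Y|].
Proof.
move=> syme.
pose mn A y := minn #|nbr e X y :&: A| #|nbr e X y :\: A|.
have [||A hA] := @exists_ge_avg {set T} (fun A => \sum_(y in Y) (4 * mn A y + 1)) (earcs e X Y).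
- by apply/card_gt0P; exists set0.
- rewrite earcsC // /earcs big_distrl exchange_big /= card_sets.
  by apply: leq_sum => y _; apply: split_min.
have EI A' y : nbr e (X :&: A') y = nbr e X y :&: A'.
  by apply/setP => z; rewrite !inE -!andbA; congr andb; rewrite andbC.
have ED A' y : nbr e (X :\: A') y = nbr e X y :\: A'.
  by apply/setP => z; rewrite !inE -!andbA.
pose half (A' : {set T}) := [set y in Y | #|nbr e X y :\: A'| <= #|nbr e X y :&: A'|].
have bnd : \sum_(y in Y) mn A y <= earcs e (X :\: A) (half A) + earcs e (X :\: ~: A) (half (~: A)).
  rewrite ![earcs e (X :\: _) _]earcsC // /earcs.
  have hs A' : \sum_(y in half A') #|nbr e (X :\: A') y| =
      \sum_(y in Y) if #|nbr e X y :\: A'| <= #|nbr e X y :&: A'| then #|nbr e X y :\: A'| else 0.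
    by rewrite -big_mkcondr /=; apply: eq_big => [y|y _]; rewrite ?inE // ED.
  rewrite !hs -big_split /=; apply: leq_sum => y _.
  rewrite /mn !setDE setCK.
  move: #|nbr e X y :&: A| #|nbr e X y :&: ~: A| => p q; clear.
  by case: (leqP q p); case: (leqP p q); lia.
have tot : earcs e X Y <= 4 * (\sum_(y in Y) mn A y) + #|Y|.
  by apply: leq_trans hA _; rewrite big_split /= -big_distrr /= sum1_card.
have fin A' : earcs e X Y <= 8 * earcs e (X :\: A') (half A') + #|Y| ->
   exists X1 Y' : {set T}, [/\ X1 \subset X, Y' \subset Y,
    (forall y, y \in Y' -> #|nbr e (X :\: X1) y| <= #|nbr e X1 y|) &
    earcs e X Y <= 8 * earcs e (X :\: X1) Y' + #|Y|].
  move=> h; exists (X :&: A'), (half A'); split.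
  - exact: subsetIl.
  - by apply/subsetP => y; rewrite inE => /andP[].
  - by move=> y; rewrite inE setDIr setDv set0U EI ED => /andP[].
  - by rewrite setDIr setDv set0U.
case: (leqP (earcs e (X :\: ~: A) (half (~: A))) (earcs e (X :\: A) (half A))) => l.
  by apply: (fin A); move: tot bnd l; clear; lia.
by apply: (fin (~: A)); move: tot bnd l; clear; lia.
Qed.

End Cuts.

(* Discarding a random member of a family of [r] sets multiplies the total size
   by [(r-1)/r] and the overlap count by [(r-2)/r], so overlaps can be made
   negligible. *)
Lemma sparse_overlap (I J : finType) (Tw : I -> {set J}) (W : {set I}) t s :
  (forall j, #|[set w in W | j \in Tw w]| <= t.+1) ->
  s <= #|W| -> 2 * t * s.-1 <= #|W|.-1 ->
  exists W' : {set I}, [/\ W' \subset W, #|W'| = s &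
    \sum_(w in W') #|Tw w| <= 2 * #|\bigcup_(w in W') Tw w|].
Proof.
move=> ht sW hts; set m := #|W|.
pose deg (A : {set I}) w := \sum_(w' in A :\ w) #|Tw w :&: Tw w'|.
pose ov (A : {set I}) := \sum_(w in A) deg A w.
pose tot (A : {set I}) := \sum_(w in A) #|Tw w|.
have start : ov W <= t * tot W.
  rewrite /ov /tot big_distrr /=; apply: leq_sum => w wW.
  apply: card_multicover => [w' _|j jw]; first exact: subsetIl.
  have := ht j; rewrite (cardsD1 w) inE wW jw add1n ltnS.
  apply: leq_trans; apply: subset_leq_card; apply/subsetP => w'.
  by rewrite !inE => /andP[/andP[-> ->] /andP[_ ->]].
have totD (A : {set I}) w : w \in A -> tot A = #|Tw w| + tot (A :\ w).
  by move=> wA; rewrite /tot (big_setD1 w wA).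
have ovD (A : {set I}) w : w \in A -> ov A = 2 * deg A w + ov (A :\ w).
  move=> wA; rewrite /ov (big_setD1 w wA) /= mul2n -addnn -addnA; congr (_ + _).
  rewrite /deg -big_split /=; apply: eq_bigr => v; rewrite !inE => /andP[vw vA].
  rewrite (big_setD1 w) /=; last by rewrite !inE eq_sym vw.
  rewrite setIC; congr (_ + _); apply: eq_bigl => u; rewrite !inE.
  by case: (u == v); case: (u == w).
have step r : s <= r -> r <= m -> exists A : {set I},
    [/\ A \subset W, #|A| = r & m.-1 * ov A <= t * r.-1 * tot A].
  move=> sr rm; have [k] : exists k, r + k = m by exists (m - r); rewrite subnKC.
  elim: k r sr rm => [|k IH] r sr rm hk.
    rewrite addn0 in hk; exists W; split=> //.
    by rewrite hk (mulnC t) -mulnA leq_mul2l start orbT.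
  have r1m : r.+1 <= m by clear -hk; lia.
  have hk1 : r.+1 + k = m by clear -hk; lia.
  have [A [AW cA hA]] := IH r.+1 (leqW sr) r1m hk1.
  have [w wA hw] : exists2 w, w \in A & m.-1 * ov (A :\ w) <= t * r.-1 * tot (A :\ w).
    apply/exists_inP; apply: contraT; rewrite negb_exists_in => /forall_inP N.
    have lt : t * r.-1 * (\sum_(w in A) tot (A :\ w)) + #|A| <=
        m.-1 * (\sum_(w in A) ov (A :\ w)).
      rewrite !big_distrr /= -sum1_card -big_split /=; apply: leq_sum => w wA.
      by rewrite addn1 ltnNge N.
    have e1 : \sum_(w in A) tot (A :\ w) + tot A = r.+1 * tot A.
      rewrite -cA -sum_nat_const -big_split /=; apply: eq_bigr => w wA.
      by rewrite (totD A w wA) addnC.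
    have e2 : \sum_(w in A) ov (A :\ w) + 2 * ov A = r.+1 * ov A.
      rewrite -cA -sum_nat_const big_distrr -big_split /=; apply: eq_bigr => w wA.
      by rewrite (ovD A w wA) addnC.
    have e1' : \sum_(w in A) tot (A :\ w) = r * tot A by clear -e1; lia.
    have e2' : \sum_(w in A) ov (A :\ w) <= r.-1 * ov A.
      by clear -e2; case: r e2 => [|r] /=; lia.
    have : m.-1 * (\sum_(w in A) ov (A :\ w)) <= t * r.-1 * (r * tot A).
      apply: leq_trans (_ : r.-1 * (m.-1 * ov A) <= _).
        by rewrite mulnCA leq_mul2l e2' orbT.
      apply: leq_trans (_ : r.-1 * (t * r * tot A) <= _).
        by rewrite leq_mul2l hA orbT.
      by rewrite !mulnA (mulnC t).
    move/(leq_trans lt); rewrite e1' cA addnS ltnNge leq_addr //.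
  exists (A :\ w); split=> //; first exact: subset_trans (subsetDl _ _) AW.
  by have := cardsD1 w A; rewrite wA cA add1n => -[].
have [A [AW cA hA]] := step s (leqnn _) sW.
exists A; split=> //.
have ov2 : 2 * ov A <= tot A.
  case: (posnP m.-1) => [m0|m0].
    suff -> : ov A = 0 by [].
    rewrite /ov big1 // => w wA; rewrite /deg big1 // => w'; rewrite !inE => /andP[ww' w'A].
    have : 1 < #|A| by apply/card_gt1P; exists w, w'; rewrite eq_sym.
    rewrite cA; move: sW m0; rewrite -/m; clear; lia.
  rewrite -(leq_pmul2l m0) mulnCA; apply: leq_trans (_ : 2 * (t * s.-1 * tot A) <= _).
    by rewrite leq_mul2l hA orbT.
  by rewrite !mulnA leq_mul2r hts orbT.
pose priv w := Tw w :\: \bigcup_(w' in A :\ w) Tw w'.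
have hp : \sum_(w in A) #|priv w| <= #|\bigcup_(w in A) Tw w|.
  apply: card_disjoint_cover => [w wA|w w' j wA w'A].
    by apply: subset_trans (subsetDl _ _) _; apply: bigcup_sup wA.
  rewrite !inE => /andP[nj jw] /andP[nj' jw']; apply/eqP; apply: contraNT nj => ww'.
  by apply/bigcupP; exists w' => //; rewrite !inE eq_sym ww'.
have : tot A <= \sum_(w in A) #|priv w| + ov A.
  rewrite /tot /ov -big_split /=; apply: leq_sum => w wA.
  rewrite -(cardsID (\bigcup_(w' in A :\ w) Tw w') (Tw w)) addnC leq_add2l.
  rewrite /deg big_distrr /=; elim/big_rec2: _ => [|w' a b _ ab]; first by rewrite cards0.
  by apply: leq_trans (leq_card_setU _ _) _; rewrite leq_add2l.
by move: ov2 hp; rewrite /tot; clear; lia.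
Qed.

(** * Carving clusters out of a graph with unique short paths *)

Definition ball (V : finType) (r : rel V) (j : nat) (w : V) : {set V} :=
  [set v | [exists p : j.-bseq V, path r w p && (last w p == v)]].

Lemma ballP (V : finType) (r : rel V) j w v :
  reflect (exists p, [/\ path r w p, last w p = v & size p <= j]) (v \in ball r j w).
Proof.
rewrite inE; apply: (iffP existsP) => [[p /andP[pp /eqP lp]]|[p [pp lp sp]]].
  by exists p; rewrite size_bseq.
by exists (Bseq sp); rewrite /= pp lp eqxx.
Qed.

Lemma split_mem (V : eqType) (x0 x : V) s : x \in x0 :: s ->
  exists p1 p2, s = p1 ++ p2 /\ last x0 p1 = x.
Proof. by case/splitPl => p1 p2 lx; exists p1, p2. Qed.

Lemma path_within (V : finType) (f : rel V) (X : {set V}) a p :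
  path f a p -> {subset a :: p <= X} -> path (within f X) a p.
Proof.
elim: p a => //= b q IH a /andP[fab pq] sub.
rewrite fab !sub ?inE ?eqxx ?orbT //=; apply: IH => // z zq.
by apply: sub; rewrite inE zq orbT.
Qed.

Section Branches.
Variables (V : finType) (f : rel V) (rho g : nat).
Hypotheses (symf : symmetric f) (irrf : irreflexive f).
Hypotheses (upf : unique_paths g f) (rho_g : 2 * rho <= g) (rho_gt0 : 0 < rho).

Definition branch (Z : {set V}) (c w : V) : {set V} :=
  ball (within f (Z :\ c)) rho.-1 w.

(** A ball of radius [rho] around [c] reduced to the branches that start in [W]: dropping branches
    is the means of keeping collisions between clusters rare. *)
Definition cluster (Z : {set V}) (c : V) (W : {set V}) : {set V} :=
  c |: \bigcup_(w in W) branch Z c w.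

Lemma branchE (Z : {set V}) c w v : w \in nbr f Z c -> v \in branch Z c w ->
  exists p, [/\ path f c (w :: p), uniq (c :: w :: p), last w p = v,
    size p <= rho.-1 & {subset w :: p <= Z :\ c}].
Proof.
rewrite inE => /andP[wZ fcw] /ballP[p0 [pp0 lp0 sp0]].
case/shortenP: pp0 lp0 => p pp up sub lp0.
have wc : w != c by apply: contraTneq fcw => ->; rewrite irrf.
have subZ : {subset w :: p <= Z :\ c}.
  move=> z; rewrite inE => /orP[/eqP->|]; first by rewrite !inE wc.
  elim: (p) w pp {wZ fcw wc lp0 up sub} => //= b q IH w /andP[/and3P[_ bZ _] pq].
  by rewrite inE => /orP[/eqP->//|]; apply: IH pq.
exists p; split=> //.
- rewrite /= fcw /=; apply: sub_path pp => a b /and3P[]//.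
- by rewrite cons_uniq up andbT; apply/negP => /subZ; rewrite !inE eqxx.
- apply: leq_trans sp0; apply: uniq_leq_size sub.
  by case/andP: up.
Qed.

Lemma mem_branch (Z : {set V}) c w p : path f w p -> {subset w :: p <= Z :\ c} ->
  size p <= rho.-1 -> last w p \in branch Z c w.
Proof.
by move=> pp sub sp; apply/ballP; exists p; split=> //; apply: path_within.
Qed.

Lemma branch_sub (Z : {set V}) c w : w \in nbr f Z c -> branch Z c w \subset Z :\ c.
Proof.
move=> wN; apply/subsetP => v /(branchE wN)[p [_ _ <- _ sub]].
by apply: sub; exact: mem_last.
Qed.

Lemma cluster_sub (Z : {set V}) c (W : {set V}) : c \in Z -> W \subset nbr f Z c ->
  cluster Z c W \subset Z.
Proof.
move=> cZ /subsetP WN; rewrite subUset sub1set cZ /=.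
by apply/bigcupsP => w /WN /branch_sub s; apply: subset_trans s (subsetDl _ _).
Qed.

Lemma clusterE (Z : {set V}) c (W : {set V}) v : W \subset nbr f Z c ->
  v \in cluster Z c W -> exists p, [/\ path f c p, uniq (c :: p), last c p = v,
    size p <= rho & {subset c :: p <= cluster Z c W}].
Proof.
move=> /subsetP WN /setU1P[->|]; first by exists [::]; split=> // z; rewrite inE => /eqP->; rewrite setU11.
case/bigcupP => w wW vB; have wN := WN _ wW.
have [p [pp up lp sp sub]] := branchE wN vB.
exists (w :: p); split=> //; first by move: sp rho_gt0 => /=; case: (rho).
move=> z; rewrite inE => /orP[/eqP->|zp]; first exact: setU11.
case/splitPl: zp pp up lp sp sub => p1 p2 lz pp up lp sp sub.
rewrite inE; apply/orP; right; apply/bigcupP; exists w => //.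
rewrite -lz; apply: mem_branch.
- by move: pp; rewrite /= cat_path => /and3P[].
- move=> y yp; apply: sub; move: yp; rewrite !inE mem_cat.
  by case/orP => [->//|->]; rewrite orbT.
- by apply: leq_trans sp; rewrite size_cat leq_addr.
Qed.

Lemma cluster_conn (Z : {set V}) c (W : {set V}) : W \subset nbr f Z c ->
  conn f (cluster Z c W).
Proof.
move=> WN.
have sw : symmetric (within f (cluster Z c W)).
  by move=> a b; rewrite /= symf andbCA.
have cc v : v \in cluster Z c W -> connect (within f (cluster Z c W)) c v.
  case/(clusterE WN) => p [pp _ <- _ sub]; apply/connectP; exists p => //.
  exact: path_within.
move=> a b /cc ca /cc cb; apply: connect_trans cb.
by rewrite (sym_connect_sym sw).
Qed.

(** A common vertex would be the end of two simple paths of length at most [rho] from [c] with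
    different first steps. *)
Lemma branch_inj (Z : {set V}) c w w' v : w \in nbr f Z c -> w' \in nbr f Z c ->
  v \in branch Z c w -> v \in branch Z c w' -> w = w'.
Proof.
move=> wN w'N /(branchE wN)[p [pp up lp sp _]] /(branchE w'N)[q [pq uq lq sq _]].
have lpq : last c (w :: p) = last c (w' :: q) by rewrite /= lp lq.
have sz : size (w :: p) + size (w' :: q) <= g.
  by apply: leq_trans rho_g; rewrite /=; clear -sp sq rho_gt0; lia.
by case: (upf pp pq up uq lpq sz).
Qed.

(* Simple paths have distinct ends up to length [rho], so minimum degree forces
   exponential growth of a branch. *)
Lemma branch_growth (Z : {set V}) d c w (S : {set V}) : c \in Z -> w \in nbr f Z c ->
  (forall v, v \in Z -> d < #|nbr f Z v|) ->
  (forall v p, path f c (w :: p) -> last w p = v -> size p = rho.-1 -> v \in S) ->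
  d ^ rho.-1 <= #|S :&: branch Z c w|.
Proof.
move=> cZ wN deg endS.
have [wZ fcw] : w \in Z /\ f c w by move: wN; rewrite inE => /andP.
pose ok j (v : V) (p : j.-tuple V) :=
  [&& path f c (w :: p), uniq (c :: w :: p), all (mem Z) (w :: p) & last w p == v].
pose Sj j := [set v | [exists p : j.-tuple V, ok j v p]].
have grow j : j <= rho.-1 -> d ^ j <= #|Sj j|.
  elim: j => [|j IH] jr.
    rewrite expn0 card_gt0; apply/set0Pn; exists w; rewrite inE; apply/existsP.
    exists [tuple]; rewrite /ok /= fcw wZ eqxx !andbT inE.
    by apply: contraTneq fcw => ->; rewrite irrf.
  apply: leq_trans (_ : d * #|Sj j| <= _).
    by rewrite expnS leq_mul2l IH ?orbT // ltnW.
  (* A vertex reached by such a path has more than [d] neighbours, and by uniqueness of short paths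
     only its predecessor lies on the path. *)
  pose E v := [set u | f v u && [exists p : j.-tuple V, ok j v p &&
      ((u \in Z) && (u \notin c :: w :: p))]].
  rewrite mulnC -sum_nat_const; apply: leq_trans (_ : \sum_(v in Sj j) #|E v| <= _).
    apply: leq_sum => v; rewrite inE => /existsP[p okp].
    have /and4P[pp up ap /eqP lp] := okp.
    have vZ : v \in Z by rewrite -lp; apply: (allP ap); exact: mem_last.
    pose q' := belast w p.
    have qE : w :: p = rcons q' v by rewrite lastI lp.
    have := deg v vZ; rewrite (cardsD1 (last c q')) => dv.
    have {}dv : d <= #|nbr f Z v :\ last c q'| by clear -dv; case: (_ \in _) dv => /=; lia.
    apply: leq_trans dv _; apply: subset_leq_card; apply/subsetP => u.
    rewrite !inE => /and3P[nu uZ fvu]; rewrite fvu /=.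
    apply/existsP; exists p; rewrite okp uZ /=.
    apply: contra nu => uq.
    have : u \in c :: rcons q' v by rewrite -qE.
    case/split_mem => q1 [q2 [qq lq1]].
    move: pp up; rewrite qE qq -cat_cons cat_uniq cat_path => /andP[pq1 pq2] /and3P[uq1 _ uq2].
    have lq2 : last u q2 = v.
      by have := congr1 (last c) qq; rewrite last_rcons last_cat lq1.
    rewrite lq1 in pq2.
    have sq2 : size q2 <= j.+1.
      have := congr1 size qq; rewrite -qE /= size_tuple size_cat; clear; lia.
    have q2E : q2 = [:: v].
      apply: (upf (x := u)) => //.
      - by rewrite /= symf fvu.
      - rewrite cons_uniq uq2 andbT -lq1.
        have : uniq (c :: (q1 ++ q2)) by rewrite -qq -qE; case/and4P: okp.
        rewrite -cat_cons cat_uniq => /and3P[_ /hasPn h _].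
        by apply/negP => /h; rewrite /= mem_last.
      - rewrite /= inE andbT; apply: contraTneq fvu => ->; by rewrite irrf.
      - rewrite /= addn1; apply: leq_trans rho_g; apply: leq_ltn_trans sq2 _.
        by clear -jr rho_gt0; lia.
    have -> : q' = q1 by move: qq; rewrite q2E cats1 => /rcons_inj; case.
    by rewrite lq1 eqxx.
  apply: card_disjoint_cover => [v vS|v v' u vS v'S].
    apply/subsetP => u; rewrite !inE => /andP[fvu /existsP[p /and3P[/and4P[pp up ap /eqP lp] uZ nu]]].
    apply/existsP; exists [tuple of rcons p u]; apply/and4P; split.
    - by rewrite -rcons_cons rcons_path pp /= lp.
    - by rewrite -!rcons_cons rcons_uniq nu.
    - by rewrite -rcons_cons all_rcons; apply/andP.
    - by rewrite /= last_rcons.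
  rewrite !inE => /andP[fvu /existsP[p /and3P[/and4P[pp up ap /eqP lp] uZ nu]]].
  case/andP => fv'u /existsP[q /and3P[/and4P[pq uq aq /eqP lq] _ nu']].
  have : w :: rcons p u = w :: rcons q u.
    apply: (upf (x := c)).
    - by rewrite -rcons_cons rcons_path pp /= lp.
    - by rewrite -rcons_cons rcons_path pq /= lq.
    - by rewrite -!rcons_cons rcons_uniq nu.
    - by rewrite -!rcons_cons rcons_uniq nu'.
    - by rewrite /= !last_rcons.
    - rewrite /= !size_rcons !size_tuple; apply: leq_trans rho_g.
      by clear -jr rho_gt0; lia.
  by case=> /rcons_inj[pqE]; rewrite -lp -lq pqE.
apply: leq_trans (grow _ (leqnn _)) _; apply: subset_leq_card; apply/subsetP => v.
rewrite !inE => /existsP[p /and4P[pp up ap /eqP lp]]; rewrite (endS v p) ?size_tuple //=.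
rewrite -lp -/(branch Z c w); have := @mem_branch Z c w p; rewrite inE; apply.
- by case/andP: pp.
- move=> z zp; rewrite !inE; have zZ : z \in Z := allP ap z zp; rewrite zZ andbT.
  by apply: contraTneq zp => ->; case/andP: up.
- by rewrite size_tuple.
Qed.

End Branches.

Section Earcs.
Variables (V : finType) (f : rel V).

Lemma nbrS (A B : {set V}) x : A \subset B -> nbr f A x \subset nbr f B x.
Proof. by move=> /subsetP AB; apply/subsetP => z; rewrite !inE => /andP[/AB-> ->]. Qed.

Lemma earcs_mono (A A' B B' : {set V}) : A \subset A' -> B \subset B' ->
  earcs f A B <= earcs f A' B'.
Proof.
move=> AA' BB'; rewrite /earcs [X in _ <= X](big_setID A) /= (setIidPr AA').
apply: leq_trans (leq_addr _ _); apply: leq_sum => x _.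
by apply: subset_leq_card; apply: nbrS.
Qed.

Lemma earcsUl (A A' B : {set V}) : earcs f (A :|: A') B <= earcs f A B + earcs f A' B.
Proof.
rewrite /earcs (big_setID A) /= (setIidPr (subsetUl _ _)) leq_add2l (setDUl) setDv set0U.
by apply: earcs_mono => //; apply: subsetDl.
Qed.

Lemma earcs_bigcup (I : finType) (W : {set I}) (A : I -> {set V}) (B : {set V}) :
  earcs f (\bigcup_(w in W) A w) B <= \sum_(w in W) earcs f (A w) B.
Proof.
apply: (big_rec2 (fun S n => earcs f S B <= n)) => [|w n S _ le].
  by rewrite /earcs big_set0.
by apply: leq_trans (earcsUl _ _ _) _; rewrite leq_add2l.
Qed.

Lemma earcs1 x (B : {set V}) : earcs f [set x] B = #|nbr f B x|.
Proof. by rewrite /earcs big_set1. Qed.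

End Earcs.

Section Phase.
Variables (V : finType) (v0 : V) (f : rel V) (P Q : {set V}) (rho g : nat).
Hypotheses (symf : symmetric f) (irrf : irreflexive f).
Hypotheses (upf : unique_paths g f) (rho_g : 2 * rho <= g) (rho_gt0 : 0 < rho).
Hypothesis disPQ : [disjoint P & Q].
Hypothesis bip : forall x y, f x y -> (x \in P) && (y \in Q) || (x \in Q) && (y \in P).

Definition side (b : bool) := if b then P else Q.

Lemma side_step b x y : x \in side b -> f x y -> y \in side (~~ b).
Proof.
move=> xb /bip; have dis z : z \in P -> z \in Q -> false.
  by move=> zP zQ; move: disPQ; rewrite -setI_eq0 => /eqP/setP/(_ z); rewrite !inE zP zQ.
case: b xb => /= xb /orP[] /andP[xx yy] //.
  by have := dis x xb xx.
by have := dis x xx xb.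
Qed.

(** Roots are taken on [side (odd rho)], so that the outermost layer of a cluster, at distance
    [rho], always lies in [Q]. *)
Lemma side_last b x p : x \in side b -> path f x p -> last x p \in side (b (+) odd (size p)).
Proof.
elim: p x b => [|y p IH] x b /= xb; first by rewrite addbF.
case/andP => /(side_step xb) yb /(IH _ _ yb).
by rewrite addbN -addNb.
Qed.

Variables (d sigma : nat) (Good : {set V} -> V -> {set V} -> Prop).
Hypothesis d_gt0 : 0 < d.
Hypothesis select : forall (Z : {set V}) c, Z \subset P :|: Q -> c \in Z ->
  c \in side (odd rho) -> d < #|nbr f Z c| ->
  exists W : {set V}, [/\ W \subset nbr f Z c, #|nbr f Z c| <= sigma * #|W| & Good Z c W].

(* Vertices of degree at most [d] are discarded for good, which costs [d] edges
   each.  A vertex of [Q] adjacent to a non-root vertex of [P] in a cluster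
   belongs to that cluster, so carving a cluster only loses edges at its root. *)
Lemma carve_clusters (Z : {set V}) : Z \subset P :|: Q ->
  exists n (Zs : nat -> {set V}) (cs : nat -> V) (Ws : nat -> {set V}),
  let X i := cluster f rho (Zs i) (cs i) (Ws i) in
  [/\ forall i, i < n -> [/\ Zs i \subset Z, cs i \in Zs i,
          Ws i \subset nbr f (Zs i) (cs i) & Good (Zs i) (cs i) (Ws i)],
      forall i j, i < j < n -> [disjoint X i & X j],
      n * (d.+1 * d ^ rho.-1) <= sigma * #|Q :&: Z| &
      earcs f (P :&: Z) ((Q :&: Z) :\: \bigcup_(i < n) X i) <= d * #|Z| + sigma * #|Q :&: Z| ].
Proof.
have [n] := ubnP #|Z|; elim: n Z => // n IH Z; rewrite ltnS => Zn ZPQ.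
have oddE : odd rho = ~~ odd rho.-1 by rewrite -{1}(prednK rho_gt0).
have notPQ x : x \in P -> x \notin Q.
  move=> xP; apply/negP => xQ; move: disPQ; rewrite -setI_eq0 => /eqP/setP/(_ x).
  by rewrite !inE xP xQ.
case: (boolP [exists x in Z, #|nbr f Z x| <= d]) => [/exists_inP[x xZ dx]|].
  have cZ := cardsD1 x Z; rewrite xZ add1n in cZ.
  have [||n' [Zs [cs [Ws /= [h1 h2 h3 h4]]]]] := IH (Z :\ x).
  - by move: Zn; rewrite cZ.
  - exact: subset_trans (subsetDl _ _) ZPQ.
  have QZ : #|Q :&: (Z :\ x)| <= #|Q :&: Z| by apply: subset_leq_card; apply: setIS; apply: subsetDl.
  exists n', Zs, cs, Ws; split=> //=.
  - by move=> i /h1[a b c e]; split=> //; apply: subset_trans a (subsetDl _ _).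
  - by apply: leq_trans h3 _; rewrite leq_mul2l QZ orbT.
  set X := \bigcup_(i < n') _ in h4 *.
  apply: leq_trans (_ : earcs f (P :&: (Z :\ x)) (Q :&: (Z :\ x) :\: X) + d <= _); last first.
    rewrite cZ mulnS (addnC d) addnAC leq_add2r; apply: leq_trans h4 _.
    by rewrite leq_add2l leq_mul2l QZ orbT.
  case: (boolP (x \in P)) => xP.
    apply: leq_trans (_ : earcs f ((P :&: (Z :\ x)) :|: [set x]) (Q :&: (Z :\ x) :\: X) <= _).
      apply: earcs_mono; apply/subsetP => z; rewrite !inE.
        by case: (z == x); rewrite ?orbT // orbF.
      case/and3P => -> zQ -> /=; rewrite zQ andbT /=.
      by apply: contraTneq zQ => ->; apply: notPQ.
    apply: leq_trans (earcsUl _ _ _ _) _; rewrite leq_add2l earcs1.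
    apply: leq_trans dx; apply: subset_leq_card; apply: nbrS.
    by apply: subset_trans (subsetDl _ _) _; apply: subset_trans (subsetIr _ _) (subsetDl _ _).
  rewrite earcsC // [X in _ <= X + _]earcsC //.
  apply: leq_trans (_ : earcs f ((Q :&: (Z :\ x) :\: X) :|: [set x]) (P :&: (Z :\ x)) <= _).
    apply: earcs_mono; apply/subsetP => z; rewrite !inE.
      by case/and3P => -> -> ->; case: (z == x); rewrite ?orbT.
    by case/andP => zP ->; rewrite zP andbT /=; apply: contraNneq xP => <-.
  apply: leq_trans (earcsUl _ _ _ _) _; rewrite leq_add2l earcs1.
  apply: leq_trans dx; apply: subset_leq_card; apply: nbrS.
  by apply: subset_trans (subsetIr _ _) (subsetDl _ _).
rewrite negb_exists_in => /forall_inP deg.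
have {}deg v : v \in Z -> d < #|nbr f Z v| by move=> /deg; rewrite -ltnNge.
have [->|/set0Pn[x0 x0Z]] := eqVneq Z set0.
  exists 0, (fun=> set0), (fun=> v0), (fun=> set0); split=> //.
  - by move=> i j; rewrite ltn0 andbF.
  - by rewrite setI0 /earcs big_set0.
have [c cZ cside] : exists2 c, c \in Z & c \in side (odd rho).
  have xPQ := subsetP ZPQ x0 x0Z; move: (x0) x0Z xPQ => x xZ xPQ.
  have : 0 < #|nbr f Z x| by apply: leq_ltn_trans (deg x xZ).
  case/card_gt0P => y; rewrite inE => /andP[yZ fxy].
  have [b xb] : exists b, x \in side b.
    by case/setUP: xPQ => xx; [exists true|exists false].
  have yb := side_step xb fxy.
  have [bE|bE] := eqVneq b (odd rho); first by exists x; rewrite -?bE.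
  by exists y => //; move: bE yb; case: b {xb}; case: (odd rho).
have [W [WN dW good]] := select ZPQ cZ cside (deg c cZ).
set X := cluster f rho Z c W.
have XZ : X \subset Z by apply: cluster_sub.
have cX : c \in X by apply: setU11.
have [||n' [Zs [cs [Ws /= [h1 h2 h3 h4]]]]] := IH (Z :\: X).
- apply: leq_trans Zn; apply: proper_card; rewrite properE subsetDl /=.
  by apply/subsetPn; exists c; rewrite // inE cX.
- exact: subset_trans (subsetDl _ _) ZPQ.
(* By parity the paths of full length end in [Q], so the growth of a branch is counted in vertices
   of [Q]. *)
have WQ : d ^ rho.-1 * #|W| <= #|Q :&: X|.
  rewrite mulnC -sum_nat_const.
  apply: leq_trans (_ : \sum_(w in W) #|Q :&: branch f rho Z c w| <= _).
    apply: leq_sum => w /(subsetP WN) wN; apply: (branch_growth (g := g)) => // v p pp lp sp.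
    by have := side_last cside pp; rewrite /= lp sp oddE addbb.
  apply: card_disjoint_cover => [w wW|w w' v wW w'W].
    apply: setIS; apply: subset_trans (subsetUr _ _); exact: bigcup_sup wW.
  move=> /setIP[_ vw] /setIP[_ vw'].
  exact: (branch_inj irrf upf rho_g rho_gt0 (subsetP WN _ wW) (subsetP WN _ w'W) vw vw').
have cardQ : #|Q :&: Z| = #|Q :&: X| + #|Q :&: (Z :\: X)|.
  by rewrite -(cardsID X (Q :&: Z)) -setIA (setIidPr XZ) setIDA.
pose sh (T : Type) (a : T) (s : nat -> T) i := if i is i'.+1 then s i' else a.
exists n'.+1, (sh _ Z Zs), (sh _ c cs), (sh _ W Ws); split=> /=.
- by case=> [|i] /=; rewrite // ltnS => /h1[a b e e']; split=> //; apply: subset_trans a (subsetDl _ _).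
- case=> [|i] [|j] //=; rewrite !ltnS; last exact: h2.
  move=> /h1[a b e _]; have := cluster_sub rho irrf b e => s.
  by rewrite -/X disjoint_sym disjoints_subset (subset_trans s) // (subset_trans a) // setDE subsetIr.
- rewrite cardQ mulnDr mulSn leq_add //; apply: leq_trans (_ : sigma * (d ^ rho.-1 * #|W|) <= _).
    rewrite mulnCA [X in X <= _]mulnC leq_mul2l; apply/orP; right.
    exact: leq_trans (deg c cZ) dW.
  by rewrite leq_mul2l WQ orbT.
rewrite big_ord_recl /= -/X.
set XX := \bigcup_(i < n') _ in h4 *.
have UE : Q :&: Z :\: (X :|: XX) = Q :&: (Z :\: X) :\: XX by rewrite -setDDl setIDA.
rewrite UE; apply: leq_trans (_ : earcs f ((P :&: (Z :\: X)) :|: (P :&: X)) (Q :&: (Z :\: X) :\: XX) <= _).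
  apply: earcs_mono => //; rewrite -setIUr setIS //; apply/subsetP => z zZ.
  by rewrite !inE zZ andbT orNb.
apply: leq_trans (earcsUl _ _ _ _) _; rewrite cardQ mulnDr (addnC (sigma * _)) addnA.
apply: leq_add.
  by apply: leq_trans h4 _; rewrite leq_add2r leq_mul2l subset_leq_card ?orbT ?subsetDl.
apply: leq_trans (_ : earcs f [set c] (Q :&: (Z :\: X)) <= _); last first.
  rewrite earcs1; apply: leq_trans (_ : sigma * #|W| <= _).
    apply: leq_trans dW; apply: subset_leq_card; apply: nbrS.
    exact: subset_trans (subsetIr _ _) (subsetDl _ _).
  rewrite leq_mul2l; apply/orP; right; apply: leq_trans WQ.
  by rewrite -[X0 in X0 <= _]mul1n leq_mul2r expn_gt0 d_gt0 orbT.
rewrite earcs1 /earcs (bigID (pred1 c)) /= [X0 in _ + X0]big1 => [|p /andP[/setIP[pP pX] pc]]; last first.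
  apply/eqP; rewrite cards_eq0 -subset0; apply/subsetP => q; rewrite inE.
  case/andP=> /setDP[/setIP[qQ /setDP[qZ qX]] _] fpq; exfalso.
  have qc : q != c by apply: contraNneq qX => ->.
  move/negP: qX; apply; move: pX => /setU1P[/eqP|/bigcupP[w wW pB]]; first by rewrite (negbTE pc).
  have wN := subsetP WN _ wW.
  have [r [rr ur lr sr sub]] := branchE irrf wN pB.
  (* A vertex of [P] is by parity not in the outermost layer, so its branch has room for one more
     step. *)
  have sr' : size r < rho.-1.
    rewrite ltn_neqAle sr andbT; apply/eqP => srE.
    have := side_last cside rr; rewrite /= lr srE oddE addbb /= => pQ.
    by have := notPQ p pP; rewrite pQ.
  rewrite inE; apply/orP; right; apply/bigcupP; exists w => //.
  rewrite -(last_rcons w r q); apply: (mem_branch (f := f)).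
  - by rewrite rcons_path lr fpq andbT; case/andP: rr.
  - move=> z; rewrite -rcons_cons mem_rcons inE => /orP[/eqP->|]; last exact: sub.
    by rewrite !inE qc qZ.
  - by rewrite size_rcons.
rewrite addn0; apply: leq_trans (_ : \sum_(i in [set c]) #|nbr f (Q :&: (Z :\: X)) i| <= _); last by rewrite big_set1.
rewrite big_mkcond [X0 in _ <= X0]big_mkcond /=; apply: leq_sum => z _.
rewrite [z \in [set c]]inE; case: (z =P c) => [->|_]; last by rewrite andbF.
rewrite andbT; case: ifP => // _; apply: subset_leq_card; apply: nbrS; exact: subsetDl.
Qed.

End Phase.

Lemma subset_of_size (T : finType) (A : {set T}) s : s <= #|A| ->
  exists B : {set T}, B \subset A /\ #|B| = s.
Proof.
move=> sA; exists [set x in take s (enum A)]; split.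
  by apply/subsetP => x; rewrite inE => /mem_take; rewrite mem_enum.
rewrite cardsE; have /card_uniqP -> := take_uniq s (enum_uniq A).
by rewrite size_takel // -cardE.
Qed.

Lemma unique_paths_sub (T : eqType) g (f f' : rel T) : subrel f' f ->
  unique_paths g f -> unique_paths g f'.
Proof. by move=> sub up x p q pp pq; apply: up; apply: sub_path sub _ _ _. Qed.

Lemma last_catrev (T : eqType) (x c : T) p q :
  last x (p ++ rev (c :: q)) = c.
Proof. by rewrite rev_cons -rcons_cat last_rcons. Qed.

(* Two edges between disjoint trees with few vertices on the corresponding
   branches would give two short simple paths between the roots. *)
Lemma unique_crossing (V : finType) (f : rel V) g (S1 S2 : {set V}) c c' p1 p2 q1 q2 :
  symmetric f -> unique_paths g f -> [disjoint S1 & S2] ->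
  path f c p1 -> uniq (c :: p1) -> {subset c :: p1 <= S2} ->
  path f c p2 -> uniq (c :: p2) -> {subset c :: p2 <= S2} ->
  path f c' q1 -> uniq (c' :: q1) -> {subset c' :: q1 <= S1} ->
  path f c' q2 -> uniq (c' :: q2) -> {subset c' :: q2 <= S1} ->
  f (last c p1) (last c' q1) -> f (last c p2) (last c' q2) ->
  (size p1 + size q1).+1 + (size p2 + size q2).+1 <= g -> p1 = p2 /\ q1 = q2.
Proof.
move=> symf upf dis pp1 up1 sp1 pp2 up2 sp2 pq1 uq1 sq1 pq2 uq2 sq2 f1 f2 sz.
have notS x : x \in S1 -> x \in S2 -> False.
  by move=> x1; rewrite (disjointFr dis x1).
have big p q : path f c p -> path f c' q -> f (last c p) (last c' q) ->
    path f c (p ++ rev (c' :: q)).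
  move=> pp pq fpq; rewrite cat_path pp lastI rev_rcons /= fpq /=.
  by rewrite sym_rev_path.
have bigu p q : uniq (c :: p) -> uniq (c' :: q) -> {subset c :: p <= S2} ->
    {subset c' :: q <= S1} -> uniq (c :: (p ++ rev (c' :: q))).
  move=> up uq sp sq; rewrite -cat_cons cat_uniq up rev_uniq uq andbT /=.
  apply/hasPn => z; rewrite mem_rev => /sq z1; apply/negP => /sp z2.
  exact: notS z1 z2.
have E : p1 ++ rev (c' :: q1) = p2 ++ rev (c' :: q2).
  apply: (upf c).
  - exact: big.
  - exact: big.
  - exact: bigu.
  - exact: bigu.
  - by rewrite !last_catrev.
  - by rewrite !size_cat !size_rev /=; move: sz; clear; lia.
have key p q p' q' : {subset c :: p' <= S2} -> {subset c' :: q <= S1} ->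
    p ++ rev (c' :: q) = p' ++ rev (c' :: q') -> size p < size p' -> False.
  move=> sp' sq EE lt; have := congr1 (fun s => nth c s (size p)) EE.
  rewrite /= nth_cat ltnn subnn nth_cat lt => EN.
  have z1 : nth c (rev (c' :: q)) 0 \in S1.
    by apply: sq; rewrite -mem_rev mem_nth // size_rev.
  apply: (notS _ z1); rewrite EN; apply: sp'.
  by rewrite inE mem_nth ?orbT.
case: (ltngtP (size p1) (size p2)) => lt.
- by have := key _ _ _ _ sp2 sq1 E lt.
- by have := key _ _ _ _ sp1 sq2 (esym E) lt.
have := eqseq_cat (rev (c' :: q1)) (rev (c' :: q2)) lt.
rewrite E eqxx => /esym/andP[/eqP-> /eqP R]; split=> //.
by have := congr1 rev R; rewrite !revK => -[].
Qed.

(** * Two rounds of clusters and the edges between them *)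

Definition bipartite_part (V : finType) (f : rel V) (P Q : {set V}) : rel V :=
  fun x y => f x y && ((x \in P) && (y \in Q) || (x \in Q) && (y \in P)).
Arguments bipartite_part V f P Q x y /.

Definition touching (V : finType) (f : rel V) (A B : {set V}) : bool :=
  [exists x in A, exists y in B, f x y].

Lemma touchingP (V : finType) (f : rel V) (A B : {set V}) :
  reflect (exists x y, [/\ x \in A, y \in B & f x y]) (touching f A B).
Proof.
apply: (iffP exists_inP) => [[x xA /exists_inP[y yB fxy]]|[x [y [xA yB fxy]]]].
  by exists x, y.
by exists x => //; apply/exists_inP; exists y.
Qed.

Section TwoPhases.
Variables (V : finType) (v0 : V) (f : rel V) (g rho : nat) (P1 Q1 P2 Q2 : {set V}).
Hypotheses (symf : symmetric f) (irrf : irreflexive f) (upf : unique_paths g f).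
Hypotheses (rho_gt0 : 0 < rho).
Let S1 := P1 :|: Q1.
Let S2 := P2 :|: Q2.
Hypotheses (dis1 : [disjoint P1 & Q1]) (dis2 : [disjoint P2 & Q2]) (dis : [disjoint S1 & S2]).
Variables (ok : bool) (d sigma t : nat).
Hypothesis d_gt0 : 0 < d.
Hypothesis hg : if ok then 4 * rho + 2 <= g else 4 * rho <= g.
Let f1 := bipartite_part f P1 Q1.
Let f2 := bipartite_part f P2 Q2.
Hypothesis hsel1 : forall (Z : {set V}) c, c \in side P1 Q1 (odd rho) ->
  d < #|nbr f1 Z c| -> exists s, [/\ s <= #|nbr f1 Z c|, #|nbr f1 Z c| <= sigma * s & ok || (s <= t)].
Hypothesis hsel2 : forall m, d < m -> exists s, [/\ s <= m, m <= sigma * s & 2 * t * s.-1 <= m.-1].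
Hypothesis balanced1 : forall y, y \in Q1 -> #|nbr f Q2 y| <= #|nbr f P1 y|.
Hypothesis balanced2 : forall y, y \in Q2 -> #|nbr f Q1 y| <= #|nbr f P2 y|.

Let sub1 : subrel f1 f. Proof. by move=> x y /andP[]. Qed.
Let sub2 : subrel f2 f. Proof. by move=> x y /andP[]. Qed.
Let sym1 : symmetric f1.
Proof. by move=> x y; rewrite /f1 /= symf; congr andb; rewrite orbC [X in X || _]andbC [X in _ || X]andbC. Qed.
Let sym2 : symmetric f2.
Proof. by move=> x y; rewrite /f2 /= symf; congr andb; rewrite orbC [X in X || _]andbC [X in _ || X]andbC. Qed.
Let irr1 : irreflexive f1. Proof. by move=> x; rewrite /f1 /= irrf. Qed.
Let irr2 : irreflexive f2. Proof. by move=> x; rewrite /f2 /= irrf. Qed.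
Let rho4 : 4 * rho <= g.
Proof. by move: hg; case: ok => //; apply: leq_trans; rewrite leq_addr. Qed.
Let rho2 : 2 * rho <= g.
Proof. by apply: leq_trans rho4; rewrite leq_mul2r orbT. Qed.

Section SecondPhase.
Variables (n1 : nat) (Zs : nat -> {set V}) (cs : nat -> V) (Ws : nat -> {set V}).
Let X i := cluster f1 rho (Zs i) (cs i) (Ws i).
Hypothesis cl1 : forall i, i < n1 -> [/\ Zs i \subset S1, cs i \in Zs i,
  Ws i \subset nbr f1 (Zs i) (cs i) & ok || (#|Ws i| <= t)].
Hypothesis disX : forall i j, i < j < n1 -> [disjoint X i & X j].
Let C1 := Q1 :&: \bigcup_(i < n1) X i.

Let XS i : i < n1 -> X i \subset S1.
Proof. by case/cl1 => a b e _; apply: subset_trans a; apply: cluster_sub. Qed.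

(** Two branches touching one cluster of the first round yield two paths between the roots, of total
    length up to [4 * rho + 2]. If [ok] holds, as for odd [k], uniqueness applies to them. Otherwise
    the paths are started one step away from the root of that cluster, which allows one branch for
    each of its at most [t] branches and one for the root itself. *)
Lemma few_branches (Z : {set V}) c (i : 'I_n1) : Z \subset S2 -> c \in Z ->
  #|[set w in nbr f2 Z c | touching f (branch f2 rho Z c w) (X i)]| <= (if ok then 0 else t).+1.
Proof.
move=> ZS cZ; have [ZiS ciZ WiN okt] := cl1 (ltn_ord i).
have toS2 : {subset Z <= S2} by apply/subsetP.
have upc w x : w \in nbr f2 Z c -> x \in branch f2 rho Z c w ->
    exists p, [/\ path f c (w :: p), uniq (c :: w :: p), last c (w :: p) = x, size (w :: p) <= rho &
      {subset c :: w :: p <= S2}].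
  move=> wN /(branchE irr2 wN)[p [pp up lp sp sub]]; exists p; split=> //.
  - exact: sub_path sub2 _ _ pp.
  - by move: sp rho_gt0 => /=; case: (rho).
  - move=> z; rewrite inE => /orP[/eqP->|/sub]; first exact: toS2.
    by rewrite inE => /andP[_ /toS2].
have uniqw w1 w2 x1 x2 c' q1 q2 : w1 \in nbr f2 Z c -> w2 \in nbr f2 Z c ->
    x1 \in branch f2 rho Z c w1 -> x2 \in branch f2 rho Z c w2 ->
    path f c' q1 -> uniq (c' :: q1) -> {subset c' :: q1 <= S1} ->
    path f c' q2 -> uniq (c' :: q2) -> {subset c' :: q2 <= S1} ->
    f x1 (last c' q1) -> f x2 (last c' q2) ->
    (rho + size q1).+1 + (rho + size q2).+1 <= g -> w1 = w2.
  move=> w1N w2N /(upc _ _ w1N)[p1 [pp1 up1 <- sz1 s1]] /(upc _ _ w2N)[p2 [pp2 up2 <- sz2 s2]].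
  move=> a1 a2 a3 b1 b2 b3 e1 e2 sz.
  have [] := unique_crossing symf upf dis pp1 up1 s1 pp2 up2 s2 a1 a2 a3 b1 b2 b3 e1 e2.
    by apply: leq_trans sz; rewrite leq_add // ltnS leq_add2r.
  by case.
case: ifP okt => okE okt.
  apply/card_le1_eqP => w1 w2.
  rewrite inE => /andP[w1N /touchingP[x1 [y1 [x1B y1X xy1]]]].
  rewrite inE => /andP[w2N /touchingP[x2 [y2 [x2B y2X xy2]]]].
  have up1 y : y \in X i -> exists q, [/\ path f (cs i) q, uniq (cs i :: q), last (cs i) q = y,
      size q <= rho & {subset cs i :: q <= S1}].
    case/(clusterE irr1 rho_gt0 WiN) => q [pq uq lq sq subq]; exists q; split=> //.
      exact: sub_path sub1 _ _ pq.
    by move=> z /subq; apply/subsetP/XS.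
  have [q1 [a1 a2 a3 a4 a5]] := up1 _ y1X; have [q2 [b1 b2 b3 b4 b5]] := up1 _ y2X.
  apply: (uniqw w2 w1 x2 x1 (cs i) q2 q1) => //; rewrite ?a3 ?b3 //.
  move: hg; rewrite okE; apply: leq_trans; move: a4 b4; clear; lia.
move: okt => /= wt.
pose F (b : option V) : {set V} := [set w in nbr f2 Z c |
  if b is Some w' then touching f (branch f2 rho Z c w) (branch f1 rho (Zs i) (cs i) w')
  else touching f (branch f2 rho Z c w) [set cs i]].
pose B := None |: (Some @: Ws i).
apply: leq_trans (_ : #|\bigcup_(b in B) F b| <= _).
  apply: subset_leq_card; apply/subsetP => w; rewrite inE => /andP[wN /touchingP[x [y [xB yX xy]]]].
  apply/bigcupP; case/setU1P: yX => [yc|/bigcupP[w' w'W yB]].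
    exists None; first exact: setU11.
    by rewrite inE wN; apply/touchingP; exists x, y; split=> //; apply/set1P.
  exists (Some w'); first by rewrite inE; apply/orP; right; apply: imset_f.
  by rewrite inE wN; apply/touchingP; exists x, y.
apply: leq_trans (_ : \sum_(b in B) 1 <= _); last first.
  rewrite sum1_card; apply: leq_trans (cardsU1_le _ _) _; rewrite ltnS.
  by rewrite card_imset //; apply: Some_inj.
apply: leq_trans (_ : \sum_(b in B) #|F b| <= _).
  elim/big_rec2: _ => [|b a b' _ ab]; first by rewrite cards0.
  by apply: leq_trans (leq_card_setU _ _) _; rewrite leq_add2l.
apply: leq_sum => b bB; apply/card_le1_eqP => w1 w2.
case: b bB => [w'|] bB.
  have w'W : w' \in Ws i.
    by case/setU1P: bB => [//|/imsetP[z zW [->]]].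
  have w'N := subsetP WiN _ w'W.
  have w'Z : w' \in S1 by apply: (subsetP ZiS); move: w'N; rewrite inE => /andP[].
  rewrite inE => /andP[w1N /touchingP[x1 [y1 [x1B y1X xy1]]]].
  rewrite inE => /andP[w2N /touchingP[x2 [y2 [x2B y2X xy2]]]].
  have up1 y : y \in branch f1 rho (Zs i) (cs i) w' -> exists q, [/\ path f w' q, uniq (w' :: q),
      last w' q = y, size q <= rho.-1 & {subset w' :: q <= S1}].
    case/(branchE irr1 w'N) => q [pq uq lq sq subq]; exists q; split=> //.
    - by apply: sub_path sub1 _ _ _; case/andP: pq.
    - by case/andP: uq.
    - by move=> z /subq; rewrite inE => /andP[_]; apply/subsetP.
  have [q1 [a1 a2 a3 a4 a5]] := up1 _ y1X; have [q2 [b1 b2 b3 b4 b5]] := up1 _ y2X.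
  apply: (uniqw w2 w1 x2 x1 w' q2 q1) => //; rewrite ?a3 ?b3 //.
  apply: leq_trans rho4; move: a4 b4 rho_gt0; clear; lia.
rewrite inE => /andP[w1N /touchingP[x1 [y1 [x1B /set1P-> xy1]]]].
rewrite inE => /andP[w2N /touchingP[x2 [y2 [x2B /set1P-> xy2]]]].
have ciS z : z \in [:: cs i] -> z \in S1 by rewrite inE => /eqP->; apply: (subsetP ZiS).
apply: (uniqw w2 w1 x2 x1 (cs i) [::] [::]) => //=.
apply: leq_trans rho4; move: rho_gt0; clear; lia.
Qed.

(** With at most one edge from [A] to each cluster, distinct edges lead to distinct clusters. *)
Lemma crossing_edges (A : {set V}) :
  (forall (i : 'I_n1) x1 x2 y1 y2, x1 \in A -> x2 \in A -> y1 \in X i -> y2 \in X i ->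
     f x1 y1 -> f x2 y2 -> x1 = x2 /\ y1 = y2) ->
  \sum_(x in A) #|nbr f C1 x| <= #|[set i : 'I_n1 | touching f A (X i)]|.
Proof.
move=> uniqe.
apply: leq_trans (_ : \sum_(x in A) \sum_(i < n1) #|nbr f (X i) x| <= _).
  apply: leq_sum => x _; apply: leq_trans (_ : #|\bigcup_(i < n1) nbr f (X i) x| <= _).
    apply: subset_leq_card; apply/subsetP => y; rewrite inE => /andP[/setIP[_ /bigcupP[i _ yX]] fxy].
    by apply/bigcupP; exists i => //; rewrite inE yX.
  elim/big_rec2: _ => [|i a b _ ab]; first by rewrite cards0.
  by apply: leq_trans (leq_card_setU _ _) _; rewrite leq_add2l.
rewrite exchange_big /= -sum1_card [X in _ <= X]big_mkcond; apply: leq_sum => i _.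
rewrite [i \in _]inE; case: (boolP (touching f A (X i))) => [/touchingP[x0 [y0 [x0A y0X f0]]]|/negP nt]; last first.
  rewrite big1 // => x xA; apply/eqP; rewrite cards_eq0 -subset0; apply/subsetP => y.
  by rewrite inE => /andP[yX fxy]; case: nt; apply/touchingP; exists x, y.
rewrite (big_setD1 x0 x0A) /= big1 => [|x /setD1P[xx0 xA]].
  rewrite addn0; apply/card_le1_eqP => y y'; rewrite inE => /andP[yX fy]; rewrite inE => /andP[y'X fy'].
  by have [_ ->] := uniqe i x0 x0 y y' x0A x0A yX y'X fy fy'.
apply/eqP; rewrite cards_eq0 -subset0; apply/subsetP => y.
rewrite inE => /andP[yX fxy]; have [E _] := uniqe i x x0 y y0 xA x0A yX y0X fxy f0.
by rewrite E eqxx in xx0.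
Qed.

(** The property required of clusters of the second round: up to the factor 3, their edges survive
    as distinct edges of the minor. The root accounts for 1, the thinned family of branches for
    2. *)
Definition few_collisions (Z : {set V}) c (W : {set V}) : Prop :=
  \sum_(x in Q2 :&: cluster f2 rho Z c W) #|nbr f C1 x| <=
    3 * #|[set i : 'I_n1 | touching f (cluster f2 rho Z c W) (X i)]|.

Lemma root_path (i : 'I_n1) y : y \in X i -> exists q, [/\ path f (cs i) q, uniq (cs i :: q),
  last (cs i) q = y, size q <= rho & {subset cs i :: q <= S1}].
Proof.
have [ZiS ciZ WiN _] := cl1 (ltn_ord i).
case/(clusterE irr1 rho_gt0 WiN) => q [pq uq lq sq subq]; exists q; split=> //.
  exact: sub_path sub1 _ _ pq.
by move=> z /subq; apply/subsetP/XS.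
Qed.

(** [sparse_overlap] is applied to the sets of clusters touched by the single branches. One branch
    sends at most one edge to each cluster: the two crossing paths from [w] to the root [cs i] have
    total length at most [4 * rho]. *)
Lemma select_second (Z : {set V}) c : Z \subset S2 -> c \in Z -> d < #|nbr f2 Z c| ->
  exists W : {set V}, [/\ W \subset nbr f2 Z c, #|nbr f2 Z c| <= sigma * #|W| & few_collisions Z c W].
Proof.
move=> ZS cZ dm; have [s [sm ms st]] := hsel2 dm.
have toS2 : {subset Z <= S2} by apply/subsetP.
pose Tw w := [set i : 'I_n1 | touching f (branch f2 rho Z c w) (X i)].
have [|W [WN Ws2 ov]] := sparse_overlap (W := nbr f2 Z c) (Tw := Tw) (t := t) (s := s) _ sm st.
  move=> i; apply: leq_trans (_ : (if ok then 0 else t).+1 <= _); last by case: ok.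
  apply: leq_trans (few_branches i ZS cZ); apply: subset_leq_card; apply/subsetP => w.
  case/setIdP => wN iT; apply/setIdP; split=> //.
  by move: iT; rewrite inE.
exists W; split=> //; first by rewrite Ws2.
rewrite /few_collisions; set Y := cluster f2 rho Z c W; set adjY := [set i | _].
have subY (A : {set V}) : A \subset Y -> [set i : 'I_n1 | touching f A (X i)] \subset adjY.
  move=> /subsetP AY; apply/subsetP => i; rewrite !inE => /touchingP[x [y [xA yX fxy]]].
  by apply/touchingP; exists x, y; split=> //; apply: AY.
have hc : \sum_(x in [set c]) #|nbr f C1 x| <= #|adjY|.
  apply: leq_trans (_ : #|[set i : 'I_n1 | touching f [set c] (X i)]| <= _); last first.
    by apply: subset_leq_card; apply: subY; rewrite sub1set setU11.
  apply: crossing_edges => i x1 x2 y1 y2 /set1P-> /set1P-> y1X y2X fy1 fy2; split=> //.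
  have [q1 [a1 a2 a3 a4 a5]] := root_path y1X; have [q2 [b1 b2 b3 b4 b5]] := root_path y2X.
  have cS : {subset [:: c] <= S2} by move=> z; rewrite inE => /eqP->; apply: toS2.
  have u0 : uniq [:: c] by [].
  have pp0 : path f c [::] by [].
  have e1 : f (last c [::]) (last (cs i) q1) by rewrite a3.
  have e2 : f (last c [::]) (last (cs i) q2) by rewrite b3.
  have sz : (size ([::] : seq V) + size q1).+1 + (size ([::] : seq V) + size q2).+1 <= g.
    by apply: leq_trans rho4; move: a4 b4 rho_gt0 => /=; clear; lia.
  have [_ E] := unique_crossing symf upf dis pp0 u0 cS pp0 u0 cS a1 a2 a5 b1 b2 b5 e1 e2 sz.
  by rewrite -a3 -b3 E.
have hw w : w \in W -> \sum_(x in Q2 :&: branch f2 rho Z c w) #|nbr f C1 x| <= #|Tw w|.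
  move=> wW; have wN := subsetP WN _ wW.
  have wS : {subset branch f2 rho Z c w <= S2}.
    by move=> z /(subsetP (branch_sub rho irr2 wN)) /setD1P[_]; apply: toS2.
  apply: leq_trans (_ : #|[set i : 'I_n1 | touching f (Q2 :&: branch f2 rho Z c w) (X i)]| <= _); last first.
    apply: subset_leq_card; apply/subsetP => i; rewrite !inE => /touchingP[x [y [xA yX fxy]]].
    by apply/touchingP; exists x, y; split=> //; case/setIP: xA.
  apply: crossing_edges => i x1 x2 y1 y2 /setIP[_ x1B] /setIP[_ x2B] y1X y2X fy1 fy2.
  have [q1 [a1 a2 a3 a4 a5]] := root_path y1X; have [q2 [b1 b2 b3 b4 b5]] := root_path y2X.
  have up x : x \in branch f2 rho Z c w -> exists p, [/\ path f w p, uniq (w :: p), last w p = x,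
      size p <= rho.-1 & {subset w :: p <= S2}].
    case/(branchE irr2 wN) => p [pp up lp sp subp]; exists p; split=> //.
    - by apply: sub_path sub2 _ _ _; case/andP: pp.
    - by case/andP: up.
    - by move=> z /subp; rewrite inE => /andP[_]; apply: toS2.
  have [p1 [e1 e2 e3 e4 e5]] := up _ x1B; have [p2 [h1 h2 h3 h4 h5]] := up _ x2B.
  have k1 : f (last w p1) (last (cs i) q1) by rewrite e3 a3.
  have k2 : f (last w p2) (last (cs i) q2) by rewrite h3 b3.
  have sz : (size p1 + size q1).+1 + (size p2 + size q2).+1 <= g.
    by apply: leq_trans rho4; move: a4 b4 e4 h4 rho_gt0 => /=; clear; lia.
  have [E1 E2] := unique_crossing symf upf dis e1 e2 e5 h1 h2 h5 a1 a2 a5 b1 b2 b5 k1 k2 sz.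
  by rewrite -e3 -h3 -a3 -b3 E1 E2.
have hU : #|\bigcup_(w in W) Tw w| <= #|adjY|.
  apply: subset_leq_card; apply/bigcupsP => w wW; apply: subY.
  by apply: subset_trans (subsetUr _ _); apply: bigcup_sup wW.
apply: leq_trans (_ : \sum_(x in [set c]) #|nbr f C1 x| +
    \sum_(w in W) \sum_(x in Q2 :&: branch f2 rho Z c w) #|nbr f C1 x| <= _).
  apply: leq_trans (_ : \sum_(x in [set c]) #|nbr f C1 x| +
      \sum_(x in \bigcup_(w in W) (Q2 :&: branch f2 rho Z c w)) #|nbr f C1 x| <= _).
    apply: leq_trans (earcsUl f _ _ _); apply: earcs_mono => //.
    apply/subsetP => x /setIP[xQ /setU1P[->|/bigcupP[w wW xB]]]; first by rewrite !inE eqxx.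
    by rewrite inE; apply/orP; right; apply/bigcupP; exists w => //; rewrite inE xQ.
  by rewrite leq_add2l; apply: earcs_bigcup.
rewrite mulSn leq_add //; apply: leq_trans (_ : 2 * #|\bigcup_(w in W) Tw w| <= _).
  by apply: leq_trans ov; apply: leq_sum.
by rewrite leq_mul2l.
Qed.

End SecondPhase.

Lemma select_first (Z : {set V}) c : c \in side P1 Q1 (odd rho) -> d < #|nbr f1 Z c| ->
  exists W : {set V}, [/\ W \subset nbr f1 Z c, #|nbr f1 Z c| <= sigma * #|W| &
    ok || (#|W| <= t)].
Proof.
move=> cs dm; have [s [sm ms st]] := hsel1 cs dm.
by have [W [WN Ws]] := subset_of_size sm; exists W; rewrite Ws.
Qed.

Lemma earcs_bipartite (P Q A B : {set V}) : A \subset P -> B \subset Q ->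
  earcs (bipartite_part f P Q) A B = earcs f A B.
Proof.
move=> /subsetP AP /subsetP BQ; apply: eq_bigr => x /AP xP; apply: eq_card => y.
by rewrite !inE; case: (boolP (y \in B)) => //= /BQ yQ; rewrite xP yQ /= andbT.
Qed.

(** Contracting the clusters gives a minor, so there are at most [minor_density h] adjacent pairs
    per cluster. An edge between [Q1] and [Q2] with an end outside the clusters is charged, through
    the balance hypotheses, to the edges between a [Q] and its [P] that carving lost. *)
Lemma two_phases h : 0 < h -> ~ Kminor_on h f [set: V] ->
  exists n1 n2, [/\ n1 * (d.+1 * d ^ rho.-1) <= sigma * #|Q1|,
    n2 * (d.+1 * d ^ rho.-1) <= sigma * #|Q2| &
    earcs f Q1 Q2 <= 3 * (minor_density h * (n1 + n2)) +
      (d * (#|S1| + #|S2|) + sigma * (#|Q1| + #|Q2|))].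
Proof.
move=> h0 noK.
have bip1 x y : f1 x y -> (x \in P1) && (y \in Q1) || (x \in Q1) && (y \in P1) by case/andP.
have bip2 x y : f2 x y -> (x \in P2) && (y \in Q2) || (x \in Q2) && (y \in P2) by case/andP.
have up1 := unique_paths_sub sub1 upf; have up2 := unique_paths_sub sub2 upf.
have [n1 [Zs [cs [Ws /= [h1 disX cnt1 lost1]]]]] :=
  @carve_clusters V v0 f1 P1 Q1 rho g sym1 irr1 up1 rho2 rho_gt0 dis1 bip1 d sigma
   (fun _ _ W => ok || (#|W| <= t)) d_gt0 (fun Z c _ _ cs dm => select_first cs dm) S1 (subxx _).
have cl1 i : i < n1 -> [/\ Zs i \subset S1, cs i \in Zs i,
  Ws i \subset nbr f1 (Zs i) (cs i) & ok || (#|Ws i| <= t)] by apply: h1.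
have [n2 [Zs2 [cs2 [Ws2 /= [h2 disY cnt2 lost2]]]]] :=
  @carve_clusters V v0 f2 P2 Q2 rho g sym2 irr2 up2 rho2 rho_gt0 dis2 bip2 d sigma
   (few_collisions n1 Zs cs Ws) d_gt0
   (fun Z c ZS cZ _ dm => select_second cl1 ZS cZ dm) S2 (subxx _).
pose X i := cluster f1 rho (Zs i) (cs i) (Ws i).
pose Y j := cluster f2 rho (Zs2 j) (cs2 j) (Ws2 j).
pose C1 := Q1 :&: \bigcup_(i < n1) X i.
pose adj (j : 'I_n2) := [set i : 'I_n1 | touching f (Y j) (X i)].
have Q1S : Q1 :&: S1 = Q1 by apply/setIidPl; apply: subsetUr.
have Q2S : Q2 :&: S2 = Q2 by apply/setIidPl; apply: subsetUr.
have P1S : P1 :&: S1 = P1 by apply/setIidPl; apply: subsetUl.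
have P2S : P2 :&: S2 = P2 by apply/setIidPl; apply: subsetUl.
rewrite Q1S P1S earcs_bipartite // ?subsetDl // in cnt1 lost1.
rewrite Q2S P2S earcs_bipartite // ?subsetDl // in cnt2 lost2.
exists n1, n2; split=> //.
have XS (i : 'I_n1) : X i \subset S1.
  by have [a b e _] := cl1 i (ltn_ord i); apply: subset_trans (cluster_sub rho irr1 b e) a.
have YS (j : 'I_n2) : Y j \subset S2.
  by have [a b e _] := h2 j (ltn_ord j); apply: subset_trans (cluster_sub rho irr2 b e) a.
have pairs : \sum_(j < n2) #|adj j| <= minor_density h * (n1 + n2).
  pose e' : rel ('I_n1 + 'I_n2) := fun a b => match a, b with
    | inl i, inr j => i \in adj j | inr j, inl i => i \in adj j | _, _ => false end.
  have syme' : symmetric e' by case=> a [] b.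
  have irre' : irreflexive e' by case.
  have mi : minor_on e' [set: 'I_n1 + 'I_n2] f.
    exists (fun a : 'I_n1 + 'I_n2 => match a with inl i => X i | inr j => Y j end); split.
    - by case=> a _; apply/set0Pn; [exists (cs a)|exists (cs2 a)]; apply: setU11.
    - case=> a _.
        have [_ _ e _] := cl1 a (ltn_ord a).
        by apply: conn_rel (cluster_conn sym1 irr1 rho_gt0 e) => u v _ _; apply: sub1.
      have [_ _ e _] := h2 a (ltn_ord a).
      by apply: conn_rel (cluster_conn sym2 irr2 rho_gt0 e) => u v _ _; apply: sub2.
    - case=> a [] b _ _ ab.
      + have : val a != val b by apply: contraNneq ab => /val_inj->.
        rewrite neq_ltn => /orP[] lt; last rewrite disjoint_sym; apply: disX; rewrite lt;
        exact: ltn_ord.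
      + by rewrite (disjointWl (XS a)) // (disjointWr (YS b)).
      + by rewrite disjoint_sym (disjointWl (XS b)) // (disjointWr (YS a)).
      + have : val a != val b by apply: contraNneq ab => /val_inj->.
        rewrite neq_ltn => /orP[] lt; last rewrite disjoint_sym; apply: disY; rewrite lt;
        exact: ltn_ord.
    - case=> a [] b _ _ ab //=; rewrite inE => /touchingP[x [y [xY yX fxy]]].
        by exists y, x; rewrite symf.
      by exists x, y.
  have narcsE : narcs e' [set: 'I_n1 + 'I_n2] = 2 * \sum_(j < n2) #|adj j|.
    have nl a : #|nbr e' [set: 'I_n1 + 'I_n2] a| = \sum_b (e' a b : nat).
      rewrite -sum1_card big_mkcond; apply: eq_bigr => b _.
      by rewrite inE in_setT /=; case: (e' a b).
    rewrite /narcs (eq_bigl xpredT) => [|a]; last by rewrite in_setT.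
    rewrite (eq_bigr _ (fun a _ => nl a)) big_sumType /= mulSn mul1n; congr (_ + _).
      rewrite (eq_bigr (fun i : 'I_n1 => \sum_(j < n2) (i \in adj j : nat))) => [|i _]; last first.
        by rewrite big_sumType /= big1.
      rewrite exchange_big; apply: eq_bigr => j _; rewrite -sum1_card [RHS]big_mkcond.
      by apply: eq_bigr => i _; case: (i \in adj j).
    apply: eq_bigr => j _; rewrite big_sumType /= [X in _ + X]big1 // addn0.
    by rewrite -sum1_card [RHS]big_mkcond; apply: eq_bigr => i _; case: (i \in adj j).
  have [n0|npos] := posnP (n1 + n2).
    by rewrite big1 // => j; have := ltn_ord j; move: n0; clear; lia.
  rewrite leqNgt; apply/negP => lt; apply: noK; apply: (Kminor_lift symf irre' mi).
  apply: Kminor_density => //; first by rewrite card_sum !card_ord.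
  rewrite narcsE card_sum !card_ord -mulnA leq_mul2l /=; exact: ltnW.
set XX := \bigcup_(i < n1) _ in lost1.
set YY := \bigcup_(i < n2) _ in lost2.
have l1 : earcs f (Q1 :\: XX) Q2 <= d * #|S1| + sigma * #|Q1|.
  apply: leq_trans lost1; rewrite [X in _ <= X]earcsC //; apply: leq_sum => y.
  by rewrite inE => /andP[_]; apply: balanced1.
have l2 : earcs f (Q2 :\: YY) Q1 <= d * #|S2| + sigma * #|Q2|.
  apply: leq_trans lost2; rewrite [X in _ <= X]earcsC //; apply: leq_sum => y.
  by rewrite inE => /andP[_]; apply: balanced2.
have l3 : earcs f (Q2 :&: YY) C1 <= 3 * (minor_density h * (n1 + n2)).
  apply: leq_trans (_ : 3 * \sum_(j < n2) #|adj j| <= _); last by rewrite leq_mul2l pairs.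
  apply: leq_trans (_ : \sum_(j in [set: 'I_n2]) earcs f (Q2 :&: Y j) C1 <= _).
    apply: leq_trans (earcs_bigcup f _ _ _); apply: earcs_mono => //.
    apply/subsetP => x /setIP[xQ /bigcupP[j _ xY]]; apply/bigcupP; exists j; first exact: in_setT.
    by rewrite inE xQ.
  rewrite big_distrr /= (eq_bigl xpredT) => [|j]; last by rewrite in_setT.
  by apply: leq_sum => j _; have [_ _ _] := h2 j (ltn_ord j).
have e1 : earcs f Q1 Q2 <= earcs f C1 Q2 + earcs f (Q1 :\: XX) Q2.
  by apply: leq_trans (earcsUl _ _ _ _); rewrite setID.
have e2 : earcs f C1 Q2 <= earcs f (Q2 :&: YY) C1 + earcs f (Q2 :\: YY) Q1.
  rewrite earcsC //; apply: leq_trans (_ : earcs f ((Q2 :&: YY) :|: (Q2 :\: YY)) C1 <= _).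
    by rewrite setID.
  apply: leq_trans (earcsUl _ _ _ _) _; rewrite leq_add2l; apply: earcs_mono => //.
  exact: subsetIl.
move: l1 l2 l3 e1 e2; rewrite !mulnDr.
move: (earcs f Q1 Q2) (earcs f C1 Q2) (earcs f (Q1 :\: XX) Q2) (earcs f (Q2 :&: YY) C1) (earcs f (Q2 :\: YY) Q1).
by move=> a b c e e'; clear; lia.
Qed.

End TwoPhases.

(** * The density bound for graphs of large girth *)

Lemma Kminor_subrel (T : finType) h (e' e : rel T) : symmetric e -> irreflexive e' ->
  subrel e' e -> Kminor_on h e' [set: T] -> Kminor_on h e [set: T].
Proof.
move=> syme irr' sub; apply: Kminor_lift => //.
exists (fun x => [set x]); split=> [u _|u _|u v _ _ uv|u v _ _ euv].
- by apply/set0Pn; exists u; rewrite set11.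
- exact: conn1.
- by rewrite disjoints1 inE.
- by exists u, v; rewrite !set11; split=> //; apply: sub.
Qed.

(** Every vertex selects [D] neighbours, and a directed cut keeps the selections made in [A]. This
    caps the degrees on the side of the first-round roots, so that a fixed fraction of the branches
    there is at most [t] branches. *)
Lemma bounded_directed_cut (T : finType) (e : rel T) (U : {set T}) D : symmetric e ->
  irreflexive e -> (forall x, x \in U -> D <= #|nbr e U x|) ->
  exists (A B : {set T}) (c : rel T), [/\ A :|: B \subset U, [disjoint A & B],
    [/\ symmetric c, irreflexive c & subrel c e],
    forall x (Z : {set T}), x \in A -> #|nbr c Z x| <= D &
    D * #|U| <= 4 * earcs c A B].
Proof.
move=> syme irre degU.
pose L x : {set T} := [set y in take D (enum (nbr e U x))].
have LN x : L x \subset nbr e U x.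
  by apply/subsetP => y; rewrite inE => /mem_take; rewrite mem_enum.
have cardL x : #|L x| = minn D #|nbr e U x|.
  rewrite cardsE; have /card_uniqP -> := take_uniq D (enum_uniq (nbr e U x)).
  by rewrite size_take_min -cardE.
pose a : rel T := fun x y => y \in L x.
have ae : subrel a e by move=> x y /(subsetP (LN x)); rewrite inE => /andP[].
have [|A [AU cut]] := @directed_cut T a U.
  by move=> x; apply/negbTE/negP => /ae; rewrite irre.
pose c : rel T := fun x y => [&& x \in A, y \in U :\: A & a x y] || [&& y \in A, x \in U :\: A & a y x].
have cA x y : x \in A -> c x y = (y \in U :\: A) && a x y.
  by move=> xA; rewrite /c xA /= !inE xA /= andbF orbF.
exists A, (U :\: A), c; split.
- by rewrite subUset AU subsetDl.
- by rewrite disjoint_sym disjoints_subset setDE subsetIr.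
- split=> [x y|x|x y].
  + by rewrite /c orbC.
  + by rewrite /c !inE; case: (x \in A).
  + by case/orP => /and3P[_ _ /ae]; rewrite // syme.
- move=> x Z xA; apply: leq_trans (_ : #|L x| <= _); last by rewrite cardL geq_minl.
  apply: subset_leq_card; apply/subsetP => y; rewrite inE => /andP[_].
  by rewrite cA // => /andP[].
- apply: leq_trans (_ : earcs a U U <= _).
    rewrite mulnC -sum_nat_const; apply: leq_sum => x xU.
    apply: leq_trans (_ : #|L x| <= _); first by rewrite cardL leq_min leqnn degU.
    apply: subset_leq_card; apply/subsetP => y yL; rewrite inE; apply/andP; split=> //.
    by have := subsetP (LN x) y yL; rewrite inE => /andP[].
  apply: leq_trans cut _; rewrite leq_mul2l; apply/orP; right; apply: leq_sum => x xA.
  by apply: subset_leq_card; apply/subsetP => y; rewrite inE => /andP[yB axy]; rewrite inE yB cA // yB.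
Qed.

(** [balanced_split] is used once in each direction, each time at the price of a factor 8. The first
    balance persists because [Q2] is taken inside [X :\: X1]. *)
Lemma four_parts (T : finType) (c : rel T) (X Y : {set T}) : symmetric c -> [disjoint X & Y] ->
  exists P1 Q1 P2 Q2 : {set T},
  [/\ P1 :|: Q2 \subset X, P2 :|: Q1 \subset Y, [disjoint P1 & Q2] && [disjoint P2 & Q1],
    (forall y, y \in Q1 -> #|nbr c Q2 y| <= #|nbr c P1 y|) /\
    (forall y, y \in Q2 -> #|nbr c Q1 y| <= #|nbr c P2 y|) &
    earcs c X Y <= 64 * earcs c Q1 Q2 + 8 * #|X| + #|Y|].
Proof.
move=> symc dis.
have [X1 [Y' [X1X Y'Y bal1 le1]]] := balanced_split X Y symc.
have [Y1 [X' [Y1Y X'X bal2 le2]]] := balanced_split Y' (X :\: X1) symc.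
exists X1, (Y' :\: Y1), Y1, X'; split.
- by rewrite subUset X1X (subset_trans X'X) // subsetDl.
- by rewrite subUset (subset_trans Y1Y) //= (subset_trans _ Y'Y) // subsetDl.
- apply/andP; split.
    rewrite disjoint_sym disjoints_subset; apply: subset_trans X'X _.
    by rewrite setDE subsetIr.
  by rewrite disjoint_sym disjoints_subset setDE subsetIr.
- split=> [y /setDP[yY' _]|]; last exact: bal2.
  apply: leq_trans (bal1 _ yY'); apply: subset_leq_card; apply/subsetP => z.
  by rewrite inE => /andP[zX' cz]; rewrite inE (subsetP X'X).
- have s1 : #|X :\: X1| <= #|X| by apply/subset_leq_card/subsetDl.
  have := earcsC symc (X :\: X1) Y'.
  move: le1 le2 s1; move: (earcs c X Y) (earcs c _ _) (earcs c _ _) (earcs c _ _) #|X :\: X1| => p q r s u.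
  clear; lia.
Qed.

(** The number of clusters is at most [sigma * #|U| / d ^ rho], so [#|U|] cancels and an inequality
    between the parameters remains. The factor 256 is 4 from the directed cut times 64 from the two
    splits. *)
Lemma two_phase_density (T : finType) (f : rel T) (U : {set T}) (ok : bool) h rho d sigma t D :
  symmetric f -> irreflexive f -> unique_paths (4 * rho + 2 * ok) f -> 0 < rho -> 0 < d ->
  0 < h -> ~ Kminor_on h f [set: T] -> U != set0 ->
  (forall x, x \in U -> D <= #|nbr f U x|) ->
  (forall m, d < m -> m <= D -> exists s, [/\ s <= m, m <= sigma * s & ok || (s <= t)]) ->
  (forall m, d < m -> exists s, [/\ s <= m, m <= sigma * s & 2 * t * s.-1 <= m.-1]) ->
  D * d ^ rho <= 256 * (3 * minor_density h * sigma) + (36 + 256 * (d + sigma)) * d ^ rho.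
Proof.
move=> symf irrf upf rho0 d0 h0 noK U0 degU sel1 sel2.
have [v0 v0U] := set0Pn _ U0.
have [A [B [c [ABU disAB [symc irrc cf] degA cut]]]] := bounded_directed_cut symf irrf degU.
(* The part that holds the first-round roots, [P1] for odd [rho] and [Q1] otherwise, has to come
   from [A], where degrees are capped. *)
pose X := if odd rho then A else B; pose Y := if odd rho then B else A.
have disXY : [disjoint X & Y] by rewrite /X /Y; case: (odd rho); rewrite // disjoint_sym.
have XYU : X :|: Y \subset U by rewrite /X /Y; case: (odd rho); rewrite // setUC.
have eXY : earcs c A B = earcs c X Y by rewrite /X /Y; case: (odd rho); rewrite // earcsC.
have [P1 [Q1 [P2 [Q2 [sX sY dPQ [bal1 bal2] le]]]]] := four_parts symc disXY.
have [/andP[dis12 dis21]] := (dPQ); move: sX sY; rewrite !subUset => /andP[P1X Q2X] /andP[P2Y Q1Y].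
have upc : unique_paths (4 * rho + 2 * ok) c by apply: unique_paths_sub upf.
have noKc : ~ Kminor_on h c [set: T] by move=> K; apply: noK; apply: Kminor_subrel cf K.
have dis1 : [disjoint P1 & Q1] by rewrite (disjointWl P1X) // (disjointWr Q1Y).
have dis2 : [disjoint P2 & Q2].
  by rewrite disjoint_sym (disjointWl Q2X) // (disjointWr P2Y).
have dis : [disjoint P1 :|: Q1 & P2 :|: Q2].
  have nXY x : x \in X -> x \in Y -> False by move=> xX; rewrite (disjointFr disXY xX).
  rewrite disjoint_subset; apply/subsetP => x /setUP[] x1; rewrite inE; apply/negP => /setUP[] x2.
  - by apply: (nXY x); [apply: (subsetP P1X)|apply: (subsetP P2Y)].
  - by rewrite (disjointFr dis12 x1) in x2.
  - by rewrite (disjointFl dis21 x1) in x2.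
  - by apply: (nXY x); [apply: (subsetP Q2X)|apply: (subsetP Q1Y)].
have hg : if ok then 4 * rho + 2 <= 4 * rho + 2 * ok else 4 * rho <= 4 * rho + 2 * ok.
  by case: (ok); rewrite ?leqnn ?addn0.
have hsel1 : forall (Z : {set T}) x, x \in side P1 Q1 (odd rho) ->
  d < #|nbr (bipartite_part c P1 Q1) Z x| -> exists s, [/\ s <= #|nbr (bipartite_part c P1 Q1) Z x|,
    #|nbr (bipartite_part c P1 Q1) Z x| <= sigma * s & ok || (s <= t)].
  move=> Z x xs dm; apply: sel1 => //.
  have xA : x \in A.
    move: xs P1X Q1Y; rewrite /side /X /Y; case: (odd rho) => xs PX QY; first exact: (subsetP PX).
    exact: (subsetP QY).
  apply: leq_trans (degA x Z xA); apply: subset_leq_card; apply/subsetP => y.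
  by rewrite inE => /and3P[yZ cxy _]; rewrite inE yZ.
have [n1 [n2 [c1 c2 lost]]] := two_phases v0 symc irrc upc rho0 dis1 dis2 dis d0 hg hsel1 sel2 bal1 bal2 h0 noKc.
have szXY : #|X| + #|Y| <= #|U|.
  by apply: leq_trans (subset_leq_card XYU); rewrite cardsU (disjoint_setI0 disXY) cards0 subn0.
have szS : #|P1 :|: Q1| + #|P2 :|: Q2| <= #|U|.
  apply: leq_trans (subset_leq_card XYU); apply: leq_trans (_ : #|(P1 :|: Q1) :|: (P2 :|: Q2)| <= _).
    by rewrite [X in _ <= X]cardsU (disjoint_setI0 dis) cards0 subn0.
  apply: subset_leq_card; rewrite !subUset.
  by rewrite (subset_trans P1X) ?subsetUl // (subset_trans Q2X) ?subsetUl //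
     (subset_trans Q1Y) ?subsetUr // (subset_trans P2Y) ?subsetUr.
have szQ : #|Q1| + #|Q2| <= #|U|.
  apply: leq_trans szS; apply: leq_add; apply: subset_leq_card; exact: subsetUr.
have npos : 0 < #|U| by apply/card_gt0P; exists v0.
have dk : d ^ rho <= d.+1 * d ^ rho.-1.
  by rewrite -{1}(prednK rho0) expnS leq_mul2r leqnSn orbT.
have cnt : (n1 + n2) * d ^ rho <= sigma * #|U|.
  apply: leq_trans (_ : (n1 + n2) * (d.+1 * d ^ rho.-1) <= _); first by rewrite leq_mul2l dk orbT.
  rewrite mulnDl; apply: leq_trans (leq_add c1 c2) _; rewrite -mulnDr leq_mul2l szQ orbT //.
rewrite -(leq_pmul2r npos).
have h1 : D * #|U| <= 256 * earcs c Q1 Q2 + 36 * #|U|.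
  move: cut le szXY; rewrite eXY; move: (earcs c X Y) (earcs c Q1 Q2) (D * #|U|) #|U| #|X| #|Y|.
  clear; lia.
have h2 : earcs c Q1 Q2 * d ^ rho <= 3 * minor_density h * (sigma * #|U|) + (d + sigma) * #|U| * d ^ rho.
  apply: leq_trans (leq_mul lost (leqnn _)) _; rewrite mulnDl; apply: leq_add.
    by rewrite [3 * _]mulnA -mulnA leq_mul2l cnt orbT.
  rewrite leq_mul2r mulnDl; apply/orP; right.
  by apply: leq_add; rewrite leq_mul2l ?szS ?szQ orbT.
have h3 : D * #|U| * d ^ rho <= 256 * (earcs c Q1 Q2 * d ^ rho) + 36 * #|U| * d ^ rho.
  by rewrite mulnA -mulnDl leq_mul2r h1 orbT.
apply: leq_trans (_ : D * #|U| * d ^ rho <= _); first by rewrite -!mulnA [d ^ _ * _]mulnC.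
apply: leq_trans h3 _; apply: leq_trans (_ : 256 * (3 * minor_density h * (sigma * #|U|) + (d + sigma) * #|U| * d ^ rho) + 36 * #|U| * d ^ rho <= _).
  by rewrite leq_add2r leq_mul2l h2 orbT.
rewrite leq_eqVlt; apply/orP; left; apply/eqP.
move: (minor_density h) (d ^ rho) #|U| => M E n; clear; lia.
Qed.

Lemma odd_density_numeric D d E M rho : 0 < rho -> 2 ^ 31 <= D -> d = D %/ 2 ^ 10 ->
  D * E <= 256 * (3 * M * 1) + (36 + 256 * (d + 1)) * E -> E = d ^ rho ->
  D ^ rho.+1 <= 2 ^ (11 * rho.+1) * M.
Proof.
move=> rho0 D31 dE; have D31' : 2 ^ 11 * (2 ^ 10 * 2 ^ 10) <= D.
  by move: (D31); rewrite -[31]/(11 + (10 + 10)) !expnD.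
have dlow : D <= 2 ^ 11 * d by move: D31' dE; clear; lia.
have dup : 2 ^ 10 * d <= D by rewrite dE mulnC leq_trunc_div.
move=> H HE; have h1 : D * E <= 2 * (256 * (3 * M)).
  have : 2 * ((36 + 256 * (d + 1)) * E) <= D * E.
    by rewrite mulnA leq_mul2r; apply/orP; right; move: D31' dup; clear; lia.
  move: H; move: (D * E) (_ * E) => a b; clear; lia.
have h2 : D ^ rho <= 2 ^ (11 * rho) * E.
  by rewrite HE expnM -expnMn leq_exp2r.
rewrite expnS mulnS expnD; apply: leq_trans (leq_mul (leqnn D) h2) _.
rewrite mulnCA [2 ^ 11 * _]mulnC -mulnA leq_mul2l; apply/orP; right.
by apply: leq_trans h1 _; clear; lia.
Qed.

(** Keeping one branch in [4 * r], with [r] about [sqrt D], leaves [D * d ^ rho = O(M * sqrt D)].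
    Squaring and cancelling one factor [D] gives the exponent [2 * rho + 1 = k + 1]. *)
Lemma even_density_numeric D d E M rho r : 0 < rho -> 2 ^ 31 <= D -> d = D %/ 2 ^ 10 ->
  r ^ 2 <= 4 * D ->
  D * E <= 256 * (3 * M * (4 * r)) + (36 + 256 * (d + 4 * r)) * E -> E = d ^ rho ->
  D ^ (2 * rho).+1 <= 2 ^ (22 * rho + 28) * M ^ 2.
Proof.
move=> rho0 D31 dE rD; have D31' : 2 ^ 11 * (2 ^ 10 * 2 ^ 10) <= D.
  by move: (D31); rewrite -[31]/(11 + (10 + 10)) !expnD.
have dlow : D <= 2 ^ 11 * d by move: D31' dE; clear; lia.
have dup : 2 ^ 10 * d <= D by rewrite dE mulnC leq_trunc_div.
have rlow : 2 ^ 13 * r <= D.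
  rewrite -(@leq_exp2r _ _ 2) // expnMn.
  apply: leq_trans (leq_mul (leqnn _) rD) _; rewrite mulnA -[D ^ 2]/(D * D) leq_mul2r.
  apply/orP; right; apply: leq_trans D31; rewrite -expnM -[4]/(2 ^ 2) -expnD.
  by rewrite leq_exp2l.
move=> H HE; have h1 : D * E <= 2 * (256 * (3 * M * (4 * r))).
  have : 2 * ((36 + 256 * (d + 4 * r)) * E) <= D * E.
    by rewrite mulnA leq_mul2r; apply/orP; right; move: D31' dup rlow; clear; lia.
  move: H; move: (D * E) (_ * E) => a b; clear; lia.
have h2 : D ^ rho <= 2 ^ (11 * rho) * E.
  by rewrite HE expnM -expnMn leq_exp2r.
have h3 : D ^ rho.+1 <= 2 ^ (11 * rho) * (2 ^ 13 * (M * r)).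
  rewrite expnS; apply: leq_trans (leq_mul (leqnn D) h2) _.
  rewrite mulnCA leq_mul2l; apply/orP; right; apply: leq_trans h1 _.
  by clear; lia.
have h4 : D * D ^ (2 * rho).+1 <= 2 ^ (22 * rho + 26) * M ^ 2 * r ^ 2.
  rewrite -expnS -[(2 * rho).+2]/(2 + 2 * rho) -mulnS mulnC expnM.
  have := leq_mul h3 h3; rewrite !mulnn => h; apply: leq_trans h _.
  rewrite [2 ^ _ * (2 ^ _ * _)]mulnA -expnD expnMn -expnM expnMn mulnA leq_eqVlt.
  by apply/orP; left; apply/eqP; congr (2 ^ _ * _ * _); clear; lia.
have Dpos : 0 < D by apply: leq_trans D31; rewrite expn_gt0.
rewrite -(leq_pmul2l Dpos); apply: leq_trans h4 _.
apply: leq_trans (leq_mul (leqnn _) rD) _.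
rewrite -[28]/(26 + 2) addnA [in X in _ <= X]expnD leq_eqVlt; apply/orP; left; apply/eqP.
by rewrite -[2 ^ 2]/4; move: (2 ^ _) (M ^ 2) => a b; clear; lia.
Qed.

Lemma ceil_sqrt D : exists r, D <= r ^ 2 /\ (0 < D -> r ^ 2 <= 4 * D).
Proof.
have ex : exists r, D <= r ^ 2 by exists D; rewrite -mulnn; case: D => // n; rewrite leq_pmulr.
exists (ex_minn ex); case: ex_minnP => r rD rmin; split=> // D0.
case: r rD rmin => [|[|r]] rD rmin //; first by move: D0; clear; lia.
have : r.+1 ^ 2 < D by rewrite ltnNge; apply/negP => /rmin; rewrite ltnn.
by rewrite -!mulnn; clear; lia.
Qed.

Lemma minor_density_gt0 h : 0 < h -> 0 < minor_density h.
Proof. by move=> h0; rewrite /minor_density !muln_gt0 h0. Qed.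

Lemma girth_minor_density (T : finType) (f : rel T) h k D :
  symmetric f -> irreflexive f -> 0 < k -> unique_paths (2 * k) f -> 0 < h ->
  ~ Kminor_on h f [set: T] -> 2 * D * #|T| < narcs f [set: T] ->
  D ^ k.+1 <= 2 ^ (31 * k.+1) * minor_density h ^ 2.
Proof.
move=> symf irrf k0 upf h0 noK nD.
have T0 : 0 < #|T|.
  rewrite lt0n; apply: contraTneq nD => T0; rewrite T0 muln0 -leqNgt leqn0.
  by rewrite /narcs big1 // => x _; have := fintype0 x T0.
have M0 := minor_density_gt0 h0.
have DM : D < minor_density h.
  rewrite ltnNge; apply/negP => MD; apply: noK; apply: Kminor_density => //.
  apply: leq_trans (ltnW nD); apply: leq_mul => //; exact: leq_mul.
(* Naming the constant keeps it from being computed in unary. *)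
have [N NE] : exists N, N = 2 ^ 31 by exists (2 ^ 31).
have [D31|D31] := ltnP D N.
  apply: leq_trans (_ : 2 ^ (31 * k.+1) <= _); last by rewrite leq_pmulr // expn_gt0 M0.
  by rewrite expnM -NE leq_exp2r // ltnW.
have N0 : 0 < N by rewrite NE expn_gt0.
have NN : N <= D -> 2 ^ 31 <= D by rewrite NE.
(* For [k = 1] the radius would be 0; here [D < minor_density h] already is the claim. *)
have [k1|k1] := leqP k 1.
  have -> : k = 1 by move: k0 k1; clear; lia.
  apply: leq_trans (_ : minor_density h ^ 2 <= _); last by rewrite leq_pmull // expn_gt0.
  by rewrite leq_exp2r // ltnW.
have [|U [_ U0 degU]] := @core T f symf D [set: T]; first by rewrite cardsT.
pose d := D %/ 2 ^ 10.
have d0 : 0 < d by rewrite divn_gt0 ?expn_gt0 //; apply: leq_trans D31; rewrite NE leq_exp2l.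
have rho0 : 0 < k./2 by rewrite half_gt0.
have kE := odd_double_half k.
case: (boolP (odd k)) kE => [ok /= kE|ok /= kE].
  have up : unique_paths (4 * k./2 + 2 * true) f.
    by rewrite [X in unique_paths X](_ : _ = 2 * k) // -[in RHS]kE; clear; lia.
  have H : D * d ^ k./2 <= 256 * (3 * minor_density h * 1) + (36 + 256 * (d + 1)) * d ^ k./2.
    apply: (two_phase_density (t := 0) symf irrf up) U0 degU _ _ => // m dm.
      by exists m; rewrite mul1n.
    by exists m; rewrite mul1n muln0 mul0n.
  have := odd_density_numeric rho0 (NN D31) (erefl d) H (erefl _).
  move=> le; rewrite -[X in D ^ X.+1]kE -addnS add1n -doubleS -muln2 expnM.
  apply: leq_trans (_ : (2 ^ (11 * k./2.+1) * minor_density h) ^ 2 <= _); first by rewrite leq_exp2r.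
  rewrite expnMn -expnM leq_mul2r leq_exp2l //; apply/orP; right.
  by rewrite -[X in _ <= 31 * X.+1]kE; clear; lia.
have [r [Dr]] := ceil_sqrt D; move=> /(_ (leq_trans N0 D31)) rD.
have r2 : 1 < r.
  rewrite ltnNge; apply/negP => r1; have : r ^ 2 <= 1 by rewrite -(exp1n 2) leq_exp2r.
  move=> /(leq_trans Dr) /(leq_trans D31) N1.
  suff : 1 < N by rewrite ltnNge N1.
  by rewrite NE -[X in X < _](expn0 2) ltn_exp2l.
have s0 : 0 < 4 * r by move: r2; clear; lia.
have divlow m : d < m -> (m %/ (4 * r)).+1 <= m.
  move=> dm; have m0 : 0 < m by apply: leq_trans dm.
  by apply: ltn_Pdiv => //; move: r2; clear; lia.
have divup m : m <= 4 * r * (m %/ (4 * r)).+1 by apply: ltnW; rewrite mulnC ltn_ceil.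
have up : unique_paths (4 * k./2 + 2 * false) f.
  by rewrite [X in unique_paths X](_ : _ = 2 * k) // -[in RHS]kE; clear; lia.
have H : D * d ^ k./2 <= 256 * (3 * minor_density h * (4 * r)) + (36 + 256 * (d + 4 * r)) * d ^ k./2.
  (* The first round keeps at most about [sqrt D / 4] branches, the second one in [4 * sqrt D], so
     [2 * t * (s - 1)] is about [m / 8]. *)
  apply: (two_phase_density (t := (D %/ (4 * r)).+1) symf irrf up) U0 degU _ _ => // m dm.
    by move=> mD; exists (m %/ (4 * r)).+1; split; [exact: divlow|exact: divup|rewrite ltnS leq_div2r].
  exists (m %/ (4 * r)).+1; split; [exact: divlow|exact: divup|rewrite /=].
  have hb := leq_trunc_div m (4 * r); have ha := leq_trunc_div D (4 * r).
  have m2 : 1 < m by move: d0 dm; clear; lia.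
  move: ha hb; move: (D %/ _) (m %/ _) => a b ha hb.
  have h4 : 4 * a <= r.
    have r0 : 0 < r by move: r2; clear; lia.
    rewrite -(leq_pmul2r r0) -mulnA mulnCA mulnn; apply: leq_trans Dr; move: ha; clear; lia.
  have h5 : 16 * (a * b) <= m.
    apply: leq_trans hb; apply: leq_trans (_ : b * (4 * (4 * a)) <= _); last by rewrite !leq_mul2l h4 !orbT.
    by move: (mulnC a b); clear; lia.
  have h6 : 8 * b <= m.
    apply: leq_trans hb; rewrite mulnC leq_mul2l; apply/orP; right; move: r2; clear; lia.
  by rewrite -mulnA [a.+1 * b]mulSn; move: (a * b) h5 h6 m2; clear; lia.
have := even_density_numeric rho0 (NN D31) (erefl d) rD H (erefl _).
move=> le; rewrite -[X in D ^ X.+1]kE -muln2 mulnC; apply: leq_trans le _.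
rewrite leq_mul2r leq_exp2l //; apply/orP; right.
by rewrite -[X in _ <= 31 * X.+1]kE; move: k1; clear; lia.
Qed.

(* Girth more than [2k] gives both the stretch (any discarded edge closes a short cycle) and the unique short paths behind the density bound. *)
Lemma sparse_spanner (T : finType) (e : rel T) h k D :
  symmetric e -> irreflexive e -> 0 < k -> 0 < h -> ~ Kminor_on h e [set: T] ->
  2 ^ (31 * k.+1) * minor_density h ^ 2 < D ^ k.+1 ->
  exists f : rel T, [/\ symmetric f, subrel f e, narcs f [set: T] <= 2 * D * #|T| &
    forall x y, e x y -> exists p, [/\ path f x p, last x p = y & size p <= (2 * k).-1]].
Proof.
move=> syme irre k0 h0 noK HD.
have [f [symf fe gf sp]] := girth_spanner (2 * k).-1 syme.
have k2 : 0 < 2 * k by rewrite muln_gt0.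
exists f; split=> //; last first.
  move=> x y /sp[p [pp lp sz]]; exists p; split=> //; apply: leq_trans sz _.
  by rewrite geq_max leqnn; move: k0; clear; lia.
have irrf : irreflexive f by move=> x; apply/negP => /fe; rewrite irre.
rewrite leqNgt; apply/negP => lt; move: HD; rewrite ltnNge => /negP; apply.
apply: (girth_minor_density symf irrf k0 _ h0 _ lt).
  by apply: girth_unique_paths => //; rewrite (prednK k2) in gf.
by move=> K; apply: noK; apply: Kminor_subrel fe K.
Qed.

Import Order.TTheory GRing.Theory Num.Theory.
Local Open Scope ring_scope.

(** * Walks in weighted graphs *)

Section WalkWeight.
Variables (R : realFieldType) (V : finType).
Implicit Types (f : rel V) (om : V -> V -> R) (x y z : V) (p q : seq V) (d : R).

Fixpoint ww om x p : R := if p is y :: p' then om x y + ww om y p' else 0.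

Lemma ww_cat om x p q : ww om x (p ++ q) = ww om x p + ww om (last x p) q.
Proof. by elim: p x => [|y p IH] x /=; rewrite ?add0r // IH addrA. Qed.

Lemma ww_rcons om x p y : ww om x (rcons p y) = ww om x p + om (last x p) y.
Proof. by rewrite -cats1 ww_cat /= addr0. Qed.

Lemma ww_rev om x p : (forall a b, om a b = om b a) ->
  ww om (last x p) (rev (belast x p)) = ww om x p.
Proof.
move=> symo; elim: p x => [|y p IH] x //=.
by rewrite rev_cons ww_rcons IH last_rev_belast [om y x]symo addrC.
Qed.

Lemma eq_ww om om' f x p : path f x p ->
  (forall a b, a \in x :: p -> f a b -> om a b = om' a b) -> ww om x p = ww om' x p.
Proof.
elim: p x => [|y p IH] x //= /andP[fxy pp] E; rewrite E ?mem_head // (IH y) //.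
by move=> a b ap; apply: E; rewrite inE ap orbT.
Qed.

Definition weighted f om := [/\ symmetric f, forall x y, om x y = om y x &
  forall x y, f x y -> 0 < om x y].

(** Distance at most [d], as a boolean: length [#|V|] suffices because a walk can be made simple
    without gaining weight. *)
Definition near f om d x y : bool :=
  [exists p : #|V|.-bseq V, [&& path f x p, last x p == y & ww om x p <= d]].

Section Weighted.
Variables (f : rel V) (om : V -> V -> R).
Hypothesis wf : weighted f om.

Lemma ww_ge0 x p : path f x p -> 0 <= ww om x p.
Proof.
have [_ _ om0] := wf; elim: p x => [|y p IH] x //= /andP[/om0 o0 /IH].
by apply: addr_ge0; apply: ltW.
Qed.

Lemma ww_uniq x p : path f x p ->
  exists q, [/\ path f x q, last x q = last x p, uniq (x :: q) & ww om x q <= ww om x p].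
Proof.
have [_ _ om0] := wf.
elim: p x => [|y p IH] x /=; first by exists [::].
case/andP=> fxy /IH[q [pq lq uq wq]].
have [xq|xq] := boolP (x \in y :: q); last first.
  by exists (y :: q); split=> //=; rewrite ?fxy ?xq // lerD2l.
have o0 := ltW (om0 _ _ fxy).
move: xq o0 uq pq lq wq IH fxy; rewrite inE => /orP[/eqP<- o0 uq pq lq wq _ _|xq o0 uq pq lq wq _ _].
  by exists q; split=> //; apply: le_trans wq _; rewrite lerDr.
case/splitPr: xq uq pq lq wq => q1 q2; rewrite -cat_cons cat_uniq => /and3P[_ _ uq].
rewrite cat_path last_cat => /andP[pq1 /= /andP[fq pq]] lq wq.
exists q2; split=> //; move: wq; rewrite ww_cat /=.
have := ww_ge0 pq1; have := ltW (om0 _ _ fq); move: o0.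
move: (ww om y q1) (ww om x q2) (ww om y p) (om _ _) (om _ _) => a b c e g; lra.
Qed.

Lemma uniq_size_card x p : uniq (x :: p) -> (size p <= #|V|)%N.
Proof. by move=> up; apply: ltnW; rewrite -[(size p).+1]/(size (x :: p)) -(card_uniqP up) max_card. Qed.

Lemma nearP d x y :
  reflect (exists p, [/\ path f x p, last x p = y & ww om x p <= d]) (near f om d x y).
Proof.
apply: (iffP existsP) => [[p /and3P[pp /eqP lp wp]]|[p [pp lp wp]]]; first by exists p.
have [q [pq lq uq wq]] := ww_uniq pp.
exists (Bseq (uniq_size_card uq)); rewrite /= pq lq lp eqxx; exact: le_trans wp.
Qed.

Lemma near_refl d x : 0 <= d -> near f om d x x.
Proof. by move=> d0; apply/nearP; exists [::]. Qed.

Lemma near_trans d1 d2 x y z : near f om d1 x y -> near f om d2 y z -> near f om (d1 + d2) x z.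
Proof.
move=> /nearP[p [pp lp wp]] /nearP[q [pq lq wq]]; apply/nearP; exists (p ++ q).
by rewrite cat_path last_cat ww_cat lp pp lerD.
Qed.

Lemma near_sym d x y : near f om d x y = near f om d y x.
Proof.
have [symf symo _] := wf.
have key a b : near f om d a b -> near f om d b a.
  case/nearP=> p [pp <- wp]; apply/nearP; exists (rev (belast a p)).
  by rewrite sym_rev_path // last_rev_belast ww_rev.
by apply/idP/idP; apply: key.
Qed.

Lemma near_le d1 d2 x y : d1 <= d2 -> near f om d1 x y -> near f om d2 x y.
Proof.
move=> le /nearP[p [pp lp wp]]; apply/nearP; exists p; split=> //; exact: le_trans le.
Qed.

Lemma near_edge d x y : f x y -> om x y <= d -> near f om d x y.
Proof. by move=> fxy le; apply/nearP; exists [:: y]; rewrite /= fxy addr0. Qed.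

Lemma shortest x y : connect f x y -> exists p,
  [/\ path f x p, last x p = y, uniq (x :: p) & forall d, near f om d x y = (ww om x p <= d)].
Proof.
case/connectP => p0 pp0 ->; have [p [pp lp up _]] := ww_uniq pp0.
pose P (p : #|V|.-bseq V) := path f x p && (last x p == last x p0).
have P0 : P (Bseq (uniq_size_card up)) by rewrite /P /= pp lp eqxx.
case: (Order.TotalTheory.arg_minP (fun p : #|V|.-bseq V => ww om x p) P0) => q /andP[pq /eqP lq] qmin.
have [s [ps ls us ws]] := ww_uniq pq.
exists s; rewrite ls lq; split=> // d; apply/idP/idP => [|sd]; last first.
  by apply/nearP; exists s; rewrite ls.
case/nearP=> s' [ps' ls' ws']; have [r [pr lr ur wr]] := ww_uniq ps'.
have := qmin (Bseq (uniq_size_card ur)); rewrite /P /= pr lr ls' eqxx => /(_ isT) le.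
by apply: le_trans ws _; apply: le_trans le _; apply: le_trans wr _.
Qed.

End Weighted.
End WalkWeight.

Lemma card_darts (V : finType) (f : rel V) (S : {set V}) :
  #|[set d : V * V | (d.1 \in S) && f d.1 d.2]| = (\sum_(s in S) #|nbr f [set: V] s|)%N.
Proof.
rewrite -sum1_card (eq_bigl (fun d : V * V => (d.1 \in S) && f d.1 d.2)) => [|d]; last by rewrite inE.
rewrite -(pair_big_dep (fun x => x \in S) (fun x y => f x y) (fun _ _ => 1%N)) /=.
by apply: eq_bigr => s _; rewrite sum1_card; apply: eq_card => y; rewrite !inE.
Qed.

(** At a vertex of degree 2 a simple walk has only one way to go on, so walks with the same first
    step agree until the shorter one ends. *)
Lemma degree2_deterministic (V : finType) (f : rel V) (Sp : {set V}) s y p q :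
  symmetric f -> (forall x, x \notin Sp -> #|nbr f [set: V] x| = 2%N) ->
  path f s (y :: p) -> path f s (y :: q) -> uniq (s :: y :: p) -> uniq (s :: y :: q) ->
  {in y :: p, forall x, x \notin Sp} -> (size p <= size q)%N -> exists r, q = p ++ r.
Proof.
move=> symf deg2; elim: p q s y => [|a p IH] [|b q] s y //=; first by exists [::].
  by exists (b :: q).
move=> /and3P[fsy fya pp] /and3P[_ fyb pq] /and4P[snp ynp anp up] /and4P[snq ynq bnq uq] nS sz.
have E : a = b.
  apply/eqP; apply: contraTT isT => ab.
  have sub : b |: [set s; a] \subset nbr f [set: V] y.
    by apply/subsetP => z /setU1P[->|/set2P[->|->]]; rewrite inE in_setT //= symf.
  have := subset_leq_card sub; rewrite (deg2 y (nS _ (mem_head _ _))) cardsU1 cards2 !inE.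
  have -> : s != a by apply: contraNneq snp => ->; rewrite !inE eqxx orbT.
  have -> : b == s = false by apply: contraNF snq => /eqP->; rewrite !inE eqxx orbT.
  by rewrite eq_sym (negbTE ab).
rewrite -{b}E in fyb pq bnq snq ynq uq *.
have [|||||r ->] := IH q y a _ _ _ _ _ sz; last by exists r.
- by rewrite /= fya.
- by rewrite /= fya.
- by rewrite /= anp up ynp.
- by rewrite /= bnq uq ynq.
- by move=> x xp; apply: nS; rewrite inE xp orbT.
Qed.

Section NetCount.
Variables (R : archiRealFieldType) (V : finType) (f : rel V) (om : V -> V -> R).
Hypothesis wf : weighted f om.
Variables (N Sp : {set V}) (K delta : R).
Hypothesis delta0 : 0 < delta.
Hypothesis separated : {in N &, forall n n', near f om delta n n' -> n = n'}.
Hypothesis nearSp : forall n, n \in N -> exists2 s, s \in Sp & near f om K s n.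
Hypothesis deg2 : forall x, x \notin Sp -> #|nbr f [set: V] x| = 2%N.
Hypothesis deg0 : forall n, n \in N -> exists y, f n y.

Let stem s p n := [/\ s \in Sp, path f s p, last s p = n, uniq (s :: p) & ww om s p <= K].

(** Cut the path at its last special vertex. *)
Lemma first_special n : n \in N -> n \notin Sp -> exists s p,
  stem s p n /\ {in p, forall x, x \notin Sp}.
Proof.
move=> nN nSp; have [s sSp /(nearP wf)[p [pp lp wp]]] := nearSp nN.
have [q [pq lq uq wq]] := ww_uniq wf pp; have {wp wq}wq := le_trans wq wp.
rewrite lp in lq; clear p pp lp.
have [m] := ubnP (size q); elim: m q s sSp pq lq uq wq => // m IH q s sSp pq lq uq wq sz.
have [/hasP[z zq zSp]|no] := boolP (has [in Sp] q); last first.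
  by exists s, q; split=> // x xq; apply: contra no => xS; apply/hasP; exists x.
case/splitPr: zq pq lq uq wq sz => q1 q2.
rewrite cat_path last_cat -cat_cons cat_uniq ww_cat /= size_cat /= => /and3P[pq1 fz pq2] lq /and4P[_ _ zq2 uq2].
have := ww_ge0 wf pq1; have [_ _ om0] := wf; have := om0 _ _ fz => o0 w0 wq sz.
apply: (IH q2 z) => //=; first by rewrite zq2.
  by move: wq o0 w0; move: (ww om s q1) (ww om z q2) (om _ z) => u v w; lra.
by move: sz; rewrite addnS !ltnS; apply: leq_trans; rewrite ltnS leq_addl.
Qed.

Let T := Num.truncn (K / delta).

(** A net point is coded by the last special vertex before it, the first step from there, and the
    weight of the path in units of [delta]. Equal codes put two points on one bare path within
    [delta] of each other. The value 0 is reserved for points that are special themselves, hence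
    [T + 2] values. *)
Lemma net_count : (#|N| <= (\sum_(s in Sp) #|nbr f [set: V] s|) * T.+2)%N.
Proof.
pose code n (c : (V * V) * 'I_T.+2) := [/\ c.1.1 \in Sp, f c.1.1 c.1.2 &
  (n = c.1.1 /\ c.2 = ord0) \/ exists p, [/\ stem c.1.1 (c.1.2 :: p) n,
    {in c.1.2 :: p, forall x, x \notin Sp} &
    val c.2 = (Num.truncn (ww om c.1.1 (c.1.2 :: p) / delta)).+1]].
have ex n : n \in N -> exists c, code n c.
  move=> nN; have [nSp|nSp] := boolP (n \in Sp).
    by have [y fny] := deg0 nN; exists ((n, y), ord0); split=> //; left.
  have [s [[|y p] [[sSp pp lp up wp] nS]]] := first_special nN nSp.
    by rewrite -lp /= sSp in nSp.
  have lt : ((Num.truncn (ww om s (y :: p) / delta)).+1 < T.+2)%N.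
    by rewrite !ltnS le_truncn // ler_pM2r // invr_gt0.
  exists ((s, y), Ordinal lt); split=> //; first by case/andP: pp.
  by right; exists p.
have [F FP] : exists F, forall n, n \in N -> code n (F n).
  have /fin_all_exists[F FP] : forall n, exists c, n \in N -> code n c.
    move=> n; have [nN|nN] := boolP (n \in N); first by have [c] := ex n nN; exists c.
    by exists ((n, n), ord0).
  by exists F.
rewrite -card_darts -[X in (_ * X)%N]card_ord -cardsT -cardsX.
rewrite -(card_in_imset (f := F) (D := N)); last first.
  have [symf _ _] := wf.
  have key s y p q n n' : path f s (y :: p) -> last s (y :: p) = n -> uniq (s :: y :: p) ->
      {in y :: p, forall x, x \notin Sp} ->
      path f s (y :: q) -> last s (y :: q) = n' -> uniq (s :: y :: q) ->
      Num.truncn (ww om s (y :: p) / delta) = Num.truncn (ww om s (y :: q) / delta) ->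
      (size p <= size q)%N -> near f om delta n n'.
    move=> pp lp up nS pq lq uq tE sz.
    have [r rE] := degree2_deterministic symf deg2 pp pq up uq nS sz.
    apply/(nearP wf); exists r; move: pq lq tE; rewrite rE -cat_cons cat_path last_cat ww_cat lp.
    case/andP=> _ pr -> tE; split=> //.
    have d0 : delta != 0 by rewrite gt_eqF.
    have ge0 := ww_ge0 wf pp; have ge1 := ww_ge0 wf pr.
    have /andP[l1 _] : (Num.truncn (ww om s (y :: p) / delta))%:R <= ww om s (y :: p) / delta
        < (Num.truncn (ww om s (y :: p) / delta)).+1%:R.
      by apply: Num.Theory.truncn_itv; apply: divr_ge0 ge0 (ltW delta0).
    have /andP[_ l2] : (Num.truncn ((ww om s (y :: p) + ww om n r) / delta))%:R <=
        (ww om s (y :: p) + ww om n r) / delta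
        < (Num.truncn ((ww om s (y :: p) + ww om n r) / delta)).+1%:R.
      by apply: Num.Theory.truncn_itv; apply: divr_ge0 (addr_ge0 ge0 ge1) (ltW delta0).
    move: l2; rewrite -tE -natr1 mulrDl => l2.
    have : ww om n r / delta <= 1 by move: l1 l2; lra.
    by rewrite ler_pdivrMr // mul1r.
  move=> n n' nN n'N E; have [sSp fs c1] := FP n nN; have [_ _] := FP n' n'N; rewrite -E => c2.
  case: (F n) sSp fs c1 c2 => [[s y] c] /= sSp fsy.
  case=> [[-> ->]|[p [[_ pp lp up wp] nS cE]]].
    by case=> [[->]|[p [_ _ /=]]].
  case=> [[_ E0]|[q [[_ pq lq uq wq] nS' cE']]]; first by rewrite E0 in cE.
  have tE := succn_inj (etrans (esym cE) cE').
  case: (leqP (size p) (size q)) => [sz|/ltnW sz].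
    by apply: separated => //; apply: key pp lp up nS pq lq uq tE sz.
  by apply/esym/separated => //; apply: key pq lq uq nS' pp lp up (esym tE) sz.
apply: subset_leq_card; apply/subsetP => _ /imsetP[n nN ->].
have [sSp fs _] := FP n nN; by rewrite inE in_setT andbT inE sSp.
Qed.

End NetCount.

Lemma forest_darts (V : finType) (f : rel V) (VS X : {set V}) (c : nat) :
  (forall x y, f x y -> x \in VS) ->
  (\sum_(x in VS) #|nbr f [set: V] x| + 2 * c <= 2 * #|VS|)%N ->
  (#|[set x in VS | #|nbr f [set: V] x| == 0%N]| <= c)%N ->
  (\sum_(s in [set x | #|nbr f [set: V] x| != 2%N] :|: X) #|nbr f [set: V] s| <=
     4 * #|[set x | #|nbr f [set: V] x| == 1%N]| + 2 * #|X|)%N.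
Proof.
move=> fVS forest iso.
pose dg x := #|nbr f [set: V] x|.
have dgVS x : x \notin VS -> dg x = 0%N.
  move=> xn; apply/eqP; rewrite cards_eq0 -subset0; apply/subsetP => y.
  by rewrite inE => /andP[_ /fVS]; rewrite (negbTE xn).
have h1 : (\sum_(s in [set x | dg x != 2%N] :|: X) dg s <=
    \sum_(x in VS) (dg x != 2%N) * dg x + 2 * #|X|)%N.
  rewrite big_mkcond [X in (_ <= X + _)%N]big_mkcond mulnC -sum_nat_const [X in (_ <= _ + X)%N]big_mkcond -big_split /=.
  apply: leq_sum => x _; rewrite !inE -/(dg x).
  have [xVS|/dgVS->] := boolP (x \in VS); last by case: ifP.
  by case: eqVneq => [->|_] /=; case: (x \in X); rewrite ?mul1n ?leq_addr ?mul0n.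
(* This holds vertex by vertex, with equality at degrees 0 to 3. In the sum, the forest hypothesis
   bounds three times the degrees by [6 * #|VS| - 6 * c], and [6 * c] pays for the isolated
   vertices. *)
have h2 : (\sum_(x in VS) (dg x != 2%N) * dg x + 6 * #|VS| <=
    3 * (\sum_(x in VS) dg x) + 6 * #|[set x in VS | dg x == 0%N]| + 4 * #|[set x in VS | dg x == 1%N]|)%N.
  have cE (P : pred V) : #|[set x in VS | P x]| = (\sum_(x in VS) (P x : nat))%N.
    by rewrite -sum1_card big_mkcond [RHS]big_mkcond; apply: eq_bigr => x _; rewrite inE; case: (x \in VS); case: (P x).
  rewrite !cE mulnC -sum_nat_const !big_distrr /= -!big_split /=; apply: leq_sum => x _.
  by case: (dg x) => [|[|[|n]]] //=; rewrite !mulnSr; move: (mul1n n.+3); clear; lia.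
have h3 : (#|[set x in VS | dg x == 1%N]| <= #|[set x | dg x == 1%N]|)%N.
  by apply: subset_leq_card; apply/subsetP => x; rewrite !inE => /andP[].
apply: leq_trans h1 _; rewrite leq_add2r; apply: leq_trans (_ : 4 * #|[set x in VS | dg x == 1%N]| <= _)%N.
  move: forest iso h2.
  move: (\sum_(x in VS) dg x)%N (\sum_(x in VS) (_ * _))%N #|VS| #|[set x in VS | dg x == 0%N]| #|[set x in VS | dg x == 1%N]|.
  by move=> a b d e g; clear; lia.
by rewrite leq_mul2l h3.
Qed.

(** Ties are broken by [enum_rank]. A net point nearest to a vertex on a shortest walk to the centre
    is also nearest to the start of the walk, so the same centre wins all along it, and cells are
    connected. *)
Lemma voronoi (R : realFieldType) (V : finType) (f : rel V) (om : V -> V -> R)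
    (N : {set V}) (delta : R) : weighted f om ->
  exists c : V -> V, forall x n, n \in N -> near f om delta x n -> c x \in N /\
    exists p, [/\ path f x p, last x p = c x, ww om x p <= delta &
      {in x :: p, forall y, c y = c x /\ near f om delta y (c x)}].
Proof.
move=> wf.
pose closest x n := [&& n \in N & [exists p : #|V|.-bseq V, [&& path f x p, last x p == n &
  [forall q : #|V|.-bseq V, (path f x q && (last x q \in N)) ==> (ww om x p <= ww om x q)]]]].
have closestP x n : reflect (n \in N /\ exists p, [/\ path f x p, last x p = n &
    forall q, path f x q -> last x q \in N -> ww om x p <= ww om x q]) (closest x n).
  apply: (iffP andP) => [[nN /existsP[p /and3P[pp /eqP lp /forallP min]]]|[nN [p [pp lp min]]]]; split=> //.
    exists p; split=> // q pq lq; have [s [ps ls us ws]] := ww_uniq wf pq.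
    have := min (Bseq (uniq_size_card us)); rewrite /= ps ls lq /= => le; exact: le_trans ws.
  have [s [ps ls us ws]] := ww_uniq wf pp.
  apply/existsP; exists (Bseq (uniq_size_card us)); rewrite /= ps ls lp eqxx /=.
  by apply/forallP => q; apply/implyP => /andP[pq lq]; apply: le_trans (min _ pq lq).
pose best x n := closest x n && [forall k, closest x k ==> (enum_rank n <= enum_rank k)%N].
pose c x := odflt x [pick n | best x n].
have cP x m : closest x m -> best x (c x).
  move=> xm; rewrite /c; case: pickP => //= no.
  case: (arg_minnP (fun n => enum_rank n : nat) xm) => k xk min.
  by have /negP[] := negbT (no k); rewrite /best xk; apply/forallP => j; apply/implyP/min.
have bestE x n n' : best x n -> best x n' -> n = n'.
  case/andP=> xn /forallP bn /andP[xn' /forallP bn'].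
  apply/enum_rank_inj/val_inj/eqP; rewrite eqn_leq.
  by rewrite (implyP (bn n')) // (implyP (bn' n)).
exists c => x n nN xn.
have [m cm] : exists m, closest x m.
  case/(nearP wf): xn => p0 [pp0 lp0 _]; have [p [pp lp up _]] := ww_uniq wf pp0.
  pose P (p : #|V|.-bseq V) := path f x p && (last x p \in N).
  have P0 : P (Bseq (uniq_size_card up)) by rewrite /P /= pp lp lp0.
  case: (Order.TotalTheory.arg_minP (fun p : #|V|.-bseq V => ww om x p) P0) => q /andP[pq lq] qmin.
  exists (last x q); apply/closestP; split=> //; exists q; split=> // s ps ls.
  have [r [pr lr ur wr]] := ww_uniq wf ps.
  by apply: le_trans wr; apply: (qmin (Bseq (uniq_size_card ur))); rewrite /P /= pr lr.
have /andP[/closestP[cN [p [pp lp pmin]]] /forallP crank] := cP _ _ cm.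
have wp : ww om x p <= delta.
  by case/(nearP wf): xn => q [pq lq wq]; apply: le_trans wq; apply: pmin; rewrite ?lq.
split=> //; exists p; split=> // y; rewrite inE => /orP[/eqP->|yp].
  by split=> //; apply/(nearP wf); exists p.
have [p1 [p2 [pE lp1]]] : exists p1 p2, p = p1 ++ p2 /\ last x p1 = y.
  by case/splitPl: (mem_behead (s := x :: p) yp) => p1 p2 <-; exists p1, p2.
move: pp lp pmin wp; rewrite pE cat_path last_cat ww_cat lp1 => /andP[pp1 pp2] lp pmin wp.
have yc : closest y (c x).
  apply/closestP; split=> //; exists p2; split=> // q pq lq.
  by have := pmin (p1 ++ q); rewrite cat_path last_cat ww_cat lp1 pp1 lerD2l; apply.
split; last first.
  apply/(nearP wf); exists p2; split=> //; apply: le_trans wp; rewrite lerDr; exact: ww_ge0 wf _ _ pp1.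
apply: (bestE y) (cP _ _ yc) _; rewrite /best yc; apply/forallP => k; apply/implyP.
case/closestP=> kN [q [pq lq qmin]]; apply: (implyP (crank k)); apply/closestP; split=> //.
exists (p1 ++ q); rewrite cat_path last_cat lp1 pp1; split=> // s ps ls.
apply: le_trans (pmin s ps ls); rewrite ww_cat lp1 lerD2l; apply: qmin => //; by rewrite lp.
Qed.

(** * Forests of clusters *)

Section ArcSums.
Variables (R : realFieldType) (V : finType).
Implicit Types (f : rel V) (g : V -> V -> R).

(** The sum runs over darts, so an edge of a symmetric relation counts twice; hence the factors 2 in
    the bounds on potentials. *)
Definition wsum f g : R := \sum_(d : V * V | f d.1 d.2) g d.1 d.2.

Lemma wsum_remove f f' g (s : seq (V * V)) : subrel f' f -> (forall x y, f x y -> 0 <= g x y) ->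
  uniq s -> {in s, forall d, f d.1 d.2 && ~~ f' d.1 d.2} ->
  wsum f' g + \sum_(d <- s) g d.1 d.2 <= wsum f g.
Proof.
move=> sub g0 us sf; rewrite /wsum [leRHS](bigID (fun d => f' d.1 d.2)) /=.
apply: lerD.
  by rewrite (eq_bigl (fun d => f d.1 d.2 && f' d.1 d.2)) // => d; case: (boolP (f' _ _)) => [/sub->|]; rewrite ?andbF.
rewrite big_uniq //= [leRHS](bigID (fun d => d \in s)) /=.
rewrite (eq_bigl (fun d => f d.1 d.2 && ~~ f' d.1 d.2 && (d \in s))) => [|d]; last first.
  by case: (boolP (d \in s)) => [/sf->|]; rewrite ?andbF.
by rewrite lerDl; apply: sumr_ge0 => d /andP[/andP[/g0]].
Qed.

Lemma wsum_ge0 f g : (forall x y, f x y -> 0 <= g x y) -> 0 <= wsum f g.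
Proof. by move=> g0; apply: sumr_ge0 => d; apply: g0. Qed.

Lemma wsum_const1 f : wsum f (fun _ _ => 1) = (\sum_x #|nbr f [set: V] x|)%:R.
Proof.
rewrite /wsum -(pair_big_dep xpredT (fun x y => f x y) (fun _ _ => 1)) /= natr_sum.
apply: eq_bigr => x _; rewrite sumr_const; congr _%:R; apply: eq_card => y.
by rewrite !inE.
Qed.
End ArcSums.

Lemma connect_map (T : finType) (f f' : rel T) (g : T -> T) :
  (forall x y, f x y -> connect f' (g x) (g y)) ->
  forall x y, connect f x y -> connect f' (g x) (g y).
Proof.
move=> step x y /connectP[p pp ->]; elim: p x pp => [|z p IH] x //= /andP[/step fxz /IH].
exact: connect_trans.
Qed.

Section Simulation.
Variables (R : realFieldType) (V : finType) (H : rel V) (w : V -> V -> R).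
Implicit Types (f : rel V) (om : V -> V -> R) (pi : V -> V) (h : V -> R) (r : R).

(** [r] is a radius inherited from earlier scales and [h a] the distance [a] has moved at the
    current one. They are paid only at the two ends of a walk, because the weight of a link already
    contains the cost inside its end clusters. The last clause confines the walk to the clusters
    visited, which later makes branch sets connected. *)
Definition simulates f om pi h r := forall a b q,
  path f (pi a) q -> last (pi a) q = pi b ->
  exists p, [/\ path H a p, last a p = b, ww w a p <= 2 * r + h a + h b + ww om (pi a) q &
    {in a :: p, forall z, pi z \in pi a :: q}].

Lemma simulates_reset f om pi h r s : (forall a, h a <= s) ->
  simulates f om pi h r -> simulates f om pi (fun _ => 0) (r + s).
Proof.
move=> hs sim a b q pq lq; have [p [pp lp wp ip]] := sim a b q pq lq.
exists p; split=> //; have := hs a; have := hs b; move: wp.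
move: (ww w a p) (ww om (pi a) q) => u v; lra.
Qed.

Lemma simulates_retract f f' om pi h r (ret : V -> V) (rho : V -> R) :
  weighted f om -> subrel f' f ->
  (forall x y, f' x y -> ret x = x /\ ret y = y) ->
  (forall a, exists q, [/\ path f (pi a) q, last (pi a) q = ret (pi a), ww om (pi a) q <= rho (pi a) &
     {in pi a :: q, forall z, ret z = ret (pi a)}]) ->
  simulates f om pi h r ->
  simulates f' om (ret \o pi) (fun a => h a + rho (pi a)) r.
Proof.
move=> [symf symo om0] sub fret retP sim a b q /= pq lq.
have [qa [pa la wa ia]] := retP a; have [qb [pb lb wb ib]] := retP b.
have [||p [pp lp wp ip]] := sim a b (qa ++ q ++ rev (belast (pi b) qb)).
- rewrite !cat_path pa la (sub_path sub) //= lq -lb.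
  by rewrite sym_rev_path.
- by rewrite !last_cat la lq /= -lb last_rev_belast.
exists p; split=> //.
  move: wp; rewrite !ww_cat la lq /= -lb ww_rev //; move: wa wb.
  move: (ww om (pi a) qa) (ww om (pi b) qb) (ww om (ret (pi a)) q) (ww w a p) => u v x y; lra.
have qfix z : z \in q -> ret z = z.
  elim: (q) {lq} (ret (pi a)) pq => [|y q' IH] x //= /andP[/fret[_ ry] pq'].
  by rewrite inE => /orP[/eqP->|]; [|apply: IH pq'].
move=> z /ip; rewrite -cat_cons !mem_cat mem_rev => /or3P[/ia /= ->|zq|zb] /=.
- by rewrite mem_head.
- by rewrite (qfix _ zq) inE zq orbT.
- by rewrite (ib _ (mem_belast zb)) -lq mem_last.
Qed.

Definition add_link f (x y : V) : rel V :=
  fun a b => f a b || (a == x) && (b == y) || (a == y) && (b == x).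

Definition link_weight om (x y : V) (l : R) : V -> V -> R :=
  fun a b => if (a == x) && (b == y) || (a == y) && (b == x) then l else om a b.

(** Cut the walk at its uses of the new link. Stopping at [u] and starting again at [v] costs an
    extra [2 * r + h u + h v], which [l] includes. *)
Lemma simulates_link f om pi h r u v l : weighted f om -> symmetric H ->
  (forall a b, w a b = w b a) ->
  H u v -> ~~ f (pi u) (pi v) -> w u v + 2 * r + h u + h v <= l ->
  simulates f om pi h r ->
  simulates (add_link f (pi u) (pi v)) (link_weight om (pi u) (pi v) l) pi h r.
Proof.
move=> [symf symo om0] symH symw Huv nf wl sim a b q.
set f' := add_link _ _ _; set om' := link_weight _ _ _ _.
have om'E x y : f x y -> om' x y = om x y.
  rewrite /om' /link_weight; case: ifP => // /orP[]/andP[/eqP-> /eqP->].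
    by rewrite (negbTE nf).
  by rewrite symf (negbTE nf).
have om'uv : om' (pi u) (pi v) = l by rewrite /om' /link_weight !eqxx.
have om'vu : om' (pi v) (pi u) = l by rewrite /om' /link_weight !eqxx orbT.
have [m] := ubnP (size q); elim: m a q => // m IH a q sz pq lq.
have [pf|npf] := boolP (path f (pi a) q).
  have [p [pp lp wp ip]] := sim a b q pf lq; exists p; split=> //.
  by rewrite (eq_ww pf (om' := om)) // => x y _; apply: om'E.
have [q1 [y [q2 [qE pq1 ny]]]] : exists q1 y q2,
    [/\ q = q1 ++ y :: q2, path f (pi a) q1 & ~~ f (last (pi a) q1) y].
  elim: q (pi a) npf {sz pq lq} => [|z q IHq] x //=.
  have [fxz /IHq[q1 [y [q2 [-> pq1 ny]]]]|nf' _] := boolP (f x z); last by exists [::], z, q.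
  by exists (z :: q1), y, q2; rewrite /= fxz.
move: pq lq sz; rewrite qE cat_path last_cat size_cat /= => /andP[_ /andP[fy pq2]] lq sz.
have sz2 : (size q2 < m)%N by move: sz; rewrite addnS !ltnS; apply: leq_trans; rewrite ltnS leq_addl.
have step u0 v0 : H u0 v0 -> w u0 v0 + 2 * r + h u0 + h v0 <= l -> om' (pi u0) (pi v0) = l ->
    last (pi a) q1 = pi u0 -> y = pi v0 ->
    exists p, [/\ path H a p, last a p = b, ww w a p <= 2 * r + h a + h b + ww om' (pi a) (q1 ++ y :: q2) &
    {in a :: p, forall z, pi z \in pi a :: (q1 ++ y :: q2)}].
  move=> Hu0 le oE lu yE; rewrite yE in pq2 lq *.
  have [p1 [pp1 lp1 wp1 ip1]] := sim a u0 q1 pq1 lu.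
  have [p2 [pp2 lp2 wp2 ip2]] := IH v0 q2 sz2 pq2 lq.
  exists (p1 ++ v0 :: p2); rewrite cat_path last_cat /= lp1 pp1 Hu0; split=> //.
    rewrite !ww_cat /= lp1 lu oE (eq_ww pq1 (om := om') (om' := om)); last by move=> x z _; apply: om'E.
    move: wp1 wp2 le; move: (ww w a p1) (ww om _ _) (ww w v0 p2) (ww om' _ _) (w u0 v0) => *; lra.
  move=> z; rewrite -cat_cons mem_cat => /orP[/ip1|/ip2]; rewrite -cat_cons mem_cat => -> //.
  by rewrite orbT.
move: fy; rewrite /f' /add_link (negbTE ny) /= => /orP[]/andP[/eqP lu /eqP yE].
  exact: (step u v Huv wl om'uv lu yE).
apply: (step v u _ _ om'vu lu yE); first by rewrite symH.
by rewrite symw; move: wl; lra.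
Qed.

End Simulation.

Section Clusterings.
Variables (R : realFieldType) (V : finType) (e H : rel V) (w : V -> V -> R).
Implicit Types (f : rel V) (om : V -> V -> R) (pi : V -> V) (h : V -> R) (r : R).

(* [f], weighted by [om], lives on the fixed points of [pi]; each walk in [f]
   is realised in [H] at an extra cost given by [r] and [h]. *)
Record clustering f om pi h r : Prop := Clustering {
  cl_weighted : weighted f om;
  cl_irr : irreflexive f;
  cl_sim : simulates H w f om pi h r;
  cl_idem : forall a, pi (pi a) = pi a;
  cl_fix : forall x y, f x y -> pi x = x;
  cl_conn : forall x y, e x y -> connect f (pi x) (pi y) }.

Definition centers pi : {set V} := [set x | pi x == x].

(** Acyclicity by counting: edges plus [c] are at most the vertices. As there are at most [c]
    components, which [cl_conn] keeps connected, this describes a forest, and it is easier to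
    maintain than the absence of cycles. *)
Definition forest f pi (c : nat) : Prop :=
  wsum f (fun _ _ => 1 : R) + 2 * c%:R <= 2 * #|centers pi|%:R.

Lemma clusteringS H' f om pi h r : subrel H H' -> clustering f om pi h r ->
  simulates H' w f om pi h r.
Proof.
move=> sub cl a b q pq lq; have [p [pp lp wp ip]] := cl_sim cl pq lq.
by exists p; split=> //; apply: sub_path pp.
Qed.

Lemma prune_leaf f om pi h r c x y : clustering f om pi h r -> forest f pi c ->
  nbr f [set: V] x = [set y] ->
  exists f' pi', [/\ subrel f' f, clustering f' om pi' (fun a => h a + (if pi a == x then om x y else 0)) r,
    forest f' pi' c, wsum f' om + 2 * om x y <= wsum f om &
    (forall a, pi' a = if pi a == x then y else pi a) /\ centers pi' = centers pi :\ x].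
Proof.
move=> [wf irr sim idem fixf con] fo Nx; have [symf symo om0] := wf.
have fxE z : f x z = (z == y) by rewrite -in_set1 -Nx inE in_setT.
have fxy : f x y by rewrite fxE.
have yx : y != x by apply: contraTneq fxy => ->; rewrite irr.
have piy : pi y = y by apply: (fixf y x); rewrite symf.
have pix : pi x = x by apply: fixf fxy.
pose f' a b := [&& f a b, a != x & b != x].
pose ret z := if z == x then y else z.
have sub : subrel f' f by move=> a b /and3P[].
have ss : {in [:: (x, y); (y, x)], forall d, f d.1 d.2 && ~~ f' d.1 d.2}.
  by move=> d; rewrite !inE => /orP[]/eqP-> /=; rewrite /f' eqxx ?andbF ?andbT // symf.
have us : uniq [:: (x, y); (y, x)] by rewrite /= inE xpair_eqE eq_sym (negbTE yx).
have cE : centers (ret \o pi) = centers pi :\ x.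
  apply/setP => z; rewrite !inE /= /ret; have [->|zx] /= := eqVneq z x.
    by rewrite pix eqxx (negbTE yx).
  have [piz|//] := eqVneq (pi z) x.
  rewrite piz [x == z]eq_sym (negbTE zx); apply: contraNF zx => /eqP yz.
  by rewrite -piz -yz piy.
have xc : x \in centers pi by rewrite inE pix.
have retP a : exists q, [/\ path f (pi a) q, last (pi a) q = ret (pi a),
    ww om (pi a) q <= (if pi a == x then om x y else 0) & {in pi a :: q, forall z, ret z = ret (pi a)}].
  rewrite /ret; have [->|ax] := eqVneq (pi a) x; last first.
    by exists [::]; split=> //= z; rewrite inE => /eqP->; rewrite (negbTE ax).
  exists [:: y]; rewrite /= fxy addr0; split=> // z; rewrite !inE => /orP[]/eqP->; rewrite ?eqxx //.
  by rewrite (negbTE yx).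
exists f', (ret \o pi); split=> //.
- split=> //.
  + by split=> // [a b|a b /sub/om0 //]; rewrite /f' symf [(a != x) && _]andbC.
  + by move=> a; rewrite /f' irr.
  + apply: (simulates_retract (rho := fun z => if z == x then om x y else 0) wf sub _ retP sim).
    move=> a b /and3P[_ ax bx].
    by rewrite /ret (negbTE ax) (negbTE bx).
  + move=> a; rewrite /= /ret; case: (eqVneq (pi a) x) => ax; last by rewrite idem (negbTE ax).
    by rewrite piy (negbTE yx).
  + move=> a b /and3P[fab ax _] /=; rewrite /ret (fixf a b fab) (negbTE ax) //.
  + move=> a b /con; apply: connect_map => u v fuv; rewrite /ret.
    have [uE|ux] := eqVneq u x.
      by move: fuv; rewrite uE fxE => /eqP->; rewrite (negbTE yx) connect0.
    have [vE|vx] := eqVneq v x; last by apply: connect1; rewrite /f' fuv ux vx.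
    by move: fuv; rewrite symf vE fxE => /eqP->; rewrite connect0.
- move: fo; rewrite /forest cE [in X in X -> _](cardsD1 x) xc natrD mulrDr /= => fo.
  have := wsum_remove (g := fun _ _ => 1 : R) sub (fun _ _ _ => ler01) us ss.
  by rewrite !big_cons big_nil /=; move: fo; lra.
- have := wsum_remove (g := om) sub (fun a b fab => ltW (om0 a b fab)) us ss.
  by rewrite !big_cons big_nil /= [om y x]symo; lra.
Qed.

(** The potential is [wsum] plus twice the cluster heights [ht]. Contracting a leaf [x] into [y]
    frees its edge and its height, which pays for the new height of [y]. At the end every leaf on a
    short edge has height at least [p], so the weight removed pays for the remaining leaves. *)
Lemma prune f om pi h r c ht p lam : 0 <= p -> 0 <= lam -> clustering f om pi h r ->
  forest f pi c -> (forall a, h a <= ht (pi a)) -> (forall x, 0 <= ht x <= p + lam) ->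
  exists f' pi' h' ht', [/\ subrel f' f, clustering f' om pi' h' r, forest f' pi' c,
    (forall a, h' a <= p + lam) /\ (forall x, 0 <= ht' x) &
    wsum f' om + 2 * \sum_(x in centers pi') ht' x <=
      wsum f om + 2 * \sum_(x in centers pi) ht x /\
    forall x y, nbr f' [set: V] x = [set y] -> om x y <= lam -> p <= ht' x].
Proof.
move=> p0 lam0.
have [m] := ubnP #|centers pi|; elim: m f pi h ht => // m IH f pi h ht sz cl fo hht htb.
pose bad d := (nbr f [set: V] d.1 == [set d.2]) && (om d.1 d.2 <= lam) && (ht d.1 < p).
case: (pickP bad) => [[x y] /andP[/andP[/eqP Nx oxy] hx]|none]; last first.
  exists f, pi, h, ht; split=> //.
    split=> [a|x]; first by have /andP[_] := htb (pi a); apply: le_trans.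
    by have /andP[] := htb x.
  split=> // x y Nx oxy; rewrite leNgt; apply/negP => hx.
  by have := none (x, y); rewrite /bad /= Nx eqxx oxy hx.
have [f' [pi' [sub cl' fo' wle [piE cE]]]] := prune_leaf cl fo Nx.
have fxy : f x y by have := set11 y; rewrite -Nx inE => /andP[].
have [_ _ om0] := cl_weighted cl.
have o0 : 0 <= om x y by apply/ltW/om0.
have xc : x \in centers pi by rewrite inE (cl_fix cl fxy).
have /andP[hx0 _] := htb x.
have yx : y != x by apply: contraTneq fxy => ->; rewrite (cl_irr cl).
have yc : y \in centers pi by rewrite inE; have [symf _ _] := cl_weighted cl; rewrite (cl_fix cl (y := x)) // symf.
pose ht1 z := if z == y then Num.max (ht y) (ht x + om x y) else ht z.
have [|||f2 [pi2 [h2 [ht2 [sub2 cl2 fo2 hb [le2 leaf2]]]]]] :=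
    IH f' pi' (fun a => h a + (if pi a == x then om x y else 0)) ht1 _ cl' fo'.
- by move: sz; rewrite cE (cardsD1 x (centers pi)) xc.
- move=> a; rewrite piE /ht1; have [pax|pax] := eqVneq (pi a) x.
    by rewrite eqxx le_max; apply/orP; right; rewrite lerD2r -pax.
  rewrite addr0; case: eqP => [<-|_]; last exact: hht.
  by rewrite le_max hht.
- move=> z; rewrite /ht1; case: eqP => _; last exact: htb.
  rewrite le_max ge_max; have /andP[-> ->] := htb y => /=.
  by move: hx oxy; lra.
exists f2, pi2, h2, ht2; split=> //; first by move=> a b /sub2/sub.
split=> //; apply: le_trans le2 _; move: wle; rewrite cE.
rewrite [X in _ -> _ <= _ + 2 * X](big_setD1 x xc) /=.
have yc' : y \in centers pi :\ x by rewrite !inE yx; move: yc; rewrite inE.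
rewrite (big_setD1 y yc') [X in _ <= _ + 2 * (_ + X)](big_setD1 y yc') /=.
rewrite (eq_bigr (F1 := ht1) ht) => [|z]; last first.
  by rewrite !inE /ht1 => /and3P[/negbTE->].
have : ht1 y <= ht y + (ht x + om x y).
  rewrite /ht1 eqxx ge_max; have /andP[hy0 _] := htb y.
  by rewrite lerDl lerDr hy0 addr_ge0.
move: (wsum f' om) (wsum f om) (\sum_(_ in _) _) => a b s; lra.
Qed.

End Clusterings.

(** * Swapping tree paths for spanner edges *)

Section PathArcs.
Variables (R : realFieldType) (V : finType).
Implicit Types (f : rel V) (g : V -> V -> R).

Fixpoint arcs (x : V) q := if q is y :: q' then [:: (x, y), (y, x) & arcs y q'] else [::].

Lemma mem_arcs x q d : d \in arcs x q -> d.1 \in x :: q /\ d.2 \in x :: q.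
Proof.
elim: q x => [|y q IH] x //=; rewrite !inE => /or3P[/eqP->|/eqP->|/IH[]] /=.
- by rewrite !eqxx orbT.
- by rewrite !eqxx orbT.
- by rewrite !inE => -> ->; rewrite !orbT.
Qed.

Lemma arcs_uniq x q : uniq (x :: q) -> uniq (arcs x q).
Proof.
elim: q x => [|y q IH] x //=; rewrite inE => /andP[xyq uq]; rewrite (IH y uq).
have xn : x \notin y :: q by rewrite inE.
have xy : x == y = false by apply: contraNF xn => /eqP->; rewrite mem_head.
rewrite !inE xpair_eqE xy /= andbT; apply/andP; split.
  by apply/negP => /mem_arcs[] /=; rewrite (negbTE xn).
by apply/negP => /mem_arcs[_] /=; rewrite (negbTE xn).
Qed.

Lemma sum_arcs g x q : (forall a b, g a b = g b a) ->
  \sum_(d <- arcs x q) g d.1 d.2 = 2 * ww g x q.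
Proof.
move=> symg; elim: q x => [|y q IH] x /=; first by rewrite big_nil mulr0.
by rewrite !big_cons IH /= [g y x]symg; lra.
Qed.

Lemma ww_const1 x q : ww (fun (_ _ : V) => 1 : R) x q = (size q)%:R.
Proof. by elim: q x => [|y q IH] x //=; rewrite IH -natr1 addrC. Qed.

Lemma arcs_sub f x q d : symmetric f -> path f x q -> d \in arcs x q -> f d.1 d.2.
Proof.
move=> symf; elim: q x => [|y q IH] x //= /andP[fxy pq]; rewrite !inE => /or3P[/eqP->|/eqP->|] //=.
  by rewrite symf.
exact: IH.
Qed.

Lemma arcs_touch x q z d : d \in arcs x (rcons q z) -> (d.1 \in x :: q) || (d.2 \in x :: q).
Proof.
elim: q x => [|y q IH] x /=; first by rewrite !inE => /orP[]/eqP-> /=; rewrite eqxx ?orbT.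
rewrite !inE => /or3P[/eqP->|/eqP->|/IH] /=; rewrite ?eqxx ?orbT //.
by rewrite !inE => /orP[] ->; rewrite !orbT.
Qed.

Lemma add_link_sym f x y : symmetric f -> symmetric (add_link f x y).
Proof.
move=> symf a b; rewrite /add_link symf -!orbA; congr (_ || _).
by rewrite orbC [X in X || _]andbC [X in _ || X]andbC.
Qed.

Lemma link_weight_sym g x y (l : R) : (forall a b, g a b = g b a) ->
  forall a b, link_weight g x y l a b = link_weight g x y l b a.
Proof.
move=> symg a b; rewrite /link_weight symg.
by rewrite orbC [X in X || _]andbC [X in _ || X]andbC.
Qed.

Lemma wsum_link f g x y l : 0 <= l -> (forall a b, f a b -> 0 <= g a b) ->
  wsum (add_link f x y) (link_weight g x y l) <= wsum f g + 2 * l.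
Proof.
move=> l0 g0; rewrite /wsum (bigID (fun d : V * V => (d.1 == x) && (d.2 == y) || (d.1 == y) && (d.2 == x))) /=.
rewrite addrC; apply: lerD.
  rewrite [leRHS](bigID (fun d : V * V => (d.1 == x) && (d.2 == y) || (d.1 == y) && (d.2 == x))) /=.
  apply: le_trans (_ : \sum_(d : V * V | f d.1 d.2 && ~~ ((d.1 == x) && (d.2 == y) || (d.1 == y) && (d.2 == x))) g d.1 d.2 <= _).
    rewrite le_eqVlt; apply/orP; left; apply/eqP; apply: eq_big => [d|d /andP[_ nd]].
      by rewrite /add_link; case: (f _ _) => //=; case: (_ || _).
    by rewrite /link_weight (negbTE nd).
  by rewrite lerDr; apply: sumr_ge0 => d /andP[/g0].
rewrite (eq_bigr (fun=> l)) => [|d /andP[_]]; last by rewrite /link_weight => ->.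
rewrite sumr_const; apply: le_trans (_ : l *+ 2 <= _); last by rewrite mulr2n; lra.
apply: ler_wpMn2l => //.
apply: leq_trans (_ : #|[set (x, y); (y, x)]| <= _)%N; last by rewrite cards2; case: (_ != _).
apply: subset_leq_card; apply/subsetP => -[a b]; rewrite unfold_in /= => /andP[_].
by rewrite !inE !xpair_eqE.
Qed.

End PathArcs.

Section Shortcut.
Variables (R : realFieldType) (V : finType) (e H : rel V) (w : V -> V -> R).
Hypotheses (symH : symmetric H) (symw : forall x y, w x y = w y x).
Variables (f : rel V) (om : V -> V -> R) (pi : V -> V) (h : V -> R) (r : R) (c : nat).
Hypotheses (cl : clustering e H w f om pi h r) (fo : forest R f pi c).
Variables (n z : V) (p1 p2 : seq V) (u v : V) (l D : R).
Let sigma := rcons p1 z.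
Hypotheses (psigma : path f n sigma) (usigma : uniq (n :: sigma)) (p1n0 : p1 != [::]).
Hypothesis deg2 : {in p1, forall x, #|nbr f [set: V] x| = 2%N}.
Hypotheses (piu : pi u = n) (tp1 : pi v \notin p1) (nt : n != pi v) (Huv : H u v).
Hypotheses (nf : ~~ f n (pi v)) (lE : w u v + 2 * r + h u + h v <= l) (l0 : 0 < l).
Hypotheses (pp2 : path f z p2) (lp2 : last z p2 = pi v) (p2p1 : {in p2, forall x, x \notin p1}).
Hypothesis DE : ww om n sigma <= 2 * D.

Definition prefix_cost x := ww om n (take (index x p1).+1 p1).
(** Interior vertices of the removed path go to [n] up to cost [D] and to [z] beyond it; as the path
    weighs at most [2 * D], none moves further than [D]. *)
Definition half_retract x := if x \in p1 then (if prefix_cost x <= D then n else z) else x.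

Let sub1 : rel V := fun a b => [&& f a b, a \notin p1 & b \notin p1].
Let f' := add_link sub1 n (pi v).
Let om' := link_weight om n (pi v) l.

Let symf : symmetric f. Proof. by case: (cl_weighted cl). Qed.
Let symo x y : om x y = om y x. Proof. by case: (cl_weighted cl). Qed.
Let om0 x y : f x y -> 0 < om x y. Proof. by case: (cl_weighted cl) => _ _; apply. Qed.
Let np1 : n \notin p1.
Proof. by move: usigma; rewrite /= mem_rcons inE negb_or => /andP[/andP[_]]. Qed.
Let zp1 : z \notin p1.
Proof. by move: usigma; rewrite /= rcons_uniq => /and3P[]. Qed.
Let nz : n != z.
Proof. by move: usigma; rewrite /= mem_rcons inE negb_or => /andP[/andP[]]. Qed.

Let prefixE q1 x q2 : p1 = q1 ++ x :: q2 -> prefix_cost x = ww om n (rcons q1 x).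
Proof.
move=> E; have uq : uniq p1 by move: usigma; rewrite /= rcons_uniq => /and3P[].
have xq1 : x \notin q1.
  by move: uq; rewrite E cat_uniq => /and3P[_ /norP[]].
rewrite /prefix_cost; congr (ww om n _).
rewrite E index_cat (negbTE xq1) /= eqxx addn0.
by rewrite -cat_rcons take_size_cat // size_rcons.
Qed.

Let half_retract_walk x : exists q, [/\ path f x q, last x q = half_retract x,
  ww om x q <= (if x \in p1 then D else 0) & {in x :: q, forall y, half_retract y = half_retract x}].
Proof.
have [xp1|xp1] := boolP (x \in p1); last first.
  exists [::]; split=> //=; first by rewrite /half_retract (negbTE xp1).
  by move=> y; rewrite inE => /eqP->.
have [q1 [q2 E]] : exists q1 q2, p1 = q1 ++ x :: q2.
  by case/splitPr: xp1 => q1 q2; exists q1, q2.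
have cx := prefixE E.
have pq1 : path f n (rcons q1 x).
  by move: psigma; rewrite /sigma E rcons_cat -cat_rcons cat_path => /andP[].
have pq2 : path f x (rcons q2 z).
  by move: psigma; rewrite /sigma E rcons_cat cat_path /= => /and3P[].
rewrite /half_retract xp1; case: ifP => cD.
  have lq : last n (rcons q1 x) = x by rewrite last_rcons.
  exists (rev (belast n (rcons q1 x))); split=> [||| y].
  - by rewrite -{1}lq sym_rev_path.
  - by rewrite -{1}lq last_rev_belast.
  - by rewrite -{1}lq ww_rev // -cx.
  rewrite inE mem_rev belast_rcons inE => /or3P[/eqP->|/eqP->|yq1].
  - by rewrite xp1 cD.
  - by rewrite (negbTE np1).
  have [q3 [q4 E4]] : exists q3 q4, q1 = q3 ++ y :: q4.
    by case/splitPr: yq1 => q3 q4; exists q3, q4.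
  have yp1 : y \in p1 by rewrite E mem_cat yq1.
  have E' : p1 = q3 ++ y :: (q4 ++ x :: q2) by rewrite E E4 -catA.
  rewrite yp1 (prefixE E'); case: ifP => // /negP[].
  apply: le_trans cD; rewrite cx E4 rcons_cat -cat_rcons ww_cat lerDl last_rcons.
  apply: (ww_ge0 (cl_weighted cl)).
  by move: pq1; rewrite E4 rcons_cat -cat_rcons cat_path last_rcons => /andP[].
have tot : ww om n sigma = ww om n (rcons q1 x) + ww om x (rcons q2 z).
  by rewrite /sigma E rcons_cat -cat_rcons ww_cat last_rcons.
exists (rcons q2 z); rewrite last_rcons; split=> //.
  move/negbT: cD; rewrite -ltNge cx; move: DE; rewrite tot.
  move: (ww om n _) (ww om x _) => a b; lra.
move=> y; rewrite inE mem_rcons inE => /or3P[/eqP->|/eqP->|yq2].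
- by rewrite xp1 cD.
- by rewrite (negbTE zp1).
have [q3 [q4 E4]] : exists q3 q4, q2 = q3 ++ y :: q4.
  by case/splitPr: yq2 => q3 q4; exists q3, q4.
have yp1 : y \in p1 by rewrite E mem_cat inE yq2 !orbT.
have E' : p1 = (rcons q1 x ++ q3) ++ y :: q4 by rewrite E E4 cat_rcons -catA.
rewrite yp1 (prefixE E'); case: ifP => // yD.
move/negP: cD; case; apply: le_trans yD; rewrite cx rcons_cat ww_cat lerDl last_rcons.
apply: (ww_ge0 (cl_weighted cl)).
by move: pq2; rewrite E4 rcons_cat -cat_rcons cat_path => /andP[].
Qed.

Lemma interior_nbr x y : x \in p1 -> f x y -> y \in n :: sigma.
Proof.
move=> xp1 fxy; have [q1 [q2 E]] : exists q1 q2, p1 = q1 ++ x :: q2.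
  by case/splitPr: xp1 => q1 q2; exists q1, q2.
have := psigma; have := usigma; rewrite /sigma E rcons_cat rcons_cons -cat_cons cat_uniq cat_path.
move=> /and3P[uq1 no uq2] /and3P[_ f1 pq2].
set a := last n q1 in f1; pose b := head z q2.
have f2 : f x b by move: pq2; rewrite /b; case: (q2) => [|b' q'] /= /andP[].
have bq : b \in rcons q2 z by rewrite mem_rcons /b; case: (q2) => [|b' q'] /=; rewrite !inE eqxx ?orbT.
have aq : a \in n :: q1 by apply: mem_last.
have ab : a != b.
  apply/eqP => E2; move/negP: no; case; apply/hasP; exists b; first by rewrite inE bq orbT.
  by rewrite -E2.
have : y \in [set a; b].
  have -> : [set a; b] = nbr f [set: V] x; last by rewrite inE in_setT.
  apply/eqP; rewrite eqEcard (deg2 xp1) cards2 ab andbT.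
  by apply/subsetP => s /set2P[]->; rewrite inE in_setT //= symf.
case/set2P=> ->.
- by rewrite mem_cat aq.
- by rewrite mem_cat [b \in x :: _]inE bq !orbT.
Qed.

Let fixp x : x \in n :: sigma -> pi x = x.
Proof.
have fixpath a q : path f a q -> q != [::] -> {in a :: q, forall y, pi y = y}.
  elim: q a => // b q IH a /= /andP[fab pq] _ y; rewrite inE => /orP[/eqP->|].
    exact: (cl_fix cl fab).
  case: q IH pq => [|d q] IH pq; last exact: IH.
  by rewrite inE => /eqP->; apply: (cl_fix cl (y := a)); rewrite symf.
by apply: fixpath psigma _ _; rewrite /sigma; case: (p1).
Qed.

Let half_retract_center x : pi x = x -> pi (half_retract x) = half_retract x /\ half_retract x \notin p1.
Proof.
rewrite /half_retract; have [_ _|//] := boolP (x \in p1).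
by case: ifP => _; split=> //; apply: fixp; rewrite !inE ?eqxx // mem_rcons mem_head orbT.
Qed.

Let centersE : centers (half_retract \o pi) = centers pi :\: [set x in p1].
Proof.
apply/setP => x; rewrite !inE /= /half_retract.
have [pp|npp] := boolP (pi x \in p1).
  have -> : (x \notin p1) && (pi x == x) = false.
    by apply/negP => /andP[xp /eqP E]; rewrite -E pp in xp.
  case: ifP => _; apply/negP => /eqP E.
    by move: pp; rewrite -E fixp ?mem_head // (negbTE np1).
  by move: pp; rewrite -E fixp ?(negbTE zp1) // inE mem_rcons mem_head orbT.
have [E|//] := eqVneq (pi x) x; last by rewrite andbF.
by rewrite -E npp.
Qed.

(** The path [sigma] gives way to a link from [n] to [pi v]. Connectivity survives because [p2]
    still joins [z] to [pi v], and the forest count because [size p1 + 1] edges and [size p1]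
    centres vanish while one edge appears. *)
Lemma shortcut : [/\ clustering e H w f' om' (half_retract \o pi)
    (fun a => h a + (if pi a \in p1 then D else 0)) r,
  forest R f' (half_retract \o pi) c &
  wsum f' om' + 2 * ww om n sigma <= wsum f om + 2 * l].
Proof.
have wf := cl_weighted cl.
have subf : subrel sub1 f by move=> a b /and3P[].
have sub1E a b : sub1 a b = [&& f a b, a \notin p1 & b \notin p1] by [].
have wf1 : weighted sub1 om.
  by split=> // [a b|a b /subf/om0//]; rewrite !sub1E symf [(a \notin _) && _]andbC.
have retu : half_retract n = n by rewrite /half_retract (negbTE np1).
have rett : half_retract (pi v) = pi v by rewrite /half_retract (negbTE tp1).
have hr2 x : x \in p1 -> half_retract x = n \/ half_retract x = z.
  by rewrite /half_retract => ->; case: ifP; [left|right].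
have symf' : symmetric f' by apply: add_link_sym; case: wf1.
have nf1 : ~~ sub1 n (pi v) by rewrite sub1E (negbTE nf).
have arcsP : {in arcs n sigma, forall d, f d.1 d.2 && ~~ sub1 d.1 d.2}.
  move=> d dA; rewrite (arcs_sub symf psigma dA) sub1E (arcs_sub symf psigma dA) /=.
  move: dA; rewrite /sigma; case: (p1) p1n0 => // y q _ /=; rewrite !inE => /or3P[/eqP->|/eqP->|/arcs_touch] /=.
  - by rewrite eqxx andbF.
  - by rewrite eqxx.
  - by rewrite !inE => /orP[] ->; rewrite ?andbF.
have uA := arcs_uniq usigma.
split.
- split.
  + split=> //; first exact: link_weight_sym.
    move=> a b; rewrite /f' /add_link /om' /link_weight; case: ifP => //.
    by rewrite -orbA => ->; rewrite orbF => /subf/om0.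
  + move=> a; rewrite /f' /add_link sub1E (cl_irr cl) /=.
    by apply/negP => /orP[]/andP[/eqP-> /eqP E]; [move: nt; rewrite E eqxx|move: nt; rewrite -E eqxx].
  + have sim1 : simulates H w sub1 om (half_retract \o pi) (fun a => h a + (if pi a \in p1 then D else 0)) r.
      apply: (simulates_retract (rho := fun x => if x \in p1 then D else 0) wf subf _ _ (cl_sim cl)).
        by move=> a b /and3P[_ ap bp]; rewrite /half_retract (negbTE ap) (negbTE bp).
      by move=> a; apply: half_retract_walk.
    have := simulates_link (l := l) (u := u) (v := v) wf1 symH symw Huv _ _ sim1.
    rewrite /= piu retu rett; apply => //.
    by rewrite (negbTE np1) (negbTE tp1) !addr0.
  + move=> a /=; have [E nb] := half_retract_center (cl_idem cl a).
    by rewrite E {1}/half_retract (negbTE nb).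
  + move=> a b; rewrite /f' /add_link sub1E -orbA => /or3P[/and3P[fab ap _]|/andP[/eqP-> _]|/andP[/eqP-> _]] /=.
    * by rewrite /half_retract (cl_fix cl fab) (negbTE ap).
    * by rewrite fixp ?mem_head.
    * by rewrite (cl_idem cl) rett.
  + have nz' : connect f' n z.
      apply: (connect_trans (y := pi v)); first by apply: connect1; rewrite /f' /add_link !eqxx orbT.
      rewrite sym_connect_sym //; apply/connectP; exists p2; rewrite ?lp2 //.
      have sub1p q x : x \notin p1 -> {in q, forall y, y \notin p1} -> path f x q -> path f' x q.
        elim: q x => [|y q IH] x //= xp qp /andP[fxy pq].
        rewrite {1}/f' /add_link sub1E fxy xp (qp y (mem_head _ _)) /=; apply: IH => //.
          exact: (qp y (mem_head _ _)).
        by move=> b bq; apply: qp; rewrite inE bq orbT.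
      exact: sub1p.
    have zn' : connect f' z n by rewrite sym_connect_sym.
    have end2 x y : x \in p1 -> f x y -> half_retract y = n \/ half_retract y = z.
      move=> xp fxy; have := interior_nbr xp fxy; rewrite inE mem_rcons inE => /or3P[/eqP->|/eqP->|].
      - by left.
      - by right; rewrite /half_retract (negbTE zp1).
      - exact: hr2.
    move=> a b /(cl_conn cl); apply: connect_map => x y fxy.
    have [xp|xp] := boolP (x \in p1).
      by case: (hr2 x xp) => ->; case: (end2 x y xp fxy) => ->.
    have [yp|yp] := boolP (y \in p1).
      have fyx : f y x by rewrite symf.
      by case: (hr2 y yp) => ->; case: (end2 y x yp fyx) => ->.
    by rewrite /half_retract (negbTE xp) (negbTE yp); apply: connect1; rewrite /f' /add_link sub1E fxy xp yp.
- have := wsum_remove (g := fun _ _ => 1 : R) subf (fun _ _ _ => ler01) uA arcsP.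
  rewrite (@sum_arcs _ _ (fun _ _ => 1)) // ww_const1 size_rcons => le1.
  have := @wsum_link R V sub1 (fun _ _ => 1) n (pi v) 1 ler01 (fun _ _ _ => ler01).
  rewrite -/f'; have -> : wsum f' (link_weight (fun _ _ => 1) n (pi v) 1) = wsum f' (fun _ _ => 1 : R).
    by apply: eq_bigr => d _; rewrite /link_weight; case: ifP.
  have up1 : uniq p1 by move: usigma; rewrite /= rcons_uniq => /and3P[].
  have sub : [set x in p1] \subset centers pi.
    by apply/subsetP => x; rewrite !inE => xp; rewrite fixp // inE mem_rcons inE xp !orbT.
  have := cardsID [set x in p1] (centers pi); rewrite (setIidPr sub) cardsE (card_uniqP up1) => cE.
  move: fo le1; rewrite /forest centersE -cE natrD -[(size p1).+1%:R]natr1.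
  move: (wsum f _) (wsum f' _) (wsum sub1 _) #|_ :\: _|%:R (size p1)%:R => a1 a2 a3 a4 a5; lra.
- have := wsum_remove (g := om) subf (fun a b fab => ltW (om0 fab)) uA arcsP.
  rewrite (sum_arcs _ _ symo).
  have := @wsum_link R V sub1 om n (pi v) l (ltW l0) (fun a b fab => ltW (om0 (subf _ _ fab))).
  rewrite -/f' -/om'; move: (wsum f' _) (wsum sub1 _) (wsum f _) (ww _ _ _) => a1 a2 a3 a4; lra.
Qed.
End Shortcut.

Section Swaps.
Variables (R : realFieldType) (V : finType) (e H : rel V) (w : V -> V -> R).
Hypotheses (symH : symmetric H) (symw : forall x y, w x y = w y x).
Variables (f0 : rel V) (om0 : V -> V -> R) (pi0 : V -> V) (h0 : V -> R) (r : R) (c : nat).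
Hypotheses (cl0 : clustering e H w f0 om0 pi0 h0 r) (fo0 : forest R f0 pi0 c).
Variables (L x : R).
Hypotheses (x0 : 0 < x) (xL : 1000 * x <= L) (rx : r <= 5 * x) (h0x : forall a, h0 a <= 7 * x).

Definition long_ends : {set V} := [set a | [exists b, f0 a b && (6 * x < om0 a b)]].

Definition irregular : {set V} := [set a | #|nbr f0 [set: V] a| != 2%N] :|: long_ends.

(** The radius [17 * L] exceeds twice [8 * L + 6 * x]: once for the reach of a swap at [n], once for
    the reach of earlier swaps around [Z]. *)
Definition spoiled (Z : {set V}) (n : V) : bool :=
  [exists s in irregular :|: Z, near f0 om0 (17 * L) s n].

(** A swap removes a path of weight at most [8 * L] followed by one edge of weight at most
    [6 * x]. *)
Definition touched (Z : {set V}) (a : V) : bool :=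
  [exists s in Z, near f0 om0 (8 * L + 6 * x) s a].

(* [x] stands for [eps * L].  Here [f0] is the forest before and [f] the forest
   after some swaps, and [Z] collects the two ends of each new edge.  Only vertices
   within [8 * L + 6 * x] of [Z] are affected, so near an unspoiled vertex walks in
   [f] and in [f0] are the same. *)
Record swapped (Z : {set V}) f om pi h (ret : V -> V) : Prop := Swapped {
  sw_cl : clustering e H w f om pi h r;
  sw_fo : forest R f pi c;
  sw_pi : forall a, pi a = ret (pi0 a);
  sw_same : forall a, ~~ touched Z a -> ret a = a /\
    forall b, f a b = f0 a b /\ om a b = om0 a b;
  sw_ret : forall a, ret a != a -> touched Z (ret a);
  sw_h : forall a, h a <= 7 * x + (4 * L + 3 * x);
  sw_h0 : forall a, ret (pi0 a) = pi0 a -> h a <= 7 * x;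
  sw_edge : forall a b, f a b -> om a b <= 6 * L \/ f0 a b /\ om a b = om0 a b;
  sw_sum : wsum f om + x * #|Z|%:R <= wsum f0 om0 }.

Lemma swapped0 : swapped set0 f0 om0 pi0 h0 id.
Proof.
split=> //; first by move=> a; rewrite eqxx.
- by move=> a; have := h0x a; move: x0 xL; lra.
- by right.
- by rewrite cards0 mulr0 addr0.
Qed.

Let wf0 := cl_weighted cl0.
Section Step.
Variables (Z : {set V}) (f : rel V) (om : V -> V -> R) (pi : V -> V) (h : V -> R) (ret : V -> V).
Hypothesis sw : swapped Z f om pi h ret.
Variables (n u v : V).
Hypotheses (nspoiled : ~~ spoiled Z n) (euv : e u v) (Huv : H u v) (wuv : 0 < w u v <= L).
Hypotheses (piu : pi0 u = n).
Hypothesis far : forall q, path f0 n q -> last n q = pi0 v -> w u v + 75 * x <= ww om0 n q.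

Let wf := cl_weighted (sw_cl sw).

Let regular a : near f0 om0 (8 * L + 6 * x) n a ->
  [/\ ~~ touched Z a, #|nbr f0 [set: V] a| = 2%N & forall b, f0 a b -> om0 a b <= 6 * x].
Proof.
move=> na; have nsp : a \notin irregular :|: Z.
  apply/negP => aS; move/negP: nspoiled; apply; apply/exists_inP; exists a => //.
  by rewrite (near_sym wf0); apply: (near_le wf0) na; move: x0 xL; lra.
split.
- apply/negP => /exists_inP[s sZ sa]; move/negP: nspoiled; apply; apply/exists_inP; exists s.
    by rewrite inE sZ orbT.
  have := near_trans wf0 sa _; rewrite (near_sym wf0) in na; move=> /(_ _ _ na).
  by apply: (near_le wf0); move: x0 xL; lra.
- by apply/eqP; apply: contraNT nsp => d2; rewrite !inE d2.
- move=> b fab; rewrite leNgt; apply: contraNN nsp => lt; rewrite !inE; apply/orP; left.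
  by apply/orP; right; apply/existsP; exists b; rewrite fab.
Qed.

Let follow q : path f n q -> ww om n q <= 8 * L + 6 * x ->
  [/\ path f0 n q, ww om0 n q = ww om n q & {in n :: q, forall a, near f0 om0 (8 * L + 6 * x) n a}].
Proof.
have K0 : 0 <= 8 * L + 6 * x by move: x0 xL; lra.
elim/last_ind: q => [|q y IH] pq wq.
  by split=> // a; rewrite inE => /eqP->; apply: near_refl.
move: pq wq; rewrite rcons_path ww_rcons => /andP[pq fy] wq.
have oy : 0 < om (last n q) y by case: wf => _ _; apply.
have [||pq0 wE nq] := IH => //; first by move: wq oy; lra.
have [nt _ _] := regular (nq _ (mem_last n q)).
have [_ /(_ y)[fE oE]] := sw_same sw nt.
have p0 : path f0 n (rcons q y) by rewrite rcons_path pq0 -fE.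
have wE' : ww om0 n (rcons q y) = ww om n (rcons q y) by rewrite !ww_rcons wE oE.
split=> //; first by rewrite wE' ww_rcons.
move=> a; rewrite inE mem_rcons inE => /or3P[/eqP->|/eqP->|aq].
- exact: near_refl.
- by apply/(nearP wf0); exists (rcons q y); rewrite last_rcons wE' ww_rcons.
- by apply: nq; rewrite inE aq orbT.
Qed.

Let pin : pi u = n.
Proof.
have nn : near f0 om0 (8 * L + 6 * x) n n by apply: (near_refl wf0); move: x0 xL; lra.
by have [nt _ _] := regular nn; rewrite (sw_pi sw) piu; case: (sw_same sw nt).
Qed.

Let apply_shortcut p1 z p2 l : path f n (rcons p1 z ++ p2) -> uniq (n :: (rcons p1 z ++ p2)) ->
  last n (rcons p1 z ++ p2) = pi v -> ww om n (rcons p1 z) <= 8 * L + 6 * x -> p1 != [::] ->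
  ~~ f n (pi v) -> w u v + 2 * r + h u + h v <= l -> 0 < l <= 6 * L ->
  l + x <= ww om n (rcons p1 z) ->
  exists Z' f' om' pi' h' ret',
  [/\ swapped Z' f' om' pi' h' ret', Z \subset Z' & n \in Z'].
Proof.
move=> pp up lp sz p1n0 nf le /andP[l0 l6] gain.
move: pp lp; rewrite cat_path last_cat last_rcons => /andP[pq1 pp2] lp2.
move: (up); rewrite -cat_cons cat_uniq => /and3P[us /hasPn dis up2].
have [_ _ nq] := follow pq1 sz.
have np1 y : y \in p1 -> y \in n :: rcons p1 z by move=> yp; rewrite inE mem_rcons inE yp !orbT.
have reg y : y \in n :: rcons p1 z -> [/\ ~~ touched Z y, ret y = y,
    (forall b, f y b = f0 y b /\ om y b = om0 y b) & #|nbr f [set: V] y| = 2%N].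
  move=> ys; have [nt d2 _] := regular (nq y ys); have [ry sy] := sw_same sw nt; split=> //.
  by rewrite -d2; apply: eq_card => b; rewrite !inE; case: (sy b) => ->.
have deg2 : {in p1, forall y, #|nbr f [set: V] y| = 2%N} by move=> y /np1/reg[].
have p2p1 : {in p2, forall y, y \notin p1}.
  by move=> y /dis; apply: contra => /np1.
have p2n y : y \in p2 -> y != n.
  by move=> /dis; apply: contraNneq => ->; rewrite mem_head.
have nz : n != z by move: us; rewrite /= mem_rcons inE negb_or => /andP[/andP[]].
have tP : pi v \notin p1 /\ n != pi v.
  rewrite -lp2; case: (p2) p2p1 p2n => [|y q] p2p1' p2n' /=.
    by split=> //; move: us; rewrite /= rcons_uniq => /and3P[].
  by split; [apply: p2p1'; apply: mem_last|rewrite eq_sym; apply: p2n'; apply: mem_last].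
have [tp1 nt] := tP.
pose D := 4 * L + 3 * x.
have DE : ww om n (rcons p1 z) <= 2 * D by rewrite /D; move: sz; lra.
have [cl' fo' sum'] := shortcut symH symw (sw_cl sw) (sw_fo sw) pq1 us p1n0 deg2 pin tp1 nt Huv nf le l0 pp2 lp2 p2p1 DE.
set f' := add_link _ _ _ in cl' fo' sum'; set om' := link_weight _ _ _ _ in cl' sum'.
set hr := half_retract om n z p1 D in cl' fo'.
have K0 : 0 <= 8 * L + 6 * x by move: x0 xL; lra.
exists (Z :|: [set n; pi v]), f', om', (hr \o pi), (fun a => h a + (if pi a \in p1 then D else 0)), (hr \o ret).
have tZ a : touched Z a -> touched (Z :|: [set n; pi v]) a.
  by case/exists_inP => s sZ sa; apply/exists_inP; exists s => //; rewrite inE sZ.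
have tn a : a \in n :: rcons p1 z -> touched (Z :|: [set n; pi v]) a.
  by move=> /nq na; apply/exists_inP; exists n => //; rewrite !inE eqxx orbT.
have tt : touched (Z :|: [set n; pi v]) (pi v).
  by apply/exists_inP; exists (pi v); [rewrite !inE eqxx !orbT|apply: (near_refl wf0)].
have hrE a : a \notin p1 -> hr a = a by rewrite /hr /half_retract => /negbTE->.
have hr_in a : a \in p1 -> hr a = n \/ hr a = z.
  by rewrite /hr /half_retract => ->; case: ifP; [left|right].
have ret_p1 a : ret a \in p1 -> ret a = a.
  move=> rp; apply/eqP; apply: contraTT isT => ra.
  by have := sw_ret sw ra; have [/negbTE-> _ _ _] := reg _ (np1 _ rp).
split; [split=> //|exact: subsetUl|by rewrite !inE eqxx orbT].
- by move=> a; rewrite /= (sw_pi sw).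
- move=> a ta; have nta : ~~ touched Z a by apply: contra ta; apply: tZ.
  have [ra sa] := sw_same sw nta.
  have an : a \notin n :: rcons p1 z by apply: contra ta; apply: tn.
  have ap1 : a \notin p1 by apply: contra an; apply: np1.
  have a_n : a == n = false by apply: contraNF an => /eqP->; rewrite mem_head.
  have a_t : a == pi v = false by apply: contraNF ta => /eqP->.
  split; first by rewrite /= ra hrE.
  move=> b; have [fE oE] := sa b; rewrite /om' /link_weight a_n a_t /= oE; split=> //.
  rewrite /f' /add_link a_n a_t /= !orbF -fE ap1; case: (boolP (f a b)) => //= fab.
  apply/negP => bp1; move/negP: an; apply.
  by apply: (interior_nbr (sw_cl sw) pq1 us deg2 bp1); case: wf => ->.
- move=> a /=; have [rp|rp] := boolP (ret a \in p1).
    move=> _; case: (hr_in _ rp) => ->; apply: tn; first by rewrite mem_head.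
    by rewrite inE mem_rcons mem_head orbT.
  by rewrite hrE // => /(sw_ret sw)/tZ.
- move=> a; case: ifP => [pp1|_]; last by rewrite addr0; apply: (sw_h sw).
  rewrite lerD2r; apply: (sw_h0 sw); apply: ret_p1; by rewrite -(sw_pi sw).
- move=> a /=; case: ifP => [pp1|npp1].
    move=> E; have rp : ret (pi0 a) \in p1 by rewrite -(sw_pi sw).
    have rE := ret_p1 _ rp; rewrite rE in E; rewrite rE in rp.
    case: (hr_in _ rp); rewrite E => E'; rewrite E' in rp; move: us.
      by rewrite /= mem_rcons inE rp orbT.
    by rewrite /= rcons_uniq rp andbF.
  have rn : ret (pi0 a) \notin p1 by rewrite -(sw_pi sw) npp1.
  by rewrite addr0 hrE //; apply: (sw_h0 sw).
- move=> a b; rewrite /f' /add_link /om' /link_weight; case: ifP => [|N]; first by left.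
  by rewrite -orbA N orbF => /and3P[fab _ _]; apply: (sw_edge sw).
have := sw_sum sw; have cZ : (#|Z :|: [set n; pi v]| <= #|Z| + 2)%N.
  by apply: leq_trans (leq_card_setU _ _) _; rewrite leq_add2l cards2; case: (_ != _).
have : x * #|Z :|: [set n; pi v]|%:R <= x * #|Z|%:R + 2 * x.
  by rewrite [2 * x]mulrC -mulrDr ler_pM2l // -natrD ler_nat.
move: sum' gain; move: (wsum f' om') (wsum f om) (wsum f0 om0) (x * _) (x * _) => *; lra.
Qed.

(** A forest path of weight at most [8 * L] to the other cluster is traded as a whole, and then the
    far end is untouched as well. Of a longer path only a first piece, just above [8 * L], is
    traded. *)
Lemma swap_step : exists Z' f' om' pi' h' ret',
  [/\ swapped Z' f' om' pi' h' ret', Z \subset Z' & n \in Z'].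
Proof.
have [w0 wL] := andP wuv.
have con : connect f n (pi v) by have := cl_conn (sw_cl sw) euv; rewrite pin.
have [p [pp lp up short]] := shortest wf con.
have nn : near f0 om0 (8 * L + 6 * x) n n by apply: (near_refl wf0); move: x0 xL; lra.
have [ntn dn lowedge] := regular nn; have [_ samen] := sw_same sw ntn.
have whole : ww om n p <= 8 * L -> w u v + 75 * x <= ww om n p /\ h v <= 7 * x.
  move=> wp; have [|p0 wE nq] := follow pp; first by move: x0 wp; lra.
  have [ntt _ _] := regular (nq _ (mem_last n p)).
  have rt : ret (pi0 v) = pi0 v.
    apply/eqP; apply: contraNT ntt => ne; have := sw_ret sw ne.
    by rewrite lp (sw_pi sw).
  split; last by apply: (sw_h0 sw).
  by rewrite -wE; apply: far => //; rewrite lp (sw_pi sw).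
have nf : ~~ f n (pi v).
  apply/negP => fnt; have [fE oE] := samen (pi v).
  have o6 : om n (pi v) <= 6 * x by rewrite oE; apply: lowedge; rewrite -fE.
  have := near_edge wf fnt o6; rewrite short => le6.
  have [|le _] := whole; first by move: le6 xL x0; lra.
  by move: le le6 w0 x0; lra.
have hu : h u <= 7 * x.
  by apply: (sw_h0 sw); rewrite piu; case: (sw_same sw ntn).
have first_edge y : f n y -> om n y <= 6 * x.
  by have [fE oE] := samen y; rewrite oE fE; apply: lowedge.
have [wp|wp] := leP (ww om n p) (8 * L).
  have [le hv] := whole wp.
  case/lastP: p pp lp up short wp le {whole} => [|p1 z] pp lp up short wp le.
    by move: le => /=; move: w0 x0; lra.
  (* [2 * r], [h u] and [h v] are at most [10 * x], [7 * x] and [7 * x], hence [24 * x]; the path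
     removed exceeds the edge by [75 * x]. *)
  apply: (apply_shortcut (p1 := p1) (z := z) (p2 := [::]) (l := w u v + 24 * x)); rewrite ?cats0 //.
  - by move: wp x0; lra.
  - case: (p1) pp wp le => //= /andP[/first_edge]; rewrite addr0; move: w0 x0.
    by move: (om n z) => o; lra.
  - by move: rx hu hv; lra.
  - by move: w0 wL x0 xL; lra.
  - by move: le; move: (ww _ _ _) => o; move: x0; lra.
have [p1 [z [p2 [pE le1 lt1]]]] : exists p1 z p2, [/\ p = rcons p1 z ++ p2,
    ww om n p1 <= 8 * L & 8 * L < ww om n (rcons p1 z)].
  have L0 : 0 <= 8 * L by move: x0 xL; lra.
  elim/last_ind: p wp {pp lp up short whole} => [|q y IH]; first by rewrite /= ltNge L0.
  have [le lt|lt _] := leP (ww om n q) (8 * L); first by exists q, y, [::]; rewrite cats0.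
  have [p1 [z [p2 [qE le1 lt1]]]] := IH lt.
  by exists p1, z, (rcons p2 y); rewrite qE -rcons_cat.
move: pp lp up; rewrite pE => pp lp up.
move: (pp); rewrite cat_path rcons_path -andbA => /and3P[pq1 fz _].
have [|q0 _ nq] := follow pq1; first by move: le1 x0; lra.
have [ntl _ low] := regular (nq _ (mem_last n p1)); have [_ /(_ z)[fE oE]] := sw_same sw ntl.
have oz : om (last n p1) z <= 6 * x by rewrite oE; apply: low; rewrite -fE.
have hv := sw_h sw v.
(* The far end may have moved in an earlier swap, so [h v] is only known to be at most
   [4 * L + 10 * x]. The weight [6 * L] allows for this and stays below the [8 * L] removed. *)
apply: (apply_shortcut (p1 := p1) (z := z) (p2 := p2) (l := 6 * L)) => //.
- by rewrite ww_rcons; move: le1 oz; move: (ww _ _ _) (om _ _) => *; lra.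
- by apply: contraTneq lt1 => E; rewrite E /= addr0; move: oz; rewrite E /= -leNgt; move: x0 xL; lra.
- by move: rx hu hv wL x0 xL; lra.
- by move: x0 xL; lra.
- by move: lt1 x0 xL; move: (ww _ _ _) => *; lra.
Qed.
End Step.

(** Each swap puts a further net point into [Z], so the process stops. Then all net points are near
    [Z] or an irregular vertex, and [sw_sum] bounds [#|Z|]. *)
Lemma swap_all (N : {set V}) :
  (forall n, n \in N -> exists u v, [/\ e u v, H u v, 0 < w u v <= L, pi0 u = n &
    forall q, path f0 n q -> last n q = pi0 v -> w u v + 75 * x <= ww om0 n q]) ->
  exists Z f om pi h ret, swapped Z f om pi h ret /\ {in N, forall n, spoiled Z n}.
Proof.
move=> NP.
have : exists Z f om pi h ret, swapped Z f om pi h ret.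
  by exists set0, f0, om0, pi0, h0, id; apply: swapped0.
case=> Z [f [om [pi [h [ret sw]]]]].
have [m] := ubnP #|N :\: Z|; elim: m Z f om pi h ret sw => // m IH Z f om pi h ret sw sz.
have [/exists_inP[n nN nsp]|none] := boolP [exists n in N, ~~ spoiled Z n]; last first.
  exists Z, f, om, pi, h, ret; split=> // n nN; apply: contraNT none => nsp.
  by apply/exists_inP; exists n.
have [u [v [euv Huv wuv piu far]]] := NP n nN.
have [Z' [f' [om' [pi' [h' [ret' [sw' ZZ' nZ']]]]]]] := swap_step sw nsp euv Huv wuv piu far.
apply: (IH _ _ _ _ _ _ sw'); move: sz; rewrite ltnS; apply: leq_trans; apply: proper_card.
apply/properP; split; first exact: setDS.
exists n; last by rewrite inE nZ'.
rewrite inE nN andbT; apply: contraNN nsp => nZ; apply/exists_inP; exists n.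
  by rewrite inE nZ orbT.
by apply: (near_refl wf0); move: x0 xL; lra.
Qed.

End Swaps.

(** * One scale *)

Section Level.
Variables (R : archiRealFieldType) (V : finType) (e : rel V) (w : V -> V -> R).
Variables (Rp : {set V}) (k D : nat).
Hypotheses (syme : symmetric e) (symw : forall x y, w x y = w y x)
  (w_gt0 : forall x y, e x y -> 0 < w x y).
Hypothesis Rp_conn : forall a, exists2 b, b \in Rp & connect e a b.
Hypothesis k0 : (0 < k)%N.
Hypothesis sparse : forall (W : finType) (g : rel W), symmetric g -> irreflexive g ->
  minor_on g [set: W] e -> exists f : rel W, [/\ symmetric f, subrel f g,
    (narcs f [set: W] <= 2 * D * #|W|)%N &
    forall a b, g a b -> exists p, [/\ path f a p, last a p = b & (size p <= (2 * k).-1)%N]].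

Variables (eps L x r : R).
Hypotheses (eps0 : 0 < eps) (eps1 : 1000 * eps <= 1) (L0 : 0 < L) (xE : x = eps * L).
Let m : R := (2 * k).-1%:R.
Let t : R := (1 + 100 * eps) * m.

Let x0 : 0 < x. Proof. by rewrite xE mulr_gt0. Qed.
Let xL : 1000 * x <= L.
Proof. by rewrite xE mulrA -[X in _ <= X]mul1r ler_pM2r. Qed.
Let m1 : 1 <= m.
Proof. by rewrite /m ler1n; case: k k0 => // j _; rewrite mulnS. Qed.

Let class u v := [&& e u v, w u v <= L & L <= (1 + eps) * w u v].

Let class_w u v : class u v -> [/\ 0 < w u v, L <= w u v + eps * w u v & 100 * x <= (100 + 1/10) * (eps * w u v)].
Proof.
case/and3P=> /w_gt0 w0 wL Lw; split=> //; first by move: Lw; rewrite mulrDl mul1r.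
have y0 : 0 < eps * w u v by rewrite mulr_gt0.
have : x <= (1 + eps) * (eps * w u v) by rewrite xE mulrCA ler_pM2l.
have : 1000 * eps * (eps * w u v) <= 1 * (eps * w u v) by rewrite ler_pM2r.
rewrite mul1r -[1000 * eps * _]mulrA [(1 + eps) * _]mulrDl mul1r; move: (eps * w u v) y0 => y; move: (eps * y) => z; lra.
Qed.

Section Pruned.
Variables (H f : rel V) (om : V -> V -> R) (pi : V -> V) (h : V -> R).
Hypotheses (symH : symmetric H) (He : subrel H e).
Hypotheses (cl : clustering e H w f om pi h r) (fo : forest R f pi #|Rp|).
Hypotheses (rx : r <= 5 * x) (hx : forall a, h a <= 7 * x).

Let wf := cl_weighted cl.
Let wH : weighted H w. Proof. by split=> // a b /He/w_gt0. Qed.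

Definition uncovered u v := class u v && ~~ near H w (t * w u v) u v.

(** A lighter forest path would be realised in [H] at an extra cost of at most [24 * x]. Since
    [75 * x + 24 * x] is within the allowance [100 * eps * w u v], the edge would be covered. *)
Lemma uncovered_far u v q : uncovered u v -> path f (pi u) q -> last (pi u) q = pi v ->
  w u v + 75 * x <= ww om (pi u) q.
Proof.
case/andP=> /class_w[w0 Lw xy] /negP unc pq lq; have [p [pp lp wp _]] := cl_sim cl pq lq.
rewrite leNgt; apply/negP => lt; apply: unc; apply/(nearP wH); exists p; split=> //.
apply: le_trans wp _.
apply: (@le_trans _ _ ((1 + 100 * eps) * w u v)); last first.
  rewrite /t -mulrA ler_pM2l; last by move: eps0; lra.
  by rewrite -[X in X <= _]mul1r ler_pM2r.
rewrite [(1 + _) * w u v]mulrDl mul1r -[100 * eps * _]mulrA; have := hx u; have := hx v; move: lt xy rx x0; move: (ww _ _ _) (eps * _) (h u) (h v) => q' y a b; lra.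
Qed.

Lemma uncovered_sym u v : uncovered u v = uncovered v u.
Proof. by rewrite /uncovered /class syme symw (near_sym wH). Qed.

Definition active : {set V} := [set a | [exists u, exists v, uncovered u v && (pi u == a)]].

(** By [cl_conn] an isolated centre is the image of its whole component, so two of them cannot share
    a representative. *)
Lemma isolated_count : (#|[set a in centers pi | #|nbr f [set: V] a| == 0%N]| <= #|Rp|)%N.
Proof.
set I := [set a in _ | _].
have /fin_all_exists[F FP] : forall a : V, exists b, b \in Rp /\ connect e a b.
  by move=> a; have [b bR ab] := Rp_conn a; exists b.
rewrite -(card_in_imset (f := F) (D := I)).
  by apply: subset_leq_card; apply/subsetP => _ /imsetP[a _ ->]; case: (FP a).
move=> a a' aI a'I E.
have aa' : connect e a a'.
  by apply: connect_trans (_ : connect e (F a) a'); [case: (FP a)|rewrite E sym_connect_sym //; case: (FP a')].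
move: aI a'I; rewrite !inE => /andP[/eqP pa a0] /andP[/eqP pa' _].
have := connect_map (cl_conn cl) aa'; rewrite pa pa' => /connectP[[|b p] //= /andP[fab _] _].
move: a0; rewrite cards_eq0 => /eqP/setP/(_ b); rewrite !inE; by rewrite fab.
Qed.

Lemma net_exists : exists N : {set V}, [/\ N \subset active,
  {in N &, forall n n', near f om x n n' -> n = n'} &
  forall a, a \in active -> exists2 n, n \in N & near f om x a n].
Proof.
pose P (N : {set V}) := (N \subset active) &&
  [forall n in N, forall n' in N, near f om x n n' ==> (n == n')].
have P0 : P set0 by rewrite /P sub0set; apply/forall_inP => n; rewrite inE.
have [N /maxsetP[/andP[NA sep] max] _] := maxset_exists P0.
have sepP : {in N &, forall n n', near f om x n n' -> n = n'}.
  by move=> n n' nN n'N nn; apply/eqP; exact: (implyP (forall_inP (forall_inP sep n nN) n' n'N) nn).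
exists N; split=> // a aA; have [aN|aN] := boolP (a \in N).
  by exists a => //; apply: (near_refl wf); apply: ltW.
have [/exists_inP[n nN an]|none] := boolP [exists n in N, near f om x a n]; first by exists n.
have nn n : n \in N -> near f om x a n = false.
  by move=> nN; apply: contraNF none => an; apply/exists_inP; exists n.
have PaN : P (a |: N).
  rewrite /P subUset sub1set aA NA /=; apply/forall_inP => n /setU1P[->|nN]; apply/forall_inP => n' /setU1P[->|n'N].
  - by rewrite eqxx implybT.
  - by rewrite nn.
  - by rewrite (near_sym wf) nn.
  - by apply/implyP => /(sepP _ _ nN n'N)->.
by have := max _ PaN (subsetUr _ _) => /setP/(_ a); rewrite setU11 (negbTE aN).
Qed.

Section Net.
Variables (N : {set V}) (cell : V -> V).
Hypotheses (NA : N \subset active)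
  (sep : {in N &, forall n n', near f om x n n' -> n = n'})
  (cover : forall a, a \in active -> exists2 n, n \in N & near f om x a n).
Hypothesis cellP : forall a n, n \in N -> near f om x a n -> cell a \in N /\
    exists p, [/\ path f a p, last a p = cell a, ww om a p <= x &
      {in a :: p, forall y, cell y = cell a /\ near f om x y (cell a)}].

(** The nearness clause excludes centres far from the net, where the value of [cell] is
    arbitrary. *)
Definition region (n : V) : {set V} := [set s | (cell (pi s) == n) && near f om x (pi s) n].

(* [26 * x = 2 * (5 * x + 7 * x) + 2 * x]: the clusters of both ends and two walks
   to the centre of the cell. *)
Lemma region_walk n s s' : n \in N -> s \in region n -> s' \in region n ->
  exists p, [/\ path H s p, last s p = s', ww w s p <= 26 * x & {in s :: p, forall z, z \in region n}].
Proof.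
move=> nN; rewrite !inE => /andP[/eqP cs ns] /andP[/eqP cs' ns'].
have [_ [p [pp lp wp ip]]] := cellP nN ns; have [_ [p' [pp' lp' wp' ip']]] := cellP nN ns'.
have [symf symo _] := wf.
have lE : last (pi s) p = last (pi s') p' by rewrite lp lp' cs cs'.
have [||q [pq lq wq iq]] := cl_sim cl (a := s) (b := s') (q := p ++ rev (belast (pi s') p')).
- by rewrite cat_path pp lE sym_rev_path.
- by rewrite last_cat lE last_rev_belast.
exists q; split=> //.
  move: wq; rewrite ww_cat lE ww_rev //; have := hx s; have := hx s'; move: wp wp' rx.
  move: (ww _ _ _) (ww _ _ _) (ww _ _ _) (h s) (h s') => *; lra.
move=> z /iq; rewrite -cat_cons mem_cat mem_rev => /orP[/ip|/mem_belast/ip'] [cz nz].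
  by rewrite inE cz cs eqxx -cs.
by rewrite inE cz cs' eqxx -cs'.
Qed.

Lemma active_region u v : uncovered u v -> cell (pi u) \in N /\ u \in region (cell (pi u)).
Proof.
move=> unc; have ua : pi u \in active.
  by rewrite inE; apply/existsP; exists u; apply/existsP; exists v; rewrite unc eqxx.
have [n nN un] := cover ua; have [cN [p [_ _ _ ip]]] := cellP nN un; split=> //.
by rewrite inE eqxx /=; case: (ip _ (mem_head _ _)).
Qed.

Let W : finType := {n : V | n \in N}.

Definition net_graph : rel W := fun a b => (a != b) &&
  [exists u, exists v, [&& uncovered u v, cell (pi u) == val a & cell (pi v) == val b]].

Lemma net_graphP a b : reflect (a != b /\ exists u v, [/\ uncovered u v, u \in region (val a) & v \in region (val b)])
  (net_graph a b).
Proof.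
apply: (iffP andP) => [[ab /existsP[u /existsP[v /and3P[unc /eqP cu /eqP cv]]]]|[ab [u [v [unc ur vr]]]]]; split=> //.
  exists u, v; have [_] := active_region unc; rewrite cu => ru; split=> //.
  by rewrite uncovered_sym in unc; have [_] := active_region unc; rewrite cv.
apply/existsP; exists u; apply/existsP; exists v; rewrite unc.
by move: ur vr; rewrite !inE => /andP[-> _] /andP[-> _].
Qed.

Lemma net_graph_minor : minor_on net_graph [set: W] e.
Proof.
exists (fun a => region (val a)); split.
- move=> a _; apply/set0Pn; have := subsetP NA _ (valP a); rewrite inE => /existsP[u /existsP[v /andP[unc /eqP pu]]].
  exists u; have [cN ru] := active_region unc; move: ru; rewrite !inE eqxx /= => nu.
  by rewrite -pu in cN *; have -> : cell (pi u) = pi u; [apply/esym/sep => //; rewrite pu; exact: valP|rewrite eqxx (near_refl wf) // ltW].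
- move=> a _ s s' sr s'r; have [p [pp lp _ ip]] := region_walk (valP a) sr s'r.
  apply/connectP; exists p => //.
  elim: p s pp ip {lp sr} => [|y p IH] s //= /andP[Hsy pp] ip.
  rewrite (ip s (mem_head _ _)) (ip y) ?inE ?eqxx ?orbT //= He // IH // => z zp.
  by apply: ip; rewrite inE zp orbT.
- move=> a b _ _ ab; rewrite -setI_eq0; apply: contraNT ab => /set0Pn[s].
  rewrite inE => /andP[]; rewrite !inE => /andP[/eqP ca _] /andP[/eqP cb _].
  by apply/eqP/val_inj; rewrite /= -ca -cb.
- move=> a b _ _ _ /net_graphP[_ [u [v [/andP[/and3P[euv _ _] _] ur vr]]]].
  by exists u, v.
Qed.

Definition augment (A : {set V * V}) : rel V := fun a b => [|| H a b, (a, b) \in A | (b, a) \in A].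

Lemma region_path (A : {set V * V}) (g : rel W) (rep : W * W -> V * V) :
  (forall d, g d.1 d.2 -> [/\ rep d \in A, uncovered (rep d).1 (rep d).2,
     (rep d).1 \in region (val d.1) & (rep d).2 \in region (val d.2)]) ->
  forall p a s v, path g a p -> s \in region (val a) -> v \in region (val (last a p)) ->
  exists q, [/\ path (augment A) s q, last s q = v &
    ww w s q <= (size p)%:R * L + (size p).+1%:R * (26 * x)].
Proof.
move=> repP; have HA : subrel H (augment A) by move=> a b Hab; rewrite /augment Hab.
elim=> [|b p IH] a s v /= pp sa va.
  have [q [pq lq wq _]] := region_walk (valP a) sa va; exists q; split=> //; first exact: sub_path pq.
  by rewrite mul0r add0r mul1r.
case/andP: pp => gab pp; have := repP (a, b) gab; case: (rep (a, b)) => u1 v1 /= [rA unc ru rv].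
have [q1 [pq1 lq1 wq1 _]] := region_walk (valP a) sa ru.
have [q2 [pq2 lq2 wq2]] := IH b v1 v pp rv va.
exists (q1 ++ v1 :: q2); rewrite cat_path last_cat lq1 /= (sub_path HA pq1) pq2; split=> //.
  by rewrite /augment rA orbT.
have wL : w u1 v1 <= L by case/andP: unc => /and3P[].
rewrite ww_cat lq1 /= -[(size p).+2%:R]natr1 mulrDl -[in X in _ <= X + _]natr1 mulrDl !mul1r.
move: wq1 wq2 wL; move: (ww _ _ _) (ww _ _ _) (w u1 v1) (_ * L) (_ * (26 * x)) => *; lra.
Qed.

(** [A1] has an uncovered edge for each dart of the sparse spanner of the net graph; [A2] has one
    for each net point, from which a swap can start. A spanner path costs at most [L] per edge and
    [26 * x] per region, at most [(2 * k - 1) * (L + 52 * x)] in total. *)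
Lemma added_edges : exists A : {set V * V}, [/\ (#|A| <= (2 * D + 1) * #|N|)%N,
  {in A, forall d, uncovered d.1 d.2},
  forall n, n \in N -> exists u v, (u, v) \in A /\ pi u = n &
  forall u v, class u v -> near (augment A) w (t * w u v) u v].
Proof.
have symg : symmetric net_graph.
  have half a b : net_graph a b -> net_graph b a.
    case/net_graphP => ab [u [v [unc ur vr]]]; apply/net_graphP; split; first by rewrite eq_sym.
    by exists v, u; rewrite uncovered_sym.
  by move=> a b; apply/idP/idP; apply: half.
have irrg : irreflexive net_graph by move=> a; rewrite /net_graph eqxx.
have [g [symgg subg gN gpath]] := sparse symg irrg net_graph_minor.
have /fin_all_exists[rep repP] : forall d : W * W, exists uv : V * V, g d.1 d.2 ->
    [/\ uncovered uv.1 uv.2, uv.1 \in region (val d.1) & uv.2 \in region (val d.2)].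
  move=> d; have [gd|ngd] := boolP (g d.1 d.2); last by exists (val d.1, val d.1).
  by have /net_graphP[_ [u [v uvP]]] := subg _ _ gd; exists (u, v).
have /fin_all_exists[bd bdP] : forall a : W, exists uv : V * V, uncovered uv.1 uv.2 /\ pi uv.1 = val a.
  move=> a; have := subsetP NA _ (valP a); rewrite inE => /existsP[u /existsP[v /andP[unc /eqP pu]]].
  by exists (u, v).
pose A1 := [set rep d | d in [set d : W * W | g d.1 d.2]]; pose A2 := [set bd a | a in [set: W]].
exists (A1 :|: A2); split.
- have cW : #|W| = #|N| by rewrite card_sig.
  apply: leq_trans (leq_card_setU _ _) _; rewrite mulnDl mul1n -cW; apply: leq_add; last first.
    by apply: leq_trans (leq_imset_card _ _) _; rewrite cardsT.
  apply: leq_trans (leq_imset_card _ _) _; apply: leq_trans gN.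
  have := card_darts g [set: W]; rewrite /narcs => <-.
  by apply: subset_leq_card; apply/subsetP => d; rewrite !inE.
- move=> d; rewrite inE => /orP[]/imsetP[a]; last by move=> _ ->; case: (bdP a).
  by rewrite inE => ga ->; case: (repP a ga).
- move=> n nN; pose a : W := exist _ n nN; have [unc pE] := bdP a.
  exists (bd a).1, (bd a).2; split; last by rewrite pE.
  by rewrite -surjective_pairing inE; apply/orP; right; apply/imsetP; exists a; rewrite ?in_setT.
have sub : subrel H (augment (A1 :|: A2)) by move=> a b Hab; rewrite /augment Hab.
have wA : weighted (augment (A1 :|: A2)) w.
  split=> //.
    by move=> a b; rewrite /augment symH [X in _ || X]orbC.
  have uncA d : d \in A1 :|: A2 -> e d.1 d.2.
    rewrite inE => /orP[]/imsetP[a].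
      by rewrite inE => ga ->; case: (repP a ga) => /andP[/and3P[]].
    by move=> _ ->; case: (bdP a) => /andP[/and3P[]].
  move=> a b /or3P[/He/w_gt0//|/uncA/w_gt0//|/uncA/w_gt0 /=]; by rewrite symw.
move=> u v cuv; have [unc|nunc] := boolP (uncovered u v); last first.
  move: nunc; rewrite /uncovered cuv /= negbK => /(nearP wH)[p [pp lp wp]].
  by apply/(nearP wA); exists p; split=> //; apply: sub_path pp.
have [cuN ur] := active_region unc.
have [cvN vr] : cell (pi v) \in N /\ v \in region (cell (pi v)).
  by apply: (@active_region v u); rewrite uncovered_sym.
pose a : W := exist _ (cell (pi u)) cuN; pose b : W := exist _ (cell (pi v)) cvN.
(* Within one cell the two clusters would be at forest distance at most [2 * x], too close for an
   uncovered edge. *)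
have ab : a != b.
  apply/eqP => abE; have cE : cell (pi u) = cell (pi v) by rewrite -[LHS]/(val a) abE.
  have nu : near f om x (pi u) (cell (pi v)) by rewrite -cE; move: ur; rewrite inE => /andP[].
  have nv : near f om x (cell (pi v)) (pi v) by rewrite (near_sym wf); move: vr; rewrite inE => /andP[].
  have /(nearP wf)[q [pq lq wq]] := near_trans wf nu nv.
  have := uncovered_far unc pq lq; have [w0 _ _] := class_w cuv; move: wq x0 w0; lra.
have gab : net_graph a b by apply/net_graphP; split=> //; exists u, v.
have [p [pp lp sp]] := gpath _ _ gab.
have repP' d : g d.1 d.2 -> [/\ rep d \in A1 :|: A2, uncovered (rep d).1 (rep d).2,
     (rep d).1 \in region (val d.1) & (rep d).2 \in region (val d.2)].
  move=> gd; have [h1 h2 h3] := repP d gd; split=> //.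
  by rewrite inE; apply/orP; left; apply/imsetP; exists d; rewrite ?inE.
have [||q [pq lq wq]] := region_path repP' (s := u) (v := v) pp; rewrite ?lp //.
apply/(nearP wA); exists q; split=> //; apply: le_trans wq _.
have [w0 Lw xy] := class_w cuv.
have sm : (size p)%:R <= m by rewrite ler_nat.
have h1 : (size p)%:R * (L + 26 * x) <= m * (L + 26 * x) by rewrite ler_pM2r //; move: L0 x0; lra.
have h2 : 1 * (26 * x) <= m * (26 * x) by rewrite ler_pM2r //; move: x0; lra.
have h3 : m * (L + 52 * x) <= m * (w u v + 100 * (eps * w u v)).
  rewrite ler_pM2l; last by apply: lt_le_trans m1.
  by move: Lw xy x0; move: (eps * _) => y; lra.
have -> : t * w u v = m * (w u v + 100 * (eps * w u v)) by rewrite /t; ring.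
apply: le_trans h3; rewrite -natr1.
have -> : (size p)%:R * L + ((size p)%:R + 1) * (26 * x) = (size p)%:R * (L + 26 * x) + 1 * (26 * x) by ring.
have -> : m * (L + 52 * x) = m * (L + 26 * x) + m * (26 * x) by ring.
exact: lerD.
Qed.

End Net.
End Pruned.
End Level.

(** * Charging net points to the potential *)

Section NetSize.
Variables (R : archiRealFieldType) (V : finType) (e H : rel V) (w : V -> V -> R) (c : nat).
Variables (f : rel V) (om : V -> V -> R) (pi : V -> V) (h : V -> R) (r L x : R).
Hypotheses (cl : clustering e H w f om pi h r) (fo : forest R f pi c).
Hypothesis iso : (#|[set a in centers pi | #|nbr f [set: V] a| == 0%N]| <= c)%N.
Hypotheses (x0 : 0 < x) (xL : 1000 * x <= L).

Let deg a := #|nbr f [set: V] a|.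
Let leaves : {set V} := [set a | deg a == 1%N].

(** The number of darts at special vertices is multiplied by [17 * L / x + 2], which is at most
    [18 * L / x]; [forest_darts] then replaces the darts at branching vertices by leaves. *)
Lemma net_size (N Z : {set V}) :
  {in N &, forall n n', near f om x n n' -> n = n'} ->
  (forall n, n \in N -> exists y, f n y) -> {in N, forall n, spoiled f om L x Z n} ->
  x * #|N|%:R <= 18 * L * (4 * #|leaves|%:R + 2 * (#|long_ends f om x|%:R + #|Z|%:R)).
Proof.
move=> sep deg0 spo; pose Sp := irregular f om x :|: Z.
have wf := cl_weighted cl.
have cnt : (#|N| <= (\sum_(s in Sp) deg s) * (Num.Def.truncn (17 * L / x)).+2)%N.
  apply: (net_count wf x0 sep) => // [n /spo/exists_inP[s sS sn]|a]; first by exists s.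
  by rewrite !inE !negb_or negbK -andbA => /and3P[/eqP].
have fo' : (\sum_(a in centers pi) deg a + 2 * c <= 2 * #|centers pi|)%N.
  rewrite -(ler_nat R) natrD !natrM; have := fo; rewrite /forest wsum_const1.
  apply: le_trans; rewrite lerD2r ler_nat [X in (_ <= X)%N](bigID (mem (centers pi))) /=.
  exact: leq_addr.
have dl : (\sum_(s in Sp) deg s <= 4 * #|leaves| + 2 * #|long_ends f om x :|: Z|)%N.
  rewrite /Sp /irregular -setUA; apply: forest_darts fo' iso => a b fab.
  by rewrite inE (cl_fix cl fab).
have dl' : (\sum_(s in Sp) deg s)%:R <= 4 * #|leaves|%:R + 2 * (#|long_ends f om x|%:R + #|Z|%:R) :> R.
  apply: le_trans (_ : (4 * #|leaves| + 2 * #|long_ends f om x :|: Z|)%:R <= _); first by rewrite ler_nat.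
  by rewrite natrD !natrM -natrD lerD2l ler_pM2l // ler_nat leq_card_setU.
have L0 : 0 < L by move: x0 xL; lra.
have tr : x * (Num.Def.truncn (17 * L / x)).+2%:R <= 18 * L.
  have /andP[le _] : (Num.Def.truncn (17 * L / x))%:R <= 17 * L / x < (Num.Def.truncn (17 * L / x)).+1%:R.
    by apply: Num.Theory.truncn_itv; rewrite divr_ge0 ?mulr_ge0 ?ltW.
  have xx : x * (17 * L / x) = 17 * L by rewrite mulrC divfK // gt_eqF.
  rewrite -addn2 natrD mulrDr; have : x * (Num.Def.truncn (17 * L / x))%:R <= x * (17 * L / x) by rewrite ler_pM2l.
  rewrite xx; move: x0 xL; lra.
apply: le_trans (_ : x * ((\sum_(s in Sp) deg s) * (Num.Def.truncn (17 * L / x)).+2)%:R <= _).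
  by rewrite ler_pM2l // ler_nat.
rewrite natrM mulrCA mulrC; apply: le_trans (ler_wpM2r _ tr) _; first exact: ler0n.
by rewrite ler_pM2l // mulr_gt0.
Qed.

(** A leaf on a short edge has height at least [x], and any other leaf is a long end. *)
Lemma leaf_count (ht : V -> R) (S : R) : (forall a, 0 <= ht a) ->
  (forall a b, nbr f [set: V] a = [set b] -> om a b <= 6 * x -> x <= ht a) ->
  \sum_(a in centers pi) ht a <= S ->
  x * #|leaves|%:R <= S + x * #|long_ends f om x|%:R.
Proof.
move=> ht0 short sumS.
have : x * #|leaves :\: long_ends f om x|%:R <= S.
  apply: le_trans sumS; rewrite mulrC mulr_natl -sumr_const.
  apply: le_trans (_ : \sum_(a in leaves :\: long_ends f om x) ht a <= _).
    apply: ler_sum => a; rewrite !inE => /andP[nl /cards1P[b Na]]; apply: (short a b Na).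
    rewrite leNgt; apply: contraNN nl => lt; apply/existsP; exists b; rewrite lt andbT.
    by have := set11 b; rewrite -Na inE => /andP[].
  rewrite [leRHS](bigID (mem (leaves :\: long_ends f om x))) /= -[leLHS]addr0; apply: lerD; last first.
    by apply: sumr_ge0 => a _.
  rewrite le_eqVlt; apply/orP; left; apply/eqP; apply: eq_bigl => a; apply/idP/idP => [|/andP[]//].
  move=> al; rewrite al andbT; move: al; rewrite !inE => /andP[_ /cards1P[b Na]].
  have fab : f a b by have := set11 b; rewrite -Na inE => /andP[].
  by rewrite (cl_fix cl fab).
have : #|leaves|%:R <= #|leaves :\: long_ends f om x|%:R + #|long_ends f om x|%:R :> R.
  rewrite -natrD ler_nat; apply: leq_trans (_ : #|(leaves :\: long_ends f om x) :|: long_ends f om x| <= _)%N.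
    by apply/subset_leq_card/subsetP => a al; rewrite in_setU in_setD al andbT; case: (a \in long_ends f om x).
  exact: leq_card_setU.
rewrite -(ler_pM2l x0) mulrDr; move: (x * _) (x * _) (x * _) => *; lra.
Qed.

End NetSize.

Section OneLevel.
Variables (R : archiRealFieldType) (V : finType) (e T : rel V) (w : V -> V -> R).
Variables (Rp : {set V}) (k D : nat).
Hypotheses (syme : symmetric e) (symw : forall x y, w x y = w y x)
  (w_gt0 : forall x y, e x y -> 0 < w x y).
Hypothesis Rp_conn : forall a, exists2 b, b \in Rp & connect e a b.
Hypothesis k0 : (0 < k)%N.
Hypothesis sparse : forall (W : finType) (g : rel W), symmetric g -> irreflexive g ->
  minor_on g [set: W] e -> exists f : rel W, [/\ symmetric f, subrel f g,
    (narcs f [set: W] <= 2 * D * #|W|)%N &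
    forall a b, g a b -> exists p, [/\ path f a p, last a p = b & (size p <= (2 * k).-1)%N]].

(* The structure handed over between consecutive scales: all edges are short
   compared with the next scale, except for surviving edges of [T]. *)
Record ready (H f : rel V) (om : V -> V -> R) (pi : V -> V) (x r : R) : Prop := Ready {
  rd_sym : symmetric H;
  rd_sub : subrel H e;
  rd_cl : clustering e H w f om pi (fun _ => 0) r;
  rd_fo : forest R f pi #|Rp|;
  rd_edge : forall a b, f a b -> om a b <= 6 * x \/ T a b /\ om a b = w a b }.

Definition long_arcs (x : R) : {set V * V} := [set d | T d.1 d.2 && (6 * x < w d.1 d.2)].

Lemma wsum_augment (H : rel V) (A : {set V * V}) (L : R) : 0 <= L ->
  {in A, forall d, e d.1 d.2 /\ w d.1 d.2 <= L} -> subrel H e ->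
  wsum (augment H A) w <= wsum H w + 2 * (#|A|%:R * L).
Proof.
move=> L0 AP He; have sub d : augment H A d.1 d.2 -> 0 <= w d.1 d.2.
  case/or3P => [/He/w_gt0/ltW//|dA|dA]; first by have [/w_gt0/ltW] := AP _ dA.
  by rewrite symw; have [/w_gt0/ltW] := AP _ dA.
rewrite /wsum [X in X <= _](bigID (fun d => H d.1 d.2)) /=; apply: lerD.
  rewrite le_eqVlt; apply/orP; left; apply/eqP; apply: eq_bigl => d.
  by rewrite /augment; case: (H _ _); rewrite ?andbF.
pose A' := [set (d.2, d.1) | d in A].
have cA' : (#|A'| <= #|A|)%N by apply: leq_imset_card.
have inA d : augment H A d.1 d.2 -> ~~ H d.1 d.2 -> d \in A :|: A'.
  case: d => a b /= /or3P[->//|dA|dA] _; rewrite inE ?dA //.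
  by apply/orP; right; apply/imsetP; exists (b, a).
have wA d : d \in A :|: A' -> w d.1 d.2 <= L.
  rewrite inE => /orP[/AP[]//|/imsetP[d' /AP[_ le] ->]].
  by rewrite /= symw.
apply: le_trans (_ : \sum_(d | augment H A d.1 d.2 && ~~ H d.1 d.2) L <= _).
  by apply: ler_sum => d /andP[h1 h2]; apply/wA/inA.
rewrite sumr_const -[L *+ _]mulr_natl mulrA; apply: ler_wpM2r => //.
apply: le_trans (_ : #|A :|: A'|%:R <= _).
  rewrite ler_nat; apply/subset_leq_card/subsetP => d; rewrite unfold_in /= => /andP[h1 h2].
  exact: inA.
rewrite -natrM ler_nat; apply: leq_trans (leq_card_setU _ _) _.
by rewrite mul2n -addnn leq_add2l.
Qed.

Lemma long_ends_card (f : rel V) om x : (forall a b, f a b -> om a b <= 6 * x \/ T a b /\ om a b = w a b) ->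
  (#|long_ends f om x| <= #|long_arcs x|)%N.
Proof.
move=> edge; apply: leq_trans (leq_imset_card (fun d : V * V => d.1) (mem (long_arcs x))).
apply/subset_leq_card/subsetP => a; rewrite inE => /existsP[b /andP[fab lt]].
apply/imsetP; exists (a, b) => //; rewrite inE /=.
case: (edge a b fab) => [le|[-> <-]]; last by rewrite lt.
by move: lt; rewrite ltNge le.
Qed.

(** The coefficient 72 arises as follows: each net point brings at most [2 * D + 1] edges, each
    counted as two darts of weight at most [L], and [eps ^ 2 * L * #|N|] is at most 36 times the
    potential released. *)
Lemma level (eps L r : R) (H f : rel V) (om : V -> V -> R) (pi : V -> V) :
  0 < eps -> 1000 * eps <= 1 -> 0 < L -> r <= 5 * (eps * L) -> ready H f om pi (eps * L) r ->
  exists (H' f' : rel V) (om' : V -> V -> R) (pi' : V -> V),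
  [/\ ready H' f' om' pi' L (5 * L), subrel H H',
    (forall u v, e u v -> w u v <= L -> L <= (1 + eps) * w u v ->
       near H' w ((1 + 100 * eps) * (2 * k).-1%:R * w u v) u v) &
    eps ^+ 2 * wsum H' w + 72 * (2 * D + 1)%:R * wsum f' om' <=
    eps ^+ 2 * wsum H w + 72 * (2 * D + 1)%:R * (wsum f om + 3 * (eps * L) * #|long_arcs (eps * L)|%:R)].
Proof.
have [x xE] : exists x, eps * L = x by exists (eps * L).
rewrite xE => eps0 eps1 L0 rx [symH He cl fo edge].
have x0 : 0 < x by rewrite -xE mulr_gt0.
have xL : 1000 * x <= L by rewrite -xE mulrA -[X in _ <= X]mul1r ler_pM2r.
have [||||f1 [pi1 [h1 [ht [sub1 cl1 fo1 [h1x ht0] [sum1 leaf1]]]]]] :=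
    @prune R V e H w f om pi (fun _ => 0) r #|Rp| (fun _ => 0) x (6 * x) _ _ cl fo _ _.
- exact: ltW.
- by move: x0; lra.
- by [].
- by move=> _; rewrite lexx /=; move: x0; lra.
have h7 a : h1 a <= 7 * x by have := h1x a; lra.
have [N [NA sep cover]] := net_exists k eps0 L0 (esym xE) cl1.
have [cell cellP] := voronoi N x (cl_weighted cl1).
have [A [cA uncA edgeN stretch]] :=
  added_edges syme symw w_gt0 k0 sparse eps0 eps1 L0 (esym xE) symH He cl1 rx h7 NA sep cover cellP.
have wf1 := cl_weighted cl1.
pose H' := augment H A.
have HH' : subrel H H' by move=> a b Hab; rewrite /H' /augment Hab.
have AeL : {in A, forall d, e d.1 d.2 /\ w d.1 d.2 <= L}.
  by move=> d /uncA/andP[/and3P[-> -> _] _].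
have symH' : symmetric H' by move=> a b; rewrite /H' /augment symH [X in _ || X]orbC.
have H'e : subrel H' e.
  by move=> a b /or3P[/He//|/AeL[]//|/AeL[] /=]; rewrite syme.
have cl1' : clustering e H' w f1 om pi1 h1 r.
  by case: (cl1) => *; split=> //; apply: clusteringS cl1.
have NP n : n \in N -> exists u v, [/\ e u v, H' u v, 0 < w u v <= L, pi1 u = n &
    forall q, path f1 n q -> last n q = pi1 v -> w u v + 75 * x <= ww om n q].
  case/edgeN => u [v [uvA pu]]; have unc := uncA _ uvA; have [/= euv wL] := AeL _ uvA.
  exists u, v; split=> //; first by rewrite /H' /augment uvA orbT.
    by rewrite w_gt0.
  by move=> q; rewrite -pu; apply: (uncovered_far symw w_gt0 k0 eps0 eps1 L0 (esym xE) symH He cl1 rx h7 unc).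
have deg0 n : n \in N -> exists y, f1 n y.
  case/NP => u [v [euv _ /andP[w0 _] pu far]].
  have /connectP[[|y p] /= pp lp] := cl_conn cl1 euv; rewrite pu in pp lp.
    by have := far [::] isT (esym lp); rewrite /=; move: w0 x0; lra.
  by exists y; case/andP: pp.
have [Z [f2 [om2 [pi2 [h2 [ret [sw spo]]]]]]] := swap_all symH' symw cl1' fo1 x0 xL rx h7 NP.
exists H', f2, om2, pi2; split=> //.
- split=> //.
  + have sim := @simulates_reset _ _ _ _ _ _ _ _ _ (5 * L - r) _ (cl_sim (sw_cl sw)).
    rewrite (_ : r + (5 * L - r) = 5 * L) in sim; last by ring.
    by case: (sw_cl sw) => *; split=> //; apply: sim => a; have := sw_h sw a; move: rx xL x0; lra.
  + exact: (sw_fo sw).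
  + move=> a b /(sw_edge sw)[le|[/sub1 fab ->]]; first by left.
    by case: (edge a b fab) => [le|]; [left; move: le x0 xL; lra|right].
- by move=> u v euv wL Lw; apply: stretch; apply/and3P.
have iso := isolated_count syme Rp_conn cl1.
have n1 := net_size cl1 fo1 iso x0 xL sep deg0 spo.
have n2 := leaf_count cl1 x0 ht0 leaf1 (lexx _).
have n3 : x * #|long_ends f1 om x|%:R <= x * #|long_arcs x|%:R.
  by rewrite ler_pM2l // ler_nat; apply: long_ends_card => a b /sub1; apply: edge.
have n4 := sw_sum sw.
have n5 : wsum H' w <= wsum H w + 2 * (#|A|%:R * L) by apply: wsum_augment => //; apply: ltW.
have n6 : #|A|%:R <= (2 * D + 1)%:R * #|N|%:R :> R by rewrite -natrM ler_nat.
rewrite [X in _ <= _ + 2 * X]big1 // mulr0 addr0 in sum1.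
set S := \sum_(_ in _) _ in sum1 n2.
(* The summand [3 * x] per long arc of [T] arises because a long end enters four times through the
   leaves and twice by itself, against [2 * Delta]. *)
pose Delta := wsum f om - wsum f2 om2 + 3 * x * #|long_arcs x|%:R.
have n7 : x * (4 * #|[set a | #|nbr f1 [set: V] a| == 1%N]|%:R + 2 * (#|long_ends f1 om x|%:R + #|Z|%:R)) <= 2 * Delta.
  rewrite /Delta -[3 * x * _]mulrA; move: n2 n3 n4 sum1.
  move: #|[set a | _]|%:R #|long_ends _ _ _|%:R #|Z|%:R (x * #|long_arcs x|%:R) => l E z T'.
  have -> : x * (4 * l + 2 * (E + z)) = 4 * (x * l) + 2 * (x * E) + 2 * (x * z) by ring.
  move: (x * l) (x * E) (x * z) (wsum f1 om) (wsum f om) (wsum f2 om2) => *; lra.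
have n8 : x * (x * #|N|%:R) <= 36 * L * Delta.
  apply: le_trans (_ : x * (18 * L * (4 * #|[set a | #|nbr f1 [set: V] a| == 1%N]|%:R + 2 * (#|long_ends f1 om x|%:R + #|Z|%:R))) <= _).
    by rewrite ler_pM2l.
  by rewrite mulrCA (_ : 36 * L * Delta = 18 * L * (2 * Delta)) ?ler_pM2l ?mulr_gt0 //; ring.
have n9 : eps ^+ 2 * (#|N|%:R * L) <= 36 * Delta.
  rewrite -(ler_pM2l L0); apply: le_trans (_ : x * (x * #|N|%:R) <= _).
    by rewrite -xE le_eqVlt; apply/orP; left; apply/eqP; ring.
  by apply: le_trans n8 _; rewrite mulrCA mulrA.
have e2 : 0 < eps ^+ 2 by rewrite exprn_gt0.
have n10 : eps ^+ 2 * wsum H' w <= eps ^+ 2 * wsum H w + 2 * ((2 * D + 1)%:R * (36 * Delta)).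
  apply: le_trans (_ : eps ^+ 2 * (wsum H w + 2 * (#|A|%:R * L)) <= _); first by rewrite ler_pM2l.
  rewrite mulrDr lerD2l mulrCA ler_pM2l //.
  apply: le_trans (_ : eps ^+ 2 * ((2 * D + 1)%:R * #|N|%:R * L) <= _).
    by rewrite ler_pM2l // ler_pM2r.
  rewrite -[_ * #|N|%:R * L]mulrA mulrCA ler_wpM2l //.
apply: le_trans (lerD n10 (lexx _)) _; rewrite /Delta.
by rewrite le_eqVlt; apply/orP; left; apply/eqP; ring.
Qed.

End OneLevel.

(** * All scales *)

Section Scales.
Variables (R : archiRealFieldType) (V : finType) (e T : rel V) (w : V -> V -> R).
Variables (Rp : {set V}) (k D : nat).
Hypotheses (syme : symmetric e) (irre : irreflexive e) (symw : forall x y, w x y = w y x)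
  (w_gt0 : forall x y, e x y -> 0 < w x y).
Hypotheses (symT : symmetric T) (Te : subrel T e) (T_conn : forall x y, e x y -> connect T x y).
Hypothesis T_forest : (\sum_x #|nbr T [set: V] x| + 2 * #|Rp| <= 2 * #|V|)%N.
Hypothesis Rp_conn : forall a, exists2 b, b \in Rp & connect e a b.
Hypothesis k0 : (0 < k)%N.
Hypothesis sparse : forall (W : finType) (g : rel W), symmetric g -> irreflexive g ->
  minor_on g [set: W] e -> exists f : rel W, [/\ symmetric f, subrel f g,
    (narcs f [set: W] <= 2 * D * #|W|)%N &
    forall a b, g a b -> exists p, [/\ path f a p, last a p = b & (size p <= (2 * k).-1)%N]].
Variable eps : R.
Hypotheses (eps0 : 0 < eps) (eps1 : 1000 * eps <= 1).
Let t : R := (1 + 100 * eps) * (2 * k).-1%:R.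

(** A second potential, which pays for the long tree edges: an edge of weight [y] is long only at
    scales with [6 * x < y], and these scales form a geometric progression. *)
Definition long_excess (x : R) : R := wsum T (fun a b => Num.max 0 (w a b - x)).

Lemma long_excess_drop x x' : 0 < x -> 4 * x <= x' ->
  long_excess x' + 3 * x * #|long_arcs T w x|%:R <= long_excess x.
Proof.
move=> x0 xx'; rewrite /long_excess /wsum mulr_natr -sumr_const.
rewrite [X in _ + X <= _](eq_bigl (fun d : V * V => T d.1 d.2 && (6 * x < w d.1 d.2))) => [|d]; last by rewrite inE.
rewrite big_mkcondr -big_split /=; apply: ler_sum => d _.
case: ifP => lt; last first.
  by rewrite addr0 ge_max le_max lexx /= le_max; apply/orP; right; move: x0 xx'; lra.
apply: le_trans (_ : w d.1 d.2 - x <= _); last by rewrite le_max lexx orbT.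
rewrite -lerBrDr ge_max; move: lt x0 xx'; move: (w _ _) => y lt x0' xx; apply/andP; split; lra.
Qed.

Lemma initial_ready x : ready e T w Rp T T w id x 0.
Proof.
have wT : weighted T w by split=> // a b /Te/w_gt0.
split=> //.
- split=> //; first by move=> a; apply/negP => /Te; rewrite irre.
  move=> a b q pq lq; exists q; split=> //; by rewrite mulr0 !add0r.
- rewrite /forest wsum_const1 (_ : centers id = [set: V]); last by apply/setP => a; rewrite !inE eqxx.
  by rewrite cardsT -!natrM -natrD ler_nat.
- by move=> a b Tab; right.
Qed.

Let K : R := 72 * (2 * D + 1)%:R.

(** The quantity [eps ^ 2 * wsum H w] plus [K] times the two potentials never increases. It starts
    at [H = T], where both potentials are at most [wsum T w]; hence [2 * K]. *)
Lemma residue (L : nat -> R) M : (forall i, 0 < L i) -> (forall i, L i <= eps * L i.+1) ->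
  exists H : rel V, [/\ symmetric H, subrel H e,
    eps ^+ 2 * wsum H w <= (eps ^+ 2 + 2 * K) * wsum T w &
    forall i u v, (i < M)%N -> e u v -> w u v <= L i -> L i <= (1 + eps) * w u v ->
      near H w (t * w u v) u v].
Proof.
move=> L0 LL; have w0 : 0 <= wsum T w by apply: wsum_ge0 => a b /Te/w_gt0/ltW.
have K0 : 0 <= K by rewrite mulr_ge0 ?ler0n.
suff [H [f [om [pi [r [[symH He cl fo ed] rL near_ pot]]]]]] : exists H f om pi r,
  [/\ ready e T w Rp H f om pi (eps * L M) r, r <= 5 * (eps * L M),
   forall i u v, (i < M)%N -> e u v -> w u v <= L i -> L i <= (1 + eps) * w u v ->
      near H w (t * w u v) u v &
   eps ^+ 2 * wsum H w + K * (wsum f om + long_excess (eps * L M)) <= (eps ^+ 2 + 2 * K) * wsum T w].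
  exists H; split=> //; apply: le_trans pot; rewrite lerDl mulr_ge0 // addr_ge0 //.
    by apply: wsum_ge0 => a b fab; apply/ltW; case: (cl_weighted cl) => _ _; apply.
  by apply: wsum_ge0 => a b _; rewrite le_max lexx.
elim: M => [|M [H [f [om [pi [r [rd rL near_ pot]]]]]]].
  exists T, T, w, id, 0; split=> //; first exact: initial_ready.
    by rewrite !mulr_ge0 // ltW.
  rewrite [leRHS]mulrDl lerD2l (_ : 2 * K * wsum T w = K * (wsum T w + wsum T w)); last by ring.
  apply: ler_wpM2l => //.
  rewrite lerD2l; apply: ler_sum => d /Te/w_gt0 wd; rewrite ge_max ltW //= lerBlDr lerDl.
  by rewrite mulr_ge0 // ltW.
have [H' [f' [om' [pi' [rd' HH' new pot']]]]] :=
  level syme symw w_gt0 Rp_conn k0 sparse eps0 eps1 (L0 M) rL rd.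
have wH' : weighted H' w by split=> //; [exact: rd_sym rd'|move=> a b /(rd_sub rd')/w_gt0].
have wH : weighted H w by split=> //; [exact: rd_sym rd|move=> a b /(rd_sub rd)/w_gt0].
exists H', f', om', pi', (5 * L M); split.
- case: rd' => s1 s2 s3 s4 s5; split=> // a b /s5[le|]; [left|by right].
  by apply: le_trans le _; rewrite ler_pM2l.
- by rewrite ler_pM2l.
- move=> i u v; rewrite ltnS leq_eqVlt => /orP[/eqP->|iM] euv wL Lw; first exact: new.
  have /(nearP wH)[p [pp lp wp]] := near_ i u v iM euv wL Lw.
  by apply/(nearP wH'); exists p; split=> //; apply: sub_path pp.
apply: le_trans pot; rewrite !mulrDr; move: pot'; rewrite -/K mulrDr.
have x0 : 0 < eps * L M by rewrite mulr_gt0.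
have xx : 4 * (eps * L M) <= eps * L M.+1.
  apply: le_trans (LL M); rewrite mulrA -[X in _ <= X]mul1r ler_pM2r //; move: eps1 eps0; lra.
have := ler_wpM2l K0 (long_excess_drop x0 xx); rewrite mulrDr.
move: (_ * wsum H' w) (_ * wsum H w) (K * wsum f' om') (K * wsum f om) (K * long_excess _) (K * long_excess _) (K * _) => *; lra.
Qed.

Lemma lower_bound : exists2 w0 : R, 0 < w0 & forall u v, e u v -> w0 <= w u v.
Proof.
case: (pickP (fun d : V * V => e d.1 d.2)) => [d0 ed|none]; last first.
  by exists 1 => // u v euv; have := none (u, v); rewrite /= euv.
case: (Order.TotalTheory.arg_minP (fun d : V * V => w d.1 d.2) (P := fun d : V * V => e d.1 d.2) ed) => d ed' min.
by exists (w d.1 d.2) => [|u v euv]; [exact: w_gt0|exact: (min (u, v))].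
Qed.

(** Take the least [l] for which the first bound holds; Bernoulli's inequality shows that there is
    one. *)
Lemma scale_exists (w0 y : R) : 0 < w0 -> w0 <= y ->
  exists l, y <= w0 * (1 + eps) ^+ l /\ w0 * (1 + eps) ^+ l <= (1 + eps) * y.
Proof.
move=> w00 w0y; have q0 : 0 < 1 + eps by move: eps0; lra.
have bern l : 1 + l%:R * eps <= (1 + eps) ^+ l.
  elim: l => [|l IH]; first by rewrite mul0r addr0.
  rewrite exprS; apply: le_trans (ler_wpM2l (ltW q0) IH).
  have : 0 <= l%:R * eps * eps by rewrite !mulr_ge0 // ?ler0n // ltW.
  rewrite -natr1 !mulrDl !mulrDr !mul1r !mulr1 mulrA [eps * l%:R]mulrC.
  move: (l%:R * eps) (l%:R * eps * eps) => *; lra.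
have ex : exists l, y <= w0 * (1 + eps) ^+ l.
  exists (Num.truncn (y / (w0 * eps))).+1.
  have := Num.Theory.truncn_itv (divr_ge0 (le_trans (ltW w00) w0y) (ltW (mulr_gt0 w00 eps0))).
  move=> /andP[_ lt]; apply: le_trans (_ : w0 * (1 + (Num.truncn (y / (w0 * eps))).+1%:R * eps) <= _); last first.
    by rewrite ler_pM2l.
  apply: ltW; move: lt; rewrite ltr_pdivrMr ?mulr_gt0 // => lt; apply: lt_le_trans lt _.
  by rewrite mulrDr mulr1 mulrCA lerDr ltW.
case: (ex_minnP ex) => l yl min; exists l; split=> //.
case: l yl min => [|l] yl min.
  rewrite expr0 mulr1 mulrDl mul1r; apply: (le_trans w0y); rewrite lerDl mulr_ge0 ?(ltW eps0) //.
  exact: le_trans (ltW w00) w0y.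
rewrite exprS mulrCA ler_pM2l //; apply/ltW; rewrite ltNge; apply/negP => /min.
by rewrite ltnn.
Qed.

(** The scale number is written as [i * J + j]. The hypothesis on [J] separates consecutive scales
    of one residue [j] by a factor at least [1 / eps]. The [J] spanners, each started from [T], are
    united. *)
Lemma all_scales J : (0 < J)%N -> 1 <= eps * (1 + eps) ^+ J ->
  exists H : rel V, [/\ symmetric H, subrel H e,
    eps ^+ 2 * wsum H w <= J%:R * ((eps ^+ 2 + 2 * K) * wsum T w) &
    forall u v, e u v -> near H w (t * w u v) u v].
Proof.
move=> J0 epsJ; have [w0 w00 wmin] := lower_bound.
have q0 : 0 < 1 + eps by move: eps0; lra.
have /fin_all_exists[l lP] : forall d : V * V, exists l : nat, e d.1 d.2 ->
    w d.1 d.2 <= w0 * (1 + eps) ^+ l /\ w0 * (1 + eps) ^+ l <= (1 + eps) * w d.1 d.2.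
  move=> d; have [ed|ed] := boolP (e d.1 d.2); last by exists 0%N.
  by have [l lP] := scale_exists w00 (wmin _ _ ed); exists l.
pose M := (\max_d l d).+1.
have /fin_all_exists[H HP] : forall j : 'I_J, exists H : rel V, [/\ symmetric H, subrel H e,
    eps ^+ 2 * wsum H w <= (eps ^+ 2 + 2 * K) * wsum T w &
    forall i u v, (i < M)%N -> e u v -> w u v <= w0 * (1 + eps) ^+ (i * J + j) ->
      w0 * (1 + eps) ^+ (i * J + j) <= (1 + eps) * w u v -> near H w (t * w u v) u v].
  move=> j; apply: (residue (L := fun i => w0 * (1 + eps) ^+ (i * J + j))) => [i|i].
    by rewrite mulr_gt0 // exprn_gt0.
  have : 0 < w0 * (1 + eps) ^+ (i * J + j) by rewrite mulr_gt0 // exprn_gt0.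
  rewrite mulSn -addnA [_ ^+ (J + _)]exprD; move: epsJ; move: ((1 + eps) ^+ J) ((1 + eps) ^+ (i * J + j)) => a b aJ b0.
  have : 1 * (w0 * b) <= eps * a * (w0 * b) by rewrite ler_pM2r.
  by rewrite mul1r (_ : eps * a * (w0 * b) = eps * (w0 * (a * b))) //; ring.
pose HU : rel V := fun a b => [exists j, H j a b].
have symHU : symmetric HU.
  by move=> a b; apply: eq_existsb => j; case: (HP j) => symH _ _ _; rewrite symH.
have HUe : subrel HU e by move=> a b /existsP[j Hj]; case: (HP j) => _ He _ _; apply: He.
have wHU : weighted HU w by split=> // a b /HUe/w_gt0.
exists HU; split=> //.
  apply: le_trans (_ : \sum_(j < J) eps ^+ 2 * wsum (H j) w <= _); last first.
    apply: le_trans (_ : \sum_(j < J) (eps ^+ 2 + 2 * K) * wsum T w <= _).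
      by apply: ler_sum => j _; case: (HP j).
    by rewrite sumr_const card_ord -[_ *+ J]mulr_natl.
  rewrite -mulr_sumr ler_pM2l ?exprn_gt0 //; rewrite /wsum.
  under [leRHS]eq_bigr => j _ do rewrite big_mkcond.
  rewrite exchange_big /= big_mkcond; apply: ler_sum => d _.
  have ge0 j : 0 <= (if H j d.1 d.2 then w d.1 d.2 else 0).
    by case: ifP => // Hd; case: (HP j) => _ He _ _; apply/ltW/w_gt0/He.
  case: ifP => [/existsP[j Hj]|_]; last by apply: sumr_ge0.
  by rewrite (bigD1 j) //= Hj lerDl sumr_ge0.
move=> u v euv; have [le1 le2] := lP (u, v) euv.
have lM : (l (u, v) < M)%N by rewrite /M ltnS; apply: (leq_bigmax (u, v)).
have [_ _ _ nearj] := HP (Ordinal (ltn_pmod (l (u, v)) J0)).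
have := nearj (l (u, v) %/ J)%N u v; rewrite /= -divn_eq.
case: (HP (Ordinal (ltn_pmod (l (u, v)) J0))) => symH He _ _.
have wH : weighted (H (Ordinal (ltn_pmod (l (u, v)) J0))) w by split=> // a b /He/w_gt0.
move=> /(_ (leq_ltn_trans (leq_div _ _) lM) euv le1 le2) /(nearP wH)[p [pp lp wp]].
apply/(nearP wHU); exists p; split=> //; apply: sub_path pp => a b Hab; apply/existsP.
by exists (Ordinal (ltn_pmod (l (u, v)) J0)).
Qed.

End Scales.

(** * From edge sets to relations *)

Section EdgeSets.
Variable V : finType.
Implicit Types (E F : {set {set V}}).

Lemma adj_sym E : symmetric (adj E).
Proof. by move=> x y; rewrite /adj setUC. Qed.

Lemma adj_irr E : (forall s, s \in E -> #|s| = 2%N) -> irreflexive (adj E).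
Proof. by move=> E2 x; apply/negP => /E2; rewrite setUid cards1. Qed.

Lemma set2_eq (a b x y : V) : ([set x; y] == [set a; b]) = ((x == a) && (y == b) || (x == b) && (y == a)).
Proof.
apply/eqP/idP => [E|/orP[]/andP[/eqP-> /eqP->] //]; last by rewrite setUC.
have h1 : x \in [set a; b] by rewrite -E set21.
have h2 : y \in [set a; b] by rewrite -E set22.
have h3 : a \in [set x; y] by rewrite E set21.
have h4 : b \in [set x; y] by rewrite E set22.
move: h1 h2 h3 h4; rewrite !inE ![a == _]eq_sym ![b == _]eq_sym.
by case: (x == a); case: (x == b); case: (y == a); case: (y == b).
Qed.

Lemma wsum_adj (R : realFieldType) F (g : {set V} -> R) : (forall s, s \in F -> #|s| = 2%N) ->
  wsum (adj F) (fun x y => g [set x; y]) = 2 * \sum_(s in F) g s.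
Proof.
move=> F2; rewrite /wsum (partition_big (fun d : V * V => [set d.1; d.2]) (mem F)) //= mulr_sumr.
apply: eq_bigr => s sF; have /eqP/cards2P[a [b [ab sE]]] := F2 s sF.
rewrite (eq_bigr (fun=> g s)) => [|d /andP[_ /eqP->] //].
rewrite sumr_const mulrC mulr_natr; congr (_ *+ _).
have -> : 2%N = #|[set (a, b); (b, a)]| by rewrite cards2 xpair_eqE negb_and ab.
apply: eq_card => -[x y]; rewrite unfold_in /= /adj !inE !xpair_eqE.
have [E|nE] := eqVneq [set x; y] s; first by rewrite E sF /=; move: E => /eqP; rewrite sE set2_eq.
by rewrite andbF; apply/esym/negP; rewrite -set2_eq -sE (negbTE nE).
Qed.

Lemma card_adj F : (forall s, s \in F -> #|s| = 2%N) ->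
  (\sum_x #|nbr (adj F) [set: V] x| = 2 * #|F|)%N.
Proof.
move=> F2; apply/eqP; rewrite -(eqr_nat rat) -wsum_const1 natrM.
by rewrite (wsum_adj (fun _ => 1 : rat) F2) sumr_const.
Qed.

Lemma rel_edges E (H : rel V) : symmetric H -> subrel H (adj E) ->
  exists F : {set {set V}}, F \subset E /\ forall x y, adj F x y = H x y.
Proof.
move=> symH HE; exists [set s in E | [exists x, exists y, (s == [set x; y]) && H x y]]; split.
  by apply/subsetP => s; rewrite inE => /andP[].
move=> x y; rewrite /adj inE; apply/andP/idP => [[_ /existsP[a /existsP[b /andP[]]]]|Hxy].
  by rewrite set2_eq => /orP[]/andP[/eqP-> /eqP->] //; rewrite symH.
split; first exact: HE.
by apply/existsP; exists x; apply/existsP; exists y; rewrite eqxx.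
Qed.

Lemma forest_reps F : (forall s, s \in F -> #|s| = 2%N) -> acyclic F ->
  exists P : {set V}, (#|F| + #|P| <= #|V|)%N /\ forall a, exists2 b, b \in P & connect (adj F) a b.
Proof.
have [m] := ubnP #|F|; elim: m F => // m IH F sz F2 acF.
have [->|[s sF]] := set_0Vmem F.
  by exists [set: V]; rewrite cards0 cardsT; split=> // a; exists a.
have sub (F' : {set {set V}}) : F' \subset F -> acyclic F'.
  move=> /subsetP F'F c sc /andP[cy uc]; apply: (acF c sc); rewrite /ucycle uc andbT.
  by apply: sub_cycle cy => x y; apply: F'F.
have F'F : F :\ s \subset F by apply: subsetDl.
have [|||P [cP conP]] := IH (F :\ s) _ _ _.
- by move: sz; rewrite (cardsD1 s F) sF.
- by move=> s' /(subsetP F'F)/F2.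
- exact: sub.
have /eqP/cards2P[x [y [xy sE]]] := F2 s sF.
have subadj : subrel (adj (F :\ s)) (adj F) by move=> a b; apply: (subsetP F'F).
have adjxy : adj F x y by rewrite /adj -sE.
have nxy : ~~ connect (adj (F :\ s)) x y.
  apply/negP => /connectP[p0 pp0 lE]; case/shortenP: pp0 lE => p pp up _ lE.
  apply: (acF (x :: p)).
    case: p pp up lE => [|a [|b p]] //=; first by move=> _ _ E; rewrite E eqxx in xy.
    move=> /andP[xa _] _ E; move: xa; rewrite /adj -E -sE !inE eqxx //.
  rewrite /ucycle up andbT /= rcons_path (sub_path subadj pp) /= -lE adj_sym //.
have [rx rxP xrx] := conP x; have [ry ryP yry] := conP y.
have csym : connect_sym (adj (F :\ s)) by apply/sym_connect_sym/adj_sym.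
have rxy : rx != ry.
  apply: contraNneq nxy => E; apply: connect_trans xrx _; by rewrite E csym.
exists (P :\ ry); split.
  by move: cP; rewrite (cardsD1 s F) sF (cardsD1 ry P) ryP addnA addn1 add1n addSn.
have lift a b : connect (adj (F :\ s)) a b -> connect (adj F) a b.
  by apply: connect_sub => c d /subadj/connect1.
move=> a; have [b bP ab] := conP a; have [bE|bn] := eqVneq b ry; last first.
  by exists b; [rewrite !inE bn|apply: lift].
exists rx; first by rewrite !inE rxy.
apply: connect_trans (lift _ _ ab) _; rewrite bE.
apply: connect_trans (_ : connect (adj F) ry y) _; first by apply: lift; rewrite csym.
apply: connect_trans (_ : connect (adj F) y x) _; first by apply: connect1; rewrite adj_sym.
exact: lift.
Qed.

Lemma Kminor_clique h E : clique_minor_free h E -> ~ Kminor_on h (adj E) [set: V].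
Proof.
move=> free [B [_ B0 Bc Bd Ba]]; apply: free; exists B; split=> // i j.
rewrite /adj inE cards2 => ij; apply: Ba; by case: (i != j) ij.
Qed.

(** A minor of a minor is a minor, so one [D] serves the net graphs of all scales. *)
Lemma sparse_minors h k D E : (forall s, s \in E -> #|s| = 2%N) -> clique_minor_free h E ->
  (0 < k)%N -> (0 < h)%N -> (2 ^ (31 * k.+1) * minor_density h ^ 2 < D ^ k.+1)%N ->
  forall (W : finType) (g : rel W), symmetric g -> irreflexive g ->
  minor_on g [set: W] (adj E) -> exists f : rel W, [/\ symmetric f, subrel f g,
    (narcs f [set: W] <= 2 * D * #|W|)%N &
    forall a b, g a b -> exists p, [/\ path f a p, last a p = b & (size p <= (2 * k).-1)%N]].
Proof.
move=> E2 free k0 h0 HD W g symg irrg gE; apply: (sparse_spanner symg irrg k0 h0 _ HD).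
by move=> K; apply: (Kminor_clique free); apply: Kminor_lift gE K => //; apply: adj_sym.
Qed.

End EdgeSets.

Lemma walk_weightE (R : realType) (V : finType) (G : wgraph R V) u p :
  walk_weight G u p = ww (fun x y => wt G [set x; y]) u p.
Proof.
rewrite /walk_weight; elim: p u => [|y p IH] u /=; first by rewrite big_nil.
by rewrite big_cons IH.
Qed.

Lemma light_spanner (R : realType) (V : finType) (G : wgraph R V) (T : {set {set V}})
    (h k D J : nat) (eps : R) :
  spanning_tree G T -> clique_minor_free h (edges G) -> (0 < k)%N -> (0 < h)%N ->
  (2 ^ (31 * k.+1) * minor_density h ^ 2 < D ^ k.+1)%N ->
  0 < eps -> 1000 * eps <= 1 -> (0 < J)%N -> 1 <= eps * (1 + eps) ^+ J ->
  exists F : {set {set V}}, [/\ F \subset edges G,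
    eps ^+ 2 * weight G F <= J%:R * ((eps ^+ 2 + 2 * (72 * (2 * D + 1)%:R)) * weight G T) &
    forall u v, adj (edges G) u v -> exists p, [/\ path (adj F) u p, last u p = v &
      walk_weight G u p <= (1 + 100 * eps) * (2 * k).-1%:R * wt G [set u; v]]].
Proof.
move=> [TE acT conT] free k0 h0 HD eps0 eps1 J0 HJ.
pose e := adj (edges G); pose w x y := wt G [set x; y].
have E2 := @edges_card2 _ _ G; have T2 s : s \in T -> #|s| = 2%N by move=> /(subsetP TE)/E2.
have symw x y : w x y = w y x by rewrite /w setUC.
have w0 x y : e x y -> 0 < w x y by apply: wt_gt0.
have [P [cP conP]] := forest_reps T2 acT.
have Te : subrel (adj T) e by move=> x y; apply: (subsetP TE).
have Tcon x y : e x y -> connect (adj T) x y by move=> exy; rewrite conT connect1.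
have forest : (\sum_x #|nbr (adj T) [set: V] x| + 2 * #|P| <= 2 * #|V|)%N.
  by rewrite card_adj // -mulnDr leq_mul2l cP.
have Pcon a : exists2 b, b \in P & connect e a b.
  by have [b bP ab] := conP a; exists b; rewrite // -conT.
have [H [symH He wH near_]] := all_scales (@adj_sym _ _) (adj_irr E2) symw w0 (@adj_sym _ T) Te Tcon
  forest Pcon k0 (sparse_minors E2 free k0 h0 HD) eps0 eps1 J0 HJ.
have [F [FE adjF]] := rel_edges symH He.
have F2 s : s \in F -> #|s| = 2%N by move=> /(subsetP FE)/E2.
exists F; split=> //.
  have wF : wsum H w = 2 * weight G F.
    by rewrite -(wsum_adj _ F2); apply: eq_bigl => d; rewrite adjF.
  have wT : wsum (adj T) w = 2 * weight G T by rewrite -(wsum_adj _ T2).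
  move: wH; rewrite wF wT; move: (eps ^+ 2) (eps ^+ 2 + _) (weight G F) (weight G T) => d c a b.
  rewrite (_ : d * (2 * a) = 2 * (d * a)); last by ring.
  rewrite (_ : J%:R * (c * (2 * b)) = 2 * (J%:R * (c * b))); last by ring.
  by rewrite ler_pM2l.
move=> u v euv; have wHw : weighted H w by split=> // a b /He/w0.
have /(nearP wHw)[p [pp lp wp]] := near_ u v euv.
exists p; split=> //; last by rewrite walk_weightE.
by rewrite (eq_path adjF).
Qed.

From mathcomp Require Import all_classical all_reals all_analysis.

(** * Numerical bounds *)

Lemma spanner_of_edges (R : realType) (V : finType) (G : wgraph R V) (F : {set {set V}}) (t : R) :
  0 < t -> F \subset edges G ->
  (forall u v, adj (edges G) u v -> exists p, [/\ path (adj F) u p, last u p = v &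
    walk_weight G u p <= t * wt G [set u; v]%SET]) -> is_spanner G t F.
Proof.
move=> t0 FE edge; split=> // u v.
have walk p : path (adj (edges G)) u p -> exists q, [/\ path (adj F) u q, last u q = last u p &
    walk_weight G u q <= t * walk_weight G u p].
  elim: p u => [|y p IH] a /=.
    by exists [::]; split=> //; rewrite !walk_weightE mulr0.
  case/andP => /edge[q1 [pq1 lq1 wq1]] /IH[q2 [pq2 lq2 wq2]].
  exists (q1 ++ q2); rewrite cat_path last_cat lq1 pq1 lq2; split=> //.
  move: wq1 wq2; rewrite !walk_weightE ww_cat /= lq1 mulrDr; exact: lerD.
rewrite -lee_pdivrMl //; apply: le_ereal_inf_tmp => _ [p [pp lp ->]].
rewrite lee_pdivrMl // -EFinM; have [q [pq lq wq]] := walk p pp.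
apply: (@le_trans _ _ (walk_weight G u q)%:E); last by rewrite lee_fin.
by apply: ereal_inf_lbound; exists q; rewrite lq lp.
Qed.

Section Numerics.
Variable R : realType.
Implicit Types (x eps : R).

(** Follows from [1 - x / 2 <= expR (- (x / 2))] and [1 <= (1 - x / 2) * (1 + x)]; it bounds powers
    of [1 + x] from below. *)
Lemma expR_half_le x : 0 <= x <= 1 -> expR (x / 2) <= 1 + x.
Proof.
move=> /andP[x0 x1]; have h : 1 - x / 2 <= expR (- (x / 2)) by apply: expR_ge1Dx.
have y0 : 0 < 1 - x / 2 by move: x1; lra.
rewrite -[expR _]invrK -expRN -[leRHS]invrK lef_pV2 ?posrE ?invr_gt0 ?expR_gt0 //; last by move: x0; lra.
apply: le_trans h; rewrite -div1r ler_pdivrMr; last by move: x0; lra.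
rewrite (_ : (1 - x / 2) * (1 + x) = 1 + x * (1 - x) / 2); last by field.
by rewrite lerDl divr_ge0 // mulr_ge0 // subr_ge0.
Qed.

Lemma ln_inv_ge eps : 0 < eps -> 1 - eps <= ln (1 / eps).
Proof.
move=> e0; have := expR_ge1Dx (ln eps); rewrite lnK ?posrE // div1r lnV ?posrE //.
move: (ln eps) => y; lra.
Qed.

(** The construction runs with [eps / 100], as its stretch carries the factor [1 + 100 * eps]. For
    [J] above [600 * ln (1 / eps) / eps] the power [(1 + eps / 100) ^+ J] is at least
    [expR (3 * ln (1 / eps))], that is [1 / eps ^+ 3]. *)
Lemma scale_count eps : 0 < eps -> 10 * eps <= 1 -> exists J : nat,
  [/\ (0 < J)%N, 1 <= eps / 100 * (1 + eps / 100) ^+ J & eps * J%:R <= 601 * ln (1 / eps)].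
Proof.
move=> e0 e1; set l := ln (1 / eps).
have l1 : 1 - eps <= l := ln_inv_ge e0.
pose y := 600 * l / eps.
have l0 : 0 <= l by move: l1 e1; lra.
have y0 : 0 <= y by apply: divr_ge0 (ltW e0); apply: mulr_ge0 l0; apply: ler0n.
have /andP[le lt] := Num.Theory.truncn_itv y0.
exists (Num.truncn y).+1; split=> //; last first.
  rewrite -natr1 mulrDr mulr1; have := ler_wpM2l (ltW e0) le.
  rewrite /y [eps * (_ / _)]mulrC divfK ?gt_eqF //; move: l1 e1 e0; lra.
set J := (Num.truncn y).+1.
have e100 : 0 <= eps / 100 <= 1 by move: e0 e1; lra.
have h1 : expR (3 * l) <= (1 + eps / 100) ^+ J.
  apply: le_trans (_ : expR (eps / 100 / 2) ^+ J <= _); last first.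
    by apply: lerXn2r; rewrite ?nnegrE ?expR_ge0 ?expR_half_le //; move: e0; lra.
  rewrite -expRM_natr ler_expR; have := ler_wpM2l (ltW e0) (ltW lt).
  rewrite /y [eps * (_ / _)]mulrC divfK ?gt_eqF // -/J; move: (J%:R) => j; lra.
have el : expR l = 1 / eps by rewrite lnK // posrE divr_gt0.
apply: le_trans (_ : eps / 100 * expR (3 * l) <= _); last first.
  by rewrite ler_pM2l // divr_gt0.
rewrite [3 * l]mulrC expRM_natr el !exprS expr0 mulr1 !mul1r.
have -> : eps / 100 * (eps^-1 * (eps^-1 * eps^-1)) = (eps^-1 / 10) * (eps^-1 / 10).
  by field; rewrite gt_eqF.
have h : 1 <= eps^-1 / 10.
  by rewrite ler_pdivlMr ?ltr0n // mul1r -[eps^-1]div1r ler_pdivlMr.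
by rewrite -[leLHS]mulr1 ler_pM.
Qed.

Lemma trunc_log_le h : (0 < h)%N -> (trunc_log 2 h)%:R <= 2 * ln h%:R :> R.
Proof.
move=> h0; have le : (2 ^ trunc_log 2 h <= h)%N by apply: trunc_logP.
have h1 : (0 : R) < h%:R by rewrite ltr0n.
have : ln (2 ^+ trunc_log 2 h) <= ln h%:R :> R.
  by rewrite ler_ln ?posrE ?exprn_gt0 // -natrX ler_nat.
rewrite lnXn // -[_ *+ trunc_log _ _]mulr_natl => le2.
have ln2 : 1 / 2 <= ln 2 :> R.
  have half0 : (0 : R) < 1 / 2 by rewrite divr_gt0.
  have := ln_inv_ge half0; rewrite (_ : 1 / (1 / 2) = 2 :> R); last by field.
  by move=> h2; apply: le_trans h2; lra.
have : (trunc_log 2 h)%:R * (1 / 2) <= (trunc_log 2 h)%:R * ln 2 :> R by rewrite ler_wpM2l // ler0n.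
move: le2; move: (_ * ln 2) => z; lra.
Qed.

(** [D] is just above the root [2 ^ 31 * M ^ (2 / (k + 1))] of the density bound. As the exponent is
    at most 1, the factor [2 ^ 13 * m] of [M] enters at most linearly; rounding and
    [m <= 2 * (1 + ln h)] add one factor 2 each, hence [2 ^ 46]. *)
Lemma sparsity_exists h k : (0 < h)%N -> (0 < k)%N -> exists D : nat,
  [/\ (0 < D)%N, (2 ^ (31 * k.+1) * minor_density h ^ 2 < D ^ k.+1)%N &
   D%:R <= 2 ^+ 46 * (h%:R `^ (2 / (k%:R + 1)) * (1 + ln h%:R)) :> R].
Proof.
move=> h0 k0; set a : R := 2 / (k%:R + 1).
have k1 : (0 : R) < k%:R + 1 by rewrite ltr_wpDl ?ler0n.
have k2 : (2 : R) <= k%:R + 1 by have : (1 : R) <= k%:R; [rewrite ler1n|lra].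
have a0 : 0 <= a by rewrite divr_ge0 // ltW.
have a1 : a <= 1 by rewrite ler_pdivrMr // mul1r.
pose m : R := (trunc_log 2 h).+1%:R; pose M : R := (minor_density h)%:R.
have m1 : 1 <= m by rewrite ler1n.
have h1 : (1 : R) <= h%:R by rewrite ler1n.
have ME : M = h%:R * (2 ^+ 13 * m) by rewrite /M /minor_density natrM natrM natrX /m [_ * h%:R]mulrC mulrA.
have p13 : (1 : R) <= 2 ^+ 13 by rewrite exprn_ege1 // ler1n.
have M1 : 1 <= M by rewrite ler1n; apply: minor_density_gt0.
pose Y := 2 ^+ 31 * M `^ a.
have p31 : (1 : R) <= 2 ^+ 31 by rewrite exprn_ege1 // ler1n.
have Ma1 : 1 <= M `^ a by rewrite -(powRr0 M) ler_powR.
have Y1 : 1 <= Y by rewrite -[leLHS]mulr1 ler_pM.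
have Y0 : 0 <= Y by apply: le_trans Y1.
have /andP[le lt] := Num.Theory.truncn_itv Y0.
exists (Num.truncn Y).+1; split=> //.
  rewrite -(ltr_nat R) natrM !natrX exprM.
  have -> : (minor_density h)%:R ^+ 2 = (M `^ a) ^+ k.+1.
    rewrite -[RHS]powR_mulrn ?powR_ge0 // -powRrM -natr1 /a divfK ?gt_eqF //.
    by rewrite powR_mulrn // (le_trans _ M1).
  by rewrite -exprMn ltrXn2r.
have Mle : M `^ a <= h%:R `^ a * (2 ^+ 13 * m).
  rewrite ME powRM //; last first.
    by rewrite mulr_ge0 // (le_trans _ m1).
  rewrite ler_wpM2l ?powR_ge0 // -[leRHS]powRr1; last by rewrite mulr_ge0 // (le_trans _ m1).
  by rewrite ler_powR // -[leLHS]mulr1 ler_pM.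
have mle : m <= 2 * (1 + ln h%:R).
  rewrite /m -natr1; have := trunc_log_le h0; have := ln_ge0 h1; move: (ln _) => z; lra.
rewrite -natr1; apply: le_trans (_ : 2 * Y <= _).
  by move: le Y1; lra.
rewrite /Y; apply: le_trans (_ : 2 * (2 ^+ 31 * (h%:R `^ a * (2 ^+ 13 * (2 * (1 + ln h%:R))))) <= _).
  rewrite ler_pM2l // ler_pM2l ?exprn_gt0 //; apply: le_trans Mle _.
  by rewrite ler_wpM2l ?powR_ge0 // ler_pM2l ?exprn_gt0.
have -> : 2 ^+ 46 = 2 * (2 ^+ 31 * (2 ^+ 13 * 2)) :> R by rewrite -!exprSr -exprD -exprS.
by rewrite le_eqVlt; apply/orP; left; apply/eqP; move: (2 ^+ 31) (2 ^+ 13) => u v; ring.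
Qed.

(** The constant 433 is [1 + 144 * 3], which bounds the bracket by a multiple of [D]; [100 ^ 2]
    undoes the rescaling of [eps], and one more factor [eps] is spent on [J]. *)
Lemma lightness_numeric (eps l J D P B wF wT : R) : 0 < eps <= 1 -> 0 <= J -> 1 <= D -> 0 <= wT -> 0 <= l ->
  (eps / 100) ^+ 2 * wF <= J * (((eps / 100) ^+ 2 + 2 * (72 * (2 * D + 1))) * wT) ->
  eps * J <= 601 * l -> D <= B * P ->
  eps ^+ 3 * wF <= 100 ^+ 2 * 433 * 601 * B * (P * l) * wT.
Proof.
move=> /andP[e0 e1] J0 D1 wT0 l0 light Jl DB.
have X1 : (eps / 100) ^+ 2 <= 1 by rewrite exprn_ile1 //; move: e0 e1; lra.
have h1 : (eps / 100) ^+ 2 * wF <= J * (433 * D * wT).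
  apply: le_trans light _; apply: ler_wpM2l => //; apply: ler_wpM2r => //.
  move: X1 D1; move: ((eps / 100) ^+ 2) => X; lra.
have D0 : 0 <= D by apply: le_trans D1.
have h2 : eps * J * (D * wT) <= 601 * l * (B * P * wT).
  apply: ler_pM => //; first by rewrite mulr_ge0 // ltW.
    exact: mulr_ge0.
  exact: ler_wpM2r.
have h3 := ler_wpM2l (ltW e0) h1.
have -> : eps ^+ 3 * wF = 100 ^+ 2 * (eps * ((eps / 100) ^+ 2 * wF)) by field.
have -> : 100 ^+ 2 * 433 * 601 * B * (P * l) * wT = 100 ^+ 2 * (433 * (601 * l * (B * P * wT))) by ring.
rewrite ler_pM2l ?exprn_gt0 //; apply: le_trans h3 _.
have -> : eps * (J * (433 * D * wT)) = 433 * (eps * J * (D * wT)) by ring.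
by apply: ler_wpM2l h2; apply: ler0n.
Qed.
End Numerics.

Theorem theorem17 (R : realType) :
  exists (C eps0 : R) (polylog : nat -> R),
    [/\ 0 < C, 0 < eps0, is_polylog polylog &
    forall (k h n : nat) (eps : R),
      (0 < k)%N -> (0 < h)%N -> (0 < n)%N -> 0 < eps < eps0 ->
      forall (V : finType) (G : wgraph R V),
        #|V| = n -> clique_minor_free h (edges G) ->
        exists H : {set {set V}},
          is_spanner G ((1 + eps) * (2 * k%:R - 1)) H /\
          forall T : {set {set V}}, is_mst G T ->
            lightness G T H <=
              C * (h%:R `^ (2 / (k%:R + 1)) * polylog h *
                   (1 / eps ^+ 3) * ln (1 / eps))].
Proof.
pose C0 : R := 100 ^+ 2 * 433 * 601.
have C00 : 0 < C0 by do 2!(apply: mulr_gt0; last exact: ltr0n); apply: exprn_gt0.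
exists (C0 * 2 ^+ 46), (1 / 10), (fun h => 1 + ln h%:R); split.
- by rewrite mulr_gt0 // exprn_gt0.
- by rewrite divr_gt0.
- exists (1 + 'X)%R => h h0; rewrite !hornerE ger0_norm // addr_ge0 // ln_ge0 //.
  by rewrite ler1n.
move=> k h n eps k0 h0 _ /andP[e0 e1] V G _ free.
have e10 : 10 * eps <= 1 by move: e1; lra.
have kk : (2 * k).-1%:R = 2 * k%:R - 1 :> R.
  by rewrite -subn1 natrB ?natrM // muln_gt0.
have t0 : 0 < (1 + eps) * (2 * k%:R - 1).
  rewrite mulr_gt0 //; first by move: e0; lra.
  by rewrite -kk ltr0n; case: k k0 {kk} => // j _; rewrite mulnS.
(* Without a minimum spanning tree the lightness bound quantifies over nothing, and [edges G] itself
   is a spanner. *)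
have [[T mstT]|none] := pselect (exists T, is_mst G T); last first.
  exists (edges G); split; last by move=> T mstT; case: none; exists T.
  apply: spanner_of_edges => // u v euv; exists [:: v]; split=> //=; first by rewrite euv.
  rewrite walk_weightE /= addr0 ler_peMl //; first by apply/ltW/wt_gt0.
  have : 1 <= 2 * k%:R - 1 :> R by rewrite -kk ler1n; case: k k0 {kk t0} => // j _; rewrite mulnS.
  have : 0 <= eps * (2 * k%:R - 1) by apply: mulr_ge0; [exact: ltW|rewrite -kk ler0n].
  by rewrite [(1 + eps) * _]mulrDl mul1r; move: (eps * _) => u1 u2 u3; apply: le_trans u3 _; rewrite lerDl.
have [J [J0 epsJ Jle]] := scale_count e0 e10.
have [D [D0 HD Dle]] := @sparsity_exists R h k h0 k0.
have x0 : 0 < eps / 100 by rewrite divr_gt0.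
have x1 : 1000 * (eps / 100) <= 1 by move: e10; lra.
have [F [FE light span]] := light_spanner mstT.1 free k0 h0 HD x0 x1 J0 epsJ.
exists F; split.
  apply: spanner_of_edges => // u v /span[p [pp lp wp]]; exists p; split=> //.
  by apply: le_trans wp _; rewrite -kk le_eqVlt; apply/orP; left; apply/eqP; field.
move=> T' [spanT' minT'].
have wTE : weight G T' = weight G T.
  by apply/eqP; rewrite eq_le mstT.2 // minT' //; case: mstT.
have wT0 : 0 <= weight G T.
  by apply: sumr_ge0 => s sT; apply/ltW/wt_gt0; case: mstT => -[/fintype.subsetP sub _ _] _; apply: sub.
set l := ln (1 / eps) in Jle *; set P := _ `^ _ * _ in Dle *.
have l0 : 0 <= l by have := ln_inv_ge e0; rewrite -/l; move: e10; lra.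
have P0 : 0 <= P by rewrite mulr_ge0 ?powR_ge0 // addr_ge0 // ln_ge0 // ler1n.
have main : eps ^+ 3 * weight G F <= C0 * 2 ^+ 46 * (P * l) * weight G T.
  apply: lightness_numeric (wT0) l0 _ Jle Dle; rewrite ?ler0n ?ler1n //.
    by rewrite e0; move: e10 e0; lra.
  by move: light; rewrite natrD natrM.
rewrite /lightness wTE.
have i0 : 0 <= 1 / eps ^+ 3 by rewrite div1r invr_ge0 exprn_ge0 // ltW.
have B0 : 0 <= C0 * 2 ^+ 46 * (P * (1 / eps ^+ 3) * l).
  by apply: mulr_ge0; [apply/ltW/mulr_gt0; rewrite ?exprn_gt0|apply: mulr_ge0 => //; apply: mulr_ge0].
(* Division by 0 yields 0, so the bound holds in this case because its right-hand side is
   nonnegative. *)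
have [->|wTn0] := eqVneq (weight G T) 0; first by rewrite invr0 mulr0.
have wTp : 0 < weight G T by rewrite lt_neqAle eq_sym wTn0.
rewrite ler_pdivrMr // -(ler_pM2l (exprn_gt0 3 e0)); apply: le_trans main _.
rewrite le_eqVlt; apply/orP; left; apply/eqP; move: (C0) (2 ^+ 46) => c b; field; exact: lt0r_neq0.
Qed.
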